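(* For every integer $n\geq 2$ there exists a quasiperiodic (i.e. uniformly recurrent) edge-to-edge substitution tiling of the plane, with prototiles the $\lfloor n/2\rfloor$ unit rhombuses with angles $\frac{x\pi}{n}$ and $\frac{y\pi}{n}$ ($x,y$ positive integers, $x+y=n$), that has $2n$-fold rotational symmetry.
   Context: **Prototiles.** Fix an integer $n\ge 2$. For positive integers $x,y$ with $x+y=n$, $(x,y)$ denotes the rhombus with sides of length $1$ and angles $\frac{x\pi}{n}$ and $\frac{y\pi}{n}$; $(x,y)$ and $(y,x)$ are the same shape, so there are $\lfloor n/2\rfloor$ prototiles. **Tiles, patches, tilings.** A tile is a copy $\varphi(T)$ of a prototile $T$ under an orientation-preserving isometry $\varphi$ of the plane. A tile is understood to come with its isometry $\varphi$ (this matters only for applying a substitution, because rhombuses have nontrivial symmetries). A collection of tiles is edge-to-edge if any two distinct tiles in it are either disjoint, or intersect in exactly one common vertex, or intersect in exactly one common edge. A patch is a finite edge-to-edge collection of tiles with pairwise disjoint interiors. A tiling is an edge-to-edge collection of tiles with pairwise disjoint interiors whose union is the whole plane. A patch $P$ appears in a collection $Q$ of tiles if some image of $P$ under an orientation-preserving isometry of the plane is a subcollection of $Q$. **Substitutions.** A substitution consists of a scaling factor $\lambda>1$ and a substitution rule, which assigns to each prototile $T$ a patch $\omega(T)$ that replaces the enlarged tile $\lambda T$ and whose total area equals the area of $\lambda T$. (The boundary of $\omega(T)$ need not coincide with the boundary of $\lambda T$.) It is extended to tiles by $\omega(\varphi(T))=\varphi_\lambda(\omega(T))$, where $\varphi_\lambda$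 is the isometry $z\mapsto \lambda\,\varphi(z/\lambda)$, and to collections of tiles by taking the union of the images of the tiles. The substitution is required to be consistent: for every prototile $T$ and every $k\ge 0$, the $k$'th order image $\omega^k(T)$ is a patch (the images of different tiles do not overlap, leave no gaps between neighbouring enlarged tiles, and fit edge-to-edge). **Substitution tilings.** A patch is legal (for a given substitution) if it appears in $\omega^k(T)$ for some prototile $T$ and some $k\geq 0$. A substitution tiling is a tiling for which there is a substitution such that every finite patch of tiles present in the tiling is legal. **Quasiperiodicity.** A tiling is uniformly recurrent (equivalently, quasiperiodic or repetitive) if for every finite patch that appears in the tiling there is a $D>0$ (possibly depending on the patch) such that the patch appears in the tiling within distance $D$ of every point of the plane. **Rotational symmetry.** A tiling has $m$-fold rotational symmetry if there is a point $P$ such that the tiling is invariant under the rotation around $P$ by the angle $\frac{2\pi}{m}$. *)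

(* Defs.v *)
From HB Require Import structures.
From mathcomp Require Import all_boot all_order all_algebra.
From mathcomp Require Import complex.
From mathcomp Require Import all_classical all_reals all_analysis.

Set Implicit Arguments.
Unset Strict Implicit.
Unset Printing Implicit Defensive.

Import Order.TTheory GRing.Theory Num.Theory.
Import numFieldNormedType.Exports.

Local Open Scope classical_set_scope.
Local Open Scope ring_scope.

(* The Euclidean plane is the complex plane.  The regular algebra [R[i]^o] is
   used because it carries the topology of the modulus. *)
Definition plane (R : realType) : Type := (R[i])^o.

Section Plane.
Variable R : realType.
Local Notation plane := (plane R).

Definition cis (t : R) : plane := Complex (cos t) (sin t).

(* Two-dimensional Lebesgue measure. *)
Definition area (A : set plane) : \bar R :=
  (lebesgue_measure \x lebesgue_measure)%E
    [set p : R * R | A (Complex p.1 p.2)].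

Definition scale (lambda : R) (z : plane) : plane := real_complex R lambda * z.

Definition segment (a b : plane) : set plane :=
  [set z | exists2 t : R, 0 <= t <= 1 & z = a + scale t (b - a)].

(* Orientation-preserving isometries z |-> rot * z + trans, |rot| = 1. *)
Record motion := Motion {
  rot : plane;
  trans : plane;
  rot_norm : `|rot| == 1 }.

Definition motion_fun (g : motion) (z : plane) : plane := rot g * z + trans g.

Lemma motion1_norm : `|1 : plane| == 1.
Proof. by rewrite normr1. Qed.

Definition motion1 : motion := Motion 0 motion1_norm.

Lemma motionM_norm (g h : motion) : `|rot g * rot h| == 1.
Proof. by rewrite normrM (eqP (rot_norm g)) (eqP (rot_norm h)) mulr1. Qed.

Definition motionM (g h : motion) : motion :=
  Motion (rot g * trans h + trans g) (motionM_norm g h).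

Lemma motionME (g h : motion) (z : plane) :
  motion_fun (motionM g h) z = motion_fun g (motion_fun h z).
Proof. by rewrite /motion_fun /= mulrDr mulrA addrA. Qed.

(* phi_lambda : z |-> lambda * phi (z / lambda). *)
Definition motion_scale (lambda : R) (g : motion) : motion :=
  Motion (scale lambda (trans g)) (rot_norm g).

Lemma motion_scaleE (lambda : R) (g : motion) (z : plane) : lambda != 0 ->
  motion_fun (motion_scale lambda g) z =
  scale lambda (motion_fun g (scale lambda^-1 z)).
Proof.
move=> l0; rewrite /motion_fun /scale /= mulrDr; congr (_ + _).
rewrite mulrCA; congr (_ * _).
by rewrite mulrA -rmorphM divff // rmorph1 mul1r.
Qed.

Section Tilings.
Variable n : nat.

(* The index i stands for the rhombus (x, y) with x = i + 1, y = n - x; as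
   i < n./2, each unordered pair {x, y} is represented exactly once. *)
Definition proto := 'I_(n./2).

(* Second side of the rhombus with a vertex at 0 and first side 1; the angle
   at 0 is x * pi / n. *)
Definition proto_side (T : proto) : plane := cis (T.+1%:R * pi / n%:R).

Definition proto_region (T : proto) : set plane :=
  [set z | exists a b : R, [/\ 0 <= a <= 1, 0 <= b <= 1 &
     z = scale a 1 + scale b (proto_side T)]].

Definition proto_vertices (T : proto) : set plane :=
  [set z | [\/ z = 0, z = 1, z = 1 + proto_side T | z = proto_side T]].

Definition proto_edges (T : proto) : set (set plane) :=
  [set e | [\/ e = segment 0 1,
               e = segment 1 (1 + proto_side T),
               e = segment (1 + proto_side T) (proto_side T) |
               e = segment (proto_side T) 0]].

(* A tile comes with its isometry; the underlying point set is [region]. *)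
Record tile := Tile { tproto : proto; tmotion : motion }.

HB.instance Definition _ := gen_eqMixin tile.
HB.instance Definition _ := gen_choiceMixin tile.

Definition region (t : tile) : set plane :=
  motion_fun (tmotion t) @` proto_region (tproto t).

Definition vertices (t : tile) : set plane :=
  motion_fun (tmotion t) @` proto_vertices (tproto t).

Definition edges (t : tile) : set (set plane) :=
  [set motion_fun (tmotion t) @` e | e in proto_edges (tproto t)].

Definition proto_tile (T : proto) : tile := Tile T motion1.

Definition move_tile (g : motion) (t : tile) : tile :=
  Tile (tproto t) (motionM g (tmotion t)).

Definition support (Q : set tile) : set plane := \bigcup_(t in Q) region t.

(* Distinct tiles with the same region also violate this, so in an
   edge-to-edge collection a region occurs with a single isometry. *)
Definition edge_to_edge (Q : set tile) : Prop :=
  forall t t', Q t -> Q t' -> t <> t' ->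
  [\/ region t `&` region t' = set0,
      exists v, [/\ vertices t v, vertices t' v &
                    region t `&` region t' = [set v]] |
      exists e, [/\ edges t e, edges t' e & region t `&` region t' = e]].

Definition disjoint_interiors (Q : set tile) : Prop :=
  forall t t', Q t -> Q t' -> t <> t' ->
  interior (region t) `&` interior (region t') = set0.

Definition is_patch (P : set tile) : Prop :=
  [/\ finite_set P, edge_to_edge P & disjoint_interiors P].

Definition is_tiling (Q : set tile) : Prop :=
  [/\ edge_to_edge Q, disjoint_interiors Q & support Q = [set: plane]].

(* The isometry that comes with a tile only matters for applying a
   substitution; occurrence and symmetry compare tiles as point sets. *)
Definition shapes (Q : set tile) : set (set plane) := region @` Q.

Definition occurrence (g : motion) (P Q : set tile) : Prop :=
  shapes (move_tile g @` P) `<=` shapes Q.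

Definition appears (P Q : set tile) : Prop := exists g, occurrence g P Q.

Definition subst_tile (lambda : R) (omega : proto -> set tile) (t : tile) :
    set tile :=
  move_tile (motion_scale lambda (tmotion t)) @` omega (tproto t).

Definition subst (lambda : R) (omega : proto -> set tile) (Q : set tile) :
    set tile :=
  \bigcup_(t in Q) subst_tile lambda omega t.

Definition subst_iter (lambda : R) (omega : proto -> set tile) (k : nat)
    (T : proto) : set tile :=
  iter k (subst lambda omega) [set proto_tile T].

(* Every omega^k(T) is a patch.  Since [subst] is a union of sets, it would
   silently merge a tile produced by two different parents, so absence of
   overlaps is required of the images themselves.  Absence of gaps: an enlarged
   tile whose original is surrounded by its neighbours is covered by the image
   of the patch (not only by its own image, since the boundary of omega(T) may
   differ from that of lambda T). *)
Definition consistent (lambda : R) (omega : proto -> set tile) : Prop :=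
  forall (T : proto) (k : nat),
  let Q := subst_iter lambda omega k T in
  [/\ is_patch Q,
      forall t t', Q t -> Q t' -> t <> t' ->
        forall s s', subst_tile lambda omega t s ->
          subst_tile lambda omega t' s' ->
          interior (region s) `&` interior (region s') = set0 &
      forall t, Q t -> region t `<=` interior (support Q) ->
        scale lambda @` region t `<=` support (subst lambda omega Q)].

Definition is_substitution (lambda : R) (omega : proto -> set tile) : Prop :=
  [/\ 1 < lambda,
      forall T, is_patch (omega T),
      forall T, (\sum_(t \in omega T) area (region t))%E =
                area (scale lambda @` proto_region T) &
      consistent lambda omega].

Definition legal (lambda : R) (omega : proto -> set tile) (P : set tile) :
    Prop :=
  exists (T : proto) (k : nat), appears P (subst_iter lambda omega k T).

Definition is_substitution_tiling (Q : set tile) : Prop :=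
  is_tiling Q /\
  exists (lambda : R) (omega : proto -> set tile),
    is_substitution lambda omega /\
    forall P, is_patch P -> P `<=` Q -> legal lambda omega P.

(* An occurrence is within distance D of z when it lies in the closed disc of
   radius D about z; asking only that it meet the disc amounts to changing D
   by the diameter of the patch. *)
Definition uniformly_recurrent (Q : set tile) : Prop :=
  forall P, is_patch P -> appears P Q ->
  exists2 D : R, 0 < D &
    forall z : plane, exists2 g : motion, occurrence g P Q &
      forall p, support (move_tile g @` P) p -> `|p - z| <= real_complex R D.

Definition rotation (c : plane) (theta : R) (z : plane) : plane :=
  c + cis theta * (z - c).

Definition rotational_symmetry (m : nat) (Q : set tile) : Prop :=
  exists c : plane,
    [set rotation c (2 * pi / m%:R) @` A | A in shapes Q] = shapes Q.

End Tilings.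
End Plane.

Arguments tile R n : clear implicits.

(* Main.v *)
(* Let theta = pi/n and U d = cis (d theta).  Every unit edge is replaced by the
   same lattice path: the direction U a, |2a| < n, occurs mult a = 2(n^2+1)(n^2-4a^2)
   times, and its k-th occurrence is put at the fraction (2k+1)/(2 mult a) of the
   edge.  The four paths around a rhombus form a closed word whose letters are
   joined in pairs by straight chords in an affine copy of the square.  A chord of
   direction d has slope governed by mult d and mult (d - x), and strict
   concavity of mult makes any two crossing chords positively oriented; hence the
   chords can be peeled off one by one, each crossing contributing a genuine
   rhombus, until only the 2n central double chords remain.  These bound a regular
   2n-gon of side 2, which is filled by rings of rhombuses around a star of 2n
   narrow ones.  Swapping the two letters at one corner first puts the prototile
   itself in that corner.

   That a list of tiles covers a disc is expressed by chains: the sum over the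
   tiles of an antisymmetric function of oriented edges telescopes.  Applied to the
   crossing number with a vertical ray it counts the tiles over a point; applied to
   the indicator of an edge it yields the neighbour across that edge.  As the
   substitution acts on such functions by summing along edge paths, and each path
   stays in a thin diamond contained in the two tiles sharing its edge, covering
   and edge-to-edge properties pass from a patch to its image.

   The star is contained in its own image and, translated, in the image of every
   tile; the increasing union of its iterates is the required tiling. *)
From HB Require Import structures.
From mathcomp Require Import all_boot all_order all_algebra.
From mathcomp Require Import zify ring lra.
Set Implicit Arguments.
Unset Strict Implicit.
Unset Printing Implicit Defensive.

(** All that is needed of the multiplicities is the sign of a 2 by 2 determinant, which for exact
    cosines is a product of two sines; the parabola keeps this sign and has integer values. The
    factor 2 makes them even, so that no chord passes through the centre of the square and each
    direction has exactly two innermost chords. The factor n^2+1 makes innermost chords of different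
    directions cross inside the square, which forces the same 2n-gon into every image.

    Several letters may share a point of the boundary, and several chords a crossing. Hence peeling
    uses only the cyclic order of the letters, and geometry enters through the orientation of
    triples.

    The corner swap makes a prototile reproduce itself at a fixed corner; the star, whose tiles meet
    at such corners, then grows under iteration. A star in every image yields legality and
    recurrence together.

    Since images overhang the enlarged tiles, no image can be studied alone: each patch is treated
    as a part of lists covering arbitrarily large discs. *)

Module CyclicPeeling.
Import Order.TTheory GRing.Theory Num.Theory.
Local Open Scope ring_scope.

(** * Cyclic order and the peeling of chords *)

Definition cyc3 (i j k : nat) : bool :=
  [|| (i < j < k)%N, (j < k < i)%N | (k < i < j)%N].

Lemma cyc3P i j k : reflect
  ((i < j /\ j < k) \/ (j < k /\ k < i) \/ (k < i /\ i < j))%coq_nat (cyc3 i j k).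
Proof. by apply: (iffP idP); rewrite /cyc3; lia. Qed.

Ltac cyc_lia := intros;
  repeat match goal with H : is_true (cyc3 _ _ _) |- _ => move/cyc3P in H end;
  repeat match goal with H : _ \/ _ |- _ => destruct H; try (exfalso; lia) end;
  try apply/cyc3P; lia.

Lemma cyc3_flip i j k : i != j -> j != k -> k != i -> ~~ cyc3 i j k -> cyc3 i k j.
Proof. by rewrite /cyc3; lia. Qed.

(** Here the arc from [f] to [f'] is nested in the arc from [e] to [g]; chords cutting off nested
    arcs are compared in this way. *)
Lemma cyc3_sub e f f' g x :
  cyc3 e f g -> cyc3 e f' g -> cyc3 e f f' -> cyc3 f x f' -> cyc3 e x g.
Proof. by cyc_lia. Qed.

Lemma cyc3_trans e f g h : cyc3 e f g -> cyc3 e g h -> cyc3 e f h.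
Proof. by cyc_lia. Qed.

Lemma cyc3_neq i j k : cyc3 i j k -> [/\ i != j, j != k & k != i].
Proof. by rewrite /cyc3 => h; split; lia. Qed.

Section Cyclic.
Variable E : eqType.
Implicit Types (s : seq E) (a b c e : E).

Definition cyc s a b c := cyc3 (index a s) (index b s) (index c s).

Lemma cycR s a b c : cyc s a b c = cyc s b c a.
Proof. rewrite /cyc /cyc3; lia. Qed.

Lemma index_rcons_notin s e a : e \notin s -> a \in s ->
  index a (rcons s e) = index a s.
Proof. by move=> _ ha; rewrite -cats1 index_cat ha. Qed.

Lemma cyc_rcons e s a b c : uniq (e :: s) ->
  a \in e :: s -> b \in e :: s -> c \in e :: s ->
  cyc (rcons s e) a b c = cyc (e :: s) a b c.
Proof.
move=> /= /andP[es us].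
have idx x : x \in e :: s -> index x (rcons s e) =
    (if x == e then size s else index x s)%N /\
    index x (e :: s) = (if x == e then 0%N else (index x s).+1) /\
    (x != e -> index x s < size s)%N.
  rewrite inE; case: eqVneq => [->|ne] /=.
    by rewrite eqxx -cats1 index_cat (negbTE es) /= eqxx addn0.
  by rewrite eq_sym (negbTE ne) => xs; rewrite index_rcons_notin // index_mem.
move=> /idx[ia [ia' la]] /idx[ib [ib' lb]] /idx[ic [ic' lc]].
rewrite /cyc ia ia' ib ib' ic ic' /cyc3.
move: la lb lc; case: (a == e); case: (b == e); case: (c == e) => /=; lia.
Qed.

Lemma cyc_rot i s a b c : uniq s -> a \in s -> b \in s -> c \in s ->
  cyc (rot i s) a b c = cyc s a b c.
Proof.
elim: i s => [|i IH] s us ha hb hc; first by rewrite rot0.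
case: s us ha hb hc => [|e s] us ha hb hc; first by [].
have [le|gt] := leqP (size (e :: s)) i.
  by rewrite rot_oversize // (leq_trans le).
have -> : rot i.+1 (e :: s) = rot i (rot 1 (e :: s)).
  by rewrite -addn1 rotD // addn1.
rewrite IH ?mem_rot ?rot_uniq //.
by rewrite rot1_cons cyc_rcons.
Qed.

Lemma index_filter_lt (P : pred E) s a b : a \in filter P s -> b \in filter P s ->
  (index a (filter P s) < index b (filter P s))%N = (index a s < index b s)%N.
Proof.
elim: s => //= x s IH.
case: ifPn => Px; last first.
  move=> ha hb; rewrite IH //.
  have [xa|_] := eqVneq x a; first by move: ha; rewrite mem_filter -xa (negbTE Px).
  have [xb|_] := eqVneq x b; first by move: hb; rewrite mem_filter -xb (negbTE Px).
  by rewrite ltnS.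
rewrite !inE /=; have [xa|na] := eqVneq x a.
  by have [xb|nb] := eqVneq x b; rewrite // ?ltn0.
have [xb|nb] := eqVneq x b; first by rewrite !ltn0.
by move=> /= ha hb; rewrite !ltnS IH.
Qed.

Lemma cyc_filter (P : pred E) s a b c :
  a \in filter P s -> b \in filter P s -> c \in filter P s ->
  cyc (filter P s) a b c = cyc s a b c.
Proof. by move=> ha hb hc; rewrite /cyc /cyc3 !index_filter_lt. Qed.

(** Read cyclically, the two lists differ by exchanging the neighbours [e] and [f]. Deleting one
    that is missing from the triple makes them equal or rotations of each other. *)
Lemma cyc_swap s e f a b c : uniq (e :: rcons s f) ->
  a \in e :: rcons s f -> b \in e :: rcons s f -> c \in e :: rcons s f ->
  (e \notin [:: a; b; c]) || (f \notin [:: a; b; c]) ->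
  cyc (rcons (rcons s e) f) a b c = cyc (e :: rcons s f) a b c.
Proof.
move=> us ha hb hc hn.
have pm : rcons (rcons s e) f =i e :: rcons s f.
  by move=> x; rewrite !(mem_rcons, inE) orbCA.
have us' : uniq (rcons (rcons s e) f).
  move: us; rewrite /= !rcons_uniq !mem_rcons !inE !negb_or (eq_sym f).
  by case/andP=> /andP[-> ->] /andP[-> ->].
have fl : filter (predC1 e) (rcons (rcons s e) f) = filter (predC1 e) (e :: rcons s f).
  by rewrite !filter_rcons /= eqxx /= filter_rcons.
have fr : filter (predC1 f) (rcons (rcons s e) f) = rcons (filter (predC1 f) s) e.
  rewrite !filter_rcons /= eqxx /=.
  by case: ifPn => //; move: us; rewrite /= mem_rcons inE => /andP[]; rewrite negb_or => /andP[->].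
have fr' : filter (predC1 f) (e :: rcons s f) = e :: filter (predC1 f) s.
  rewrite /= filter_rcons /= eqxx /=.
  by case: ifPn => //; move: us; rewrite /= mem_rcons inE => /andP[]; rewrite negb_or => /andP[->].
have fm (x y : E) (l : seq E) : x \in l -> y != x -> x \in filter (predC1 y) l.
  by move=> xl yx; rewrite mem_filter /= eq_sym yx.
case/orP: hn; rewrite !inE !negb_or => /and3P[na nb nc].
  transitivity (cyc (filter (predC1 e) (rcons (rcons s e) f)) a b c).
    by rewrite cyc_filter // fm // pm.
  by rewrite fl cyc_filter // fm.
transitivity (cyc (filter (predC1 f) (rcons (rcons s e) f)) a b c).
  by rewrite cyc_filter // fm // pm.
have uf : uniq (e :: filter (predC1 f) s) by rewrite -fr' filter_uniq.
by rewrite fr cyc_rcons // -fr' ?cyc_filter // fm.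
Qed.

Lemma cyc_flip s a b c : a \in s -> b \in s -> c \in s ->
  a != b -> b != c -> c != a -> ~~ cyc s a b c -> cyc s a c b.
Proof.
have idx x y : x \in s -> y \in s -> x != y -> index x s != index y s.
  by move=> xs ys; apply: contraNneq => h; rewrite -(nth_index x xs) h nth_index.
by move=> *; apply: cyc3_flip => //; apply: idx.
Qed.

Lemma cyc_neq s a b c : cyc s a b c -> [/\ a != b, b != c & c != a].
Proof.
by case/cyc3_neq => h1 h2 h3; split; [move: h1|move: h2|move: h3]; apply: contraNneq => ->.
Qed.

Lemma cyc_head s z a b : uniq (z :: s) -> a \in s -> b \in s ->
  cyc (z :: s) z a b = (index a s < index b s)%N.
Proof.
move=> /= /andP[zs _] ha hb.
rewrite /cyc /= eqxx !ifN; last 2 first.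
- by apply: contraNneq zs => ->.
- by apply: contraNneq zs => ->.
rewrite /cyc3; lia.
Qed.

(** Rotating [s] to start at [z] turns the cyclic order seen from [z] into the order of indices, and
    a strictly sorted list is determined by its members. *)
Lemma cyc_sorted_rot s (P : pred E) z t : uniq s -> uniq (z :: t) ->
  (forall x, (x \in z :: t) = (x \in s) && P x) ->
  pairwise (fun a b => cyc s z a b) t ->
  exists i, z :: t = rot i (filter P s).
Proof.
move=> us uz zt pt.
have zs : z \in s by move: (zt z); rewrite mem_head => /esym/andP[].
have Pz : P z by move: (zt z); rewrite mem_head => /esym/andP[].
set i := index z s.
have sE : s = take i s ++ z :: drop i.+1 s.
  by rewrite -[in LHS](cat_take_drop i s) (drop_nth z) ?index_mem // nth_index.
set s1 := take i s in sE; set s2 := drop i.+1 s in sE.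
have rs : rot i s = z :: s2 ++ s1.
  have si : size s1 = i by rewrite size_takel // index_size.
  by rewrite [in LHS]sE -si rot_size_cat.
have us' : uniq (z :: s2 ++ s1) by rewrite -rs rot_uniq.
have Et : t = filter P (s2 ++ s1).
  pose r a b := (index a (s2 ++ s1) < index b (s2 ++ s1))%N.
  have tr : transitive r by move=> ? ? ?; apply: ltn_trans.
  have memt x : (x \in t) = (x \in s2 ++ s1) && P x.
    move: (zt x); rewrite -(mem_rot i s) rs !inE.
    have [->|] := eqVneq x z; last by [].
    by case/andP: uz => /negbTE-> _ _; case/andP: us' => /negbTE-> _.
  apply: (@irr_sorted_eq _ r tr).
  - by move=> ?; rewrite /r ltnn.
  - rewrite sorted_pairwise //.
    apply: (sub_in_pairwise (P := mem t)) pt => [a b at_ bt_|]; last exact/allP.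
    move: (at_) (bt_); rewrite !memt => /andP[a1 _] /andP[b1 _].
    rewrite -(cyc_rot i us) // -?(mem_rot i s) ?rs ?mem_head ?inE ?a1 ?b1 ?orbT //.
    by rewrite cyc_head.
  - apply: sorted_filter => //.
    case/andP: us' => _; rewrite /r; elim: (s2 ++ s1) {tr} => //= x q IH /andP[xq uq].
    move: (IH uq) => {IH}; case: q xq uq => //= y q xq _ sq.
    rewrite eqxx; have ->: (x == y) = false by apply: contraNF xq => /eqP->; rewrite mem_head.
    rewrite /=; apply: (sub_in_path (P := mem (y :: q))) sq => [a b ha hb|]; last exact/allP.
    have nx c : c \in y :: q -> (x == c) = false by move=> hc; apply: contraNF xq => /eqP->.
    by rewrite /= !nx.
  - by move=> x; rewrite mem_filter andbC memt.
exists (size (filter P s1)).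
by rewrite [in RHS]sE filter_cat /= Pz rot_size_cat /= Et filter_cat.
Qed.
End Cyclic.

Lemma count_lt (T : eqType) (a b : pred T) (s : seq T) (x : T) :
  x \in s -> b x -> ~~ a x -> subpred a b -> (count a s < count b s)%N.
Proof.
move=> xs bx nax ab; elim: s xs => //= y s IH.
rewrite inE => /orP[/eqP<-|/IH lt].
  by rewrite bx (negbTE nax) ltnS sub_count.
by rewrite -addnS leq_add //; case: (a y) (ab y) => // ->.
Qed.

Lemma rot_rot_ex (T : Type) i j (s : seq T) : exists k, rot i (rot j s) = rot k s.
Proof.
have [le|/ltnW gt] := leqP (size s) j; first by exists i; rewrite (rot_oversize le).
have [le'|/ltnW gt'] := leqP (size s) i.
  by exists j; rewrite [LHS]rot_oversize // size_rot.
by rewrite rot_add_mod //; eexists.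
Qed.

Lemma filter_rot (T : Type) (P : pred T) i (s : seq T) :
  exists j, filter P (rot i s) = rot j (filter P s).
Proof.
exists (size (filter P (take i s))).
have -> : filter P s = filter P (take i s) ++ filter P (drop i s).
  by rewrite -filter_cat cat_take_drop.
by rewrite rot_size_cat /rot filter_cat.
Qed.

Section Paths.
Variables (V : zmodType) (A : comNzRingType) (E : eqType) (u : E -> V).
Implicit Types (Phi : V -> V -> A) (s : seq E) (p q : V).

Definition antisym Phi := forall a b, Phi b a = - Phi a b.

Fixpoint psum Phi p s : A :=
  if s is e :: s' then Phi p (p + u e) + psum Phi (p + u e) s' else 0.

Definition quad Phi (t : V * E * E) : A :=
  let: (q, e, f) := t in
  Phi q (q + u e) + Phi (q + u e) (q + u e + u f) +
  Phi (q + u e + u f) (q + u f) + Phi (q + u f) q.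

(** The row of parallelograms swept by the step [e] when it is carried along the path [s]. *)
Fixpoint strip p e s : seq (V * E * E) :=
  if s is f :: s' then (p, e, f) :: strip (p + u f) e s' else [::].

Lemma mem_strip t p e s : t \in strip p e s -> t.1.2 = e /\ t.2 \in s.
Proof.
elim: s p => //= f s IH p; rewrite inE => /orP[/eqP->|/IH[-> fs]].
  by split=> /=; rewrite ?inE ?eqxx.
by split; rewrite ?inE ?fs ?orbT.
Qed.

Lemma psum_cat Phi p s s' :
  psum Phi p (s ++ s') = psum Phi p s + psum Phi (p + \sum_(e <- s) u e) s'.
Proof.
elim: s p => [|e s IH] p /=; first by rewrite big_nil addr0 add0r.
by rewrite IH big_cons !addrA.
Qed.

Lemma psum_rot i p s : \sum_(e <- s) u e = 0 ->
  exists q, forall Phi, psum Phi p s = psum Phi q (rot i s).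
Proof.
move=> cl; exists (p + \sum_(e <- take i s) u e) => Phi.
move: cl; rewrite -[in X in X -> _](cat_take_drop i s) big_cat /= => cl.
by rewrite -[in LHS](cat_take_drop i s) /rot !psum_cat -addrA cl addr0 addrC.
Qed.

(** Carrying [e] past one letter [f] replaces the steps e, f by f, e at the cost of one
    parallelogram. When [e] reaches [e'], the two opposite steps cancel. *)
Lemma psum_strip Phi p e e' s s' : antisym Phi -> u e' = - u e ->
  psum Phi p (e :: s ++ e' :: s') =
  \sum_(t <- strip p e s) quad Phi t + psum Phi p (s ++ s').
Proof.
move=> aP ue; elim: s p => [|f s IH] p /=.
  by rewrite big_nil ue addrK (aP p) addrA subrr.
rewrite big_cons /=; have := IH (p + u f); rewrite /= (addrAC p (u f)) => H.
have -> : psum Phi (p + u e + u f) (s ++ e' :: s') =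
    \sum_(t <- strip (p + u f) e s) quad Phi t + psum Phi (p + u f) (s ++ s')
    - Phi (p + u f) (p + u e + u f) by rewrite -H; ring.
rewrite (aP p (p + u f)) (aP (p + u f)); ring.
Qed.

Section Peel.
Variables (sg : E -> E) (good : rel E) (C : pred E).

(** A chord diagram on a closed path: a letter and its image under [sg] are the two ends of one
    chord. The class [C] marks the chords that peeling has to keep. *)
Definition chordal s := [/\ uniq s, \sum_(e <- s) u e = 0 &
  {in s, forall e, [/\ sg e \in s, sg (sg e) = e, sg e != e, u (sg e) = - u e
                     & C (sg e) = C e]}].

(** The two cyclic conditions say that the chord of [h] crosses the chord of [g], starting on the
    arc from [g] to [sg g]. *)
Definition positive s := {in s &, forall g h,
  cyc s g h (sg g) -> cyc s g (sg g) (sg h) -> good g h}.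

(** One of the two arcs of a chord outside [C] contains no whole chord of [C], so the chord can be
    pushed out to that side. *)
Definition separated s := {in s, forall g, ~~ C g -> {in s &, forall c c',
  C c -> C c' -> cyc s g c (sg g) -> cyc s g (sg c) (sg g) ->
  cyc s g (sg g) c' -> cyc s g (sg g) (sg c') -> False}}.

Let noC s e := all (fun c => C c ==> ~~ (cyc s e c (sg e) && cyc s e (sg c) (sg e))) s.
Let len s e := count (fun f => cyc s e f (sg e)) s.

Lemma chordal_rot i s : chordal s -> chordal (rot i s).
Proof.
case=> us cl hs; split; first by rewrite rot_uniq.
  by rewrite (perm_big s) // perm_rot.
by move=> e; rewrite mem_rot => /hs; rewrite mem_rot.
Qed.

Lemma positive_rot i s : chordal s -> positive s -> positive (rot i s).
Proof.
case=> us cl hs ps g h; rewrite !mem_rot => gs hs'.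
have [sgs _ _ _ _] := hs _ gs; have [shs _ _ _ _] := hs _ hs'.
rewrite !cyc_rot //; exact: ps.
Qed.

Lemma separated_rot i s : chordal s -> separated s -> separated (rot i s).
Proof.
case=> us cl hs ss g; rewrite mem_rot => gs nC c c'; rewrite !mem_rot => cs cs'.
have [sgs _ _ _ _] := hs _ gs; have [scs _ _ _ _] := hs _ cs.
have [scs' _ _ _ _] := hs _ cs'.
rewrite !cyc_rot //; exact: ss.
Qed.

Lemma chord_remove e s s' (q := s ++ s') : chordal (e :: s ++ sg e :: s') ->
  ~~ C e ->
  chordal q /\ [/\ q = filter (predC (pred2 e (sg e))) (e :: s ++ sg e :: s') &
  filter C q = filter C (e :: s ++ sg e :: s')].
Proof.
case=> us cl hs nC.
have [_ see _ ue Ce] := hs e (mem_head _ _).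
have [uq eq sq] : [/\ uniq q, e \notin q & sg e \notin q].
  move: us; rewrite cons_uniq mem_cat inE !negb_or => /andP[/and3P[es ne es']].
  rewrite uniq_catC cat_cons cons_uniq mem_cat orbC -mem_cat uniq_catC => /andP[h1 h2].
  by rewrite /q mem_cat negb_or es es' h1 h2.
have qE : q = filter (predC (pred2 e (sg e))) (e :: s ++ sg e :: s').
  rewrite /= eqxx /= filter_cat /= eqxx orbT /= -filter_cat -/q.
  apply/esym/all_filterP/allP => x xq /=; rewrite negb_or.
  by apply/andP; split; apply: contraTneq xq => ->.
split; last first.
  by split=> //; rewrite /= (negbTE nC) !filter_cat /= Ce (negbTE nC).
split=> //.
  rewrite -[RHS]cl [in RHS]big_cons [in RHS]big_cat /= big_cons ue /q big_cat /=.
  by rewrite [in RHS]addrCA !addrA ?addrK ?subrr ?add0r.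
move=> f fq.
have fs : f \in e :: s ++ sg e :: s'.
  by move: fq; rewrite qE mem_filter => /andP[].
have [sfs sfK nf uf Cf] := hs _ fs; split=> //.
rewrite qE mem_filter sfs andbT /= negb_or; apply/andP; split.
  by apply: contraNneq sq => <-; rewrite sfK.
by apply: contraNneq eq => /(congr1 sg); rewrite sfK see => <-.
Qed.

(** Among the oriented chords outside [C] with no whole chord of [C] on their arc, take one with the
    shortest arc. A chord wholly inside this arc would, suitably oriented, be a shorter such chord.
    Hence every letter of the arc belongs to a chord crossing the chosen one, the strip swept along
    the arc consists of good rhombuses, and the chord can be removed. *)
Lemma chord_peel s p : chordal s -> positive s -> separated s ->
  exists tl i, all (fun t => good t.1.2 t.2) tl /\
    exists p', forall Phi, antisym Phi ->
      psum Phi p s = \sum_(t <- tl) quad Phi t + psum Phi p' (rot i (filter C s)).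
Proof.
have [m] := ubnP (size s); elim: m => // m IH in s p * => sm hs ps ss.
have [/allP aC|/allPn[g gs nCg]] := boolP (all C s).
  exists [::], 0%N; split=> //; exists p => Phi aP; rewrite big_nil add0r rot0.
  by rewrite (all_filterP _) //; apply/allP.
have [us cl ch] := hs.
(* If the arc of [g] contains a whole chord of [C], the complementary arc does not, so [sg g]
   serves. *)
have ex_noC : exists2 e, e \in s & ~~ C e && noC s e.
  have [sgs sgK _ _ Cg] := ch _ gs.
  have [n1|/allPn[c cs]] := boolP (noC s g); first by exists g => //; rewrite nCg.
  rewrite negb_imply negbK => /andP[Cc /andP[c1 c2]].
  exists (sg g) => //; rewrite Cg nCg /=; apply/allP => c' cs'; apply/implyP => Cc'.
  apply/negP; rewrite sgK => /andP[c3 c4].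
  by apply: (ss g gs nCg c c') => //; rewrite cycR.
pose Q k := has (fun e => [&& ~~ C e, noC s e & len s e == k]) s.
have exQ : exists k, Q k.
  case: ex_noC => e es /andP[h1 h2]; exists (len s e); apply/hasP; exists e => //.
  by rewrite h1 h2 /=.
case: (ex_minnP exQ) => k /hasP[e es /and3P[nCe ne /eqP le]] kmin.
have [ses see sne ue Ce] := ch _ es.
have nochord f : f \in s -> cyc s e f (sg e) -> cyc s e (sg f) (sg e) -> False.
  move=> fs; have [sfs sff snf uf Cf] := ch _ fs.
  (* Of the two orientations of the inner chord, the one whose own arc is nested in the arc of [e]
     is used. *)
  wlog c3 : f fs sfs sff snf uf Cf / cyc s e f (sg f).
    move=> W c1 c2; have [c3|c3] := boolP (cyc s e f (sg f)); first exact: W c3 c1 c2.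
    apply: (W (sg f)) => //; rewrite ?sff ?uf ?opprK //; first by rewrite eq_sym.
    have [n1 _ n3] := cyc_neq c1; have [n4 _ n6] := cyc_neq c2.
    by apply: cyc_flip => //; rewrite eq_sym.
  move=> c1 c2.
  have nCf : ~~ C f.
    apply/negP => Cc; move/allP: ne => /(_ f fs); rewrite Cc /=.
    by rewrite c1 c2.
  suff [h1 h2] : (k <= len s f)%N /\ (len s f < k)%N by move: h2; rewrite ltnNge h1.
  have imp x : cyc s f x (sg f) -> cyc s e x (sg e) by apply: cyc3_sub c1 c2 c3.
  split.
    apply: kmin; apply/hasP; exists f => //; rewrite nCf eqxx andbT.
    apply/allP => c cs; apply/implyP => Cc; apply/negP => /andP[/imp d1 /imp d2].
    by move/allP: ne => /(_ c cs); rewrite Cc d1 d2.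
  rewrite -le; apply: (count_lt fs c1) => //.
  by apply/negP => /cyc_neq[]; rewrite eqxx.
have er : exists i s', rot i s = e :: s'.
  exists (index e s); rewrite /rot (drop_nth e) ?index_mem // nth_index //.
  by eexists.
case: er => i [s' rs].
have hs' : chordal (e :: s') by rewrite -rs; apply: chordal_rot.
have ps' : positive (e :: s') by rewrite -rs; apply: positive_rot.
have ss' : separated (e :: s') by rewrite -rs; apply: separated_rot.
have sgs' : sg e \in s'.
  by have [_ _ /(_ e (mem_head _ _))[]] := hs'; rewrite inE (negbTE sne).
have [j s's] : exists j, s' = take j s' ++ sg e :: drop j.+1 s'.
  exists (index (sg e) s').
  by rewrite -[in LHS](cat_take_drop (index (sg e) s') s') (drop_nth e) ?index_mem // nth_index.
set s1 := take _ _ in s's; set s2 := drop _ _ in s's.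
have rs' := rs; rewrite s's in hs' ps' ss' rs'.
have [hq [qE Cq]] := chord_remove hs' nCe.
have us1 : uniq (e :: s1 ++ sg e :: s2) by case: hs'.
have mem_s x : (x \in s) = (x \in e :: s1 ++ sg e :: s2) by rewrite -rs' mem_rot.
have cyc_s a b c : a \in s -> b \in s -> c \in s ->
    cyc (e :: s1 ++ sg e :: s2) a b c = cyc s a b c.
  by move=> *; rewrite -rs' cyc_rot.
(* The other end of [f] lies outside the arc, so the two chords cross and positivity applies. *)
have good1 f : f \in s1 -> good e f.
  move=> f1; have fs : f \in s by rewrite mem_s inE mem_cat f1 orbT.
  have [sfs sff snf uf Cf] := ch _ fs.
  have d1 : cyc s e f (sg e).
    rewrite -cyc_s // cyc_head // ?mem_cat ?f1 ?inE ?eqxx ?orbT //.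
    rewrite !index_cat f1 ifN ?ltn_addr ?index_mem //.
    move: us1; rewrite cons_uniq cat_uniq => /and4P[_ _ /hasPn hn _].
    by have := hn (sg e) (mem_head _ _).
  apply: ps' => //; rewrite -?mem_s ?cyc_s //.
  have [n1 n2 _] := cyc_neq d1.
  apply: cyc_flip => //.
  - by apply: contraNneq n2 => h; rewrite h sff.
  - by apply: contraNneq n1 => /(congr1 sg); rewrite sff see => ->.
  by apply/negP => /(nochord f fs d1).
have subq x : x \in s1 ++ s2 -> x \in e :: s1 ++ sg e :: s2.
  by rewrite inE !mem_cat inE => /orP[] ->; rewrite !orbT.
have cyc_q a b c : a \in s1 ++ s2 -> b \in s1 ++ s2 -> c \in s1 ++ s2 ->
    cyc (s1 ++ s2) a b c = cyc (e :: s1 ++ sg e :: s2) a b c.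
  by rewrite !qE => *; rewrite cyc_filter.
have chq := let: And3 _ _ h := hq in h.
have pq : positive (s1 ++ s2).
  move=> g1 h gq hq'; have [? _ _ _ _] := chq _ gq; have [? _ _ _ _] := chq _ hq'.
  by rewrite !cyc_q //; apply: ps'; apply: subq.
have sq : separated (s1 ++ s2).
  move=> g' gq nC c c' cq cq'; have [? _ _ _ _] := chq _ gq.
  have [? _ _ _ _] := chq _ cq; have [? _ _ _ _] := chq _ cq'.
  by rewrite !cyc_q //; apply: ss' => //; apply: subq.
have sz : (size (s1 ++ s2) < m)%N.
  by move: sm; rewrite -(size_rot i s) rs' /= !size_cat /= addnS ltnS => /ltnW.
have [p1 Hp1] : exists p1, forall Phi,
    psum Phi p s = psum Phi p1 (e :: s1 ++ sg e :: s2).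
  by have [p1 Hp1] := psum_rot i p cl; exists p1 => Phi; rewrite Hp1 rs'.
have [tl [i' [gtl [p' HP]]]] := IH _ p1 sz hq pq sq.
exists (strip p1 e s1 ++ tl).
have [i2 Hi] : exists i2, rot i' (filter C (s1 ++ s2)) = rot i2 (filter C s).
  rewrite Cq -rs'; have [i1 ->] := filter_rot C i s.
  exact: rot_rot_ex.
exists i2; split.
  by rewrite all_cat gtl andbT; apply/allP => t /mem_strip[-> /good1].
exists p' => Phi aP; by rewrite Hp1 psum_strip // HP // big_cat /= addrA Hi.
Qed.
End Peel.
End Paths.
End CyclicPeeling.

(** * A parabolic substitute for the cosine *)

Module ProfileFunction.
Import CyclicPeeling.
Import Order.TTheory GRing.Theory Num.Theory.
Local Open Scope ring_scope.

Lemma modzDMr p m d : ((m + p * d)%R = m %[mod d])%Z.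
Proof. by rewrite addrC modzMDl. Qed.

Section Profile.
Variable n : nat.
Hypothesis n_gt1 : (1 < n)%N.

Definition parab (a : int) : int := n%:Z ^+ 2 - 4 * a ^+ 2.

(** The parabola on 2|a| <= n, continued so that a shift by [n] changes the sign. Like the cosine of
    a pi/n it is even, positive for 2|a| < n, and zero at 2|a| = n. *)
Definition mprof (a : int) : int :=
  let r := (a %% (2 * n)%:Z)%Z in
  if 2 * r <= n%:Z then parab r
  else if 2 * r <= 3 * n%:Z then - parab (r - n%:Z)
  else parab (r - 2 * n%:Z).

Lemma mprofE k a : - n%:Z <= 2 * a <= n%:Z ->
  mprof (a + 2 * n%:Z * k) = parab a /\ mprof (a + n%:Z + 2 * n%:Z * k) = - parab a.
Proof.
move=> ha.
have n0 : (2 * n)%:Z = 2 * n%:Z by rewrite PoszM.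
split; rewrite /mprof n0.
  have [a0|a0] := leP 0 a.
    have -> : ((a + 2 * n%:Z * k) %% (2 * n%:Z))%Z = a.
      by rewrite (mulrC (2 * n%:Z)) modzDMr modz_small //; lia.
    by rewrite ifT //; lia.
  have -> : ((a + 2 * n%:Z * k) %% (2 * n%:Z))%Z = a + 2 * n%:Z.
    have -> : a + 2 * n%:Z * k = (k - 1) * (2 * n%:Z) + (a + 2 * n%:Z) by ring.
    by rewrite modzMDl modz_small //; lia.
  case: ifP => [|_]; first by lia.
  case: ifP => [h|_]; last by congr parab; lia.
  have -> : parab (a + 2 * n%:Z - n%:Z) = - parab a; last by rewrite opprK.
  have -> : n%:Z = - 2 * a by lia.
  rewrite /parab; have -> : n%:Z = - 2 * a by lia.
  ring.
have -> : ((a + n%:Z + 2 * n%:Z * k) %% (2 * n%:Z))%Z = a + n%:Z.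
  by rewrite (mulrC (2 * n%:Z)) modzDMr modz_small //; lia.
case: ifP => h; last by rewrite ifT ?addrK //; lia.
have e : n%:Z = - 2 * a by lia.
rewrite /parab e; ring.
Qed.

Lemma mprof_small a : - n%:Z <= 2 * a <= n%:Z -> mprof a = parab a.
Proof. by move=> /(mprofE 0)[+ _]; rewrite mulr0 addr0. Qed.

Lemma mprof_split a : exists k b, - n%:Z < 2 * b <= n%:Z /\
  (a = b + 2 * n%:Z * k \/ a = b + n%:Z + 2 * n%:Z * k).
Proof.
have := divz_eq a (2 * n)%:Z; have := @modz_ge0 a (2 * n)%:Z; have := @ltz_mod a (2 * n)%:Z.
set r := (a %% _)%Z; set q := (a %/ _)%Z => h1 h2 h3.
have n0 : (2 * n)%:Z = 2 * n%:Z by rewrite PoszM.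
have r0 : 0 <= r by apply: h2; lia.
have r1 : r < 2 * n%:Z by move: h1; rewrite n0; lia.
have h4 : a = r + 2 * n%:Z * q by rewrite h3 n0; ring.
have [c1|c1] := leP (2 * r) n%:Z; first by exists q, r; split; [lia|left].
have [c2|c2] := leP (2 * r) (3 * n%:Z).
  by exists q, (r - n%:Z); split; [lia|right; rewrite h4; ring].
by exists (q + 1), (r - 2 * n%:Z); split; [lia|left; rewrite h4; ring].
Qed.

Lemma mprofDn a : mprof (a + n%:Z) = - mprof a.
Proof.
have [k [b [hb [] ->]]] := mprof_split a; have hb' : - n%:Z <= 2 * b <= n%:Z by lia.
  have [-> _] := mprofE k hb'; have [_ <-] := mprofE k hb'; congr mprof; ring.
have [_ ->] := mprofE k hb'; rewrite opprK; have [<- _] := mprofE (k + 1) hb'.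
by congr mprof; ring.
Qed.

Lemma mprofBn a : mprof (a - n%:Z) = - mprof a.
Proof. by rewrite -[in RHS](subrK n%:Z a) mprofDn opprK. Qed.

Lemma mprofN a : mprof (- a) = mprof a.
Proof.
have [k [b [hb h]]] := mprof_split a.
have hb' : - n%:Z <= 2 * b <= n%:Z by lia.
have hb'' : - n%:Z <= 2 * (- b) <= n%:Z by lia.
have pN : parab (- b) = parab b by rewrite /parab sqrrN.
case: h => ->.
  have [-> _] := mprofE k hb'; rewrite -pN; have [<- _] := mprofE (- k) hb''.
  by congr mprof; ring.
have [_ ->] := mprofE k hb'; rewrite -pN; have [_ <-] := mprofE (- k - 1) hb''.
by congr mprof; ring.
Qed.

(** Each value factors as (n - 2a)(n + 2a). For a fixed sum of arguments, the product of two linear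
    factors grows as the arguments approach each other, and this applies to both families of
    factors. *)
Lemma parab_lt (p q s t : int) : - n%:Z <= 2 * s -> s < p -> p <= q ->
  2 * t <= n%:Z -> p + q = s + t -> parab s * parab t < parab p * parab q.
Proof.
move=> h1 h2 h3 h4 h5.
have -> : t = p + q - s by lia.
have h6 : 2 * (p + q - s) <= n%:Z by lia.
pose N := n%:Z; rewrite /parab -/N.
have a1 : 0 <= (N - 2 * s) * (N - 2 * (p + q - s)) by apply: mulr_ge0; lia.
have a2 : 0 <= (N + 2 * s) * (N + 2 * (p + q - s)) by apply: mulr_ge0; lia.
have g : 0 < (p - s) * (q - s) by apply: mulr_gt0; lia.
have b1 : (N - 2 * s) * (N - 2 * (p + q - s)) < (N - 2 * p) * (N - 2 * q) by nia.
have b2 : (N + 2 * s) * (N + 2 * (p + q - s)) < (N + 2 * p) * (N + 2 * q) by nia.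
have := ltr_pM a1 a2 b1 b2.
have -> : (N - 2 * s) * (N - 2 * (p + q - s)) * ((N + 2 * s) * (N + 2 * (p + q - s))) =
  (N ^+ 2 - 4 * s ^+ 2) * (N ^+ 2 - 4 * (p + q - s) ^+ 2) by ring.
have -> // : (N - 2 * p) * (N - 2 * q) * ((N + 2 * p) * (N + 2 * q)) =
  (N ^+ 2 - 4 * p ^+ 2) * (N ^+ 2 - 4 * q ^+ 2) by ring.
Qed.

Lemma parab_ge0 a : - n%:Z <= 2 * a <= n%:Z -> 0 <= parab a.
Proof.
move=> h; rewrite /parab.
have : 0 <= (n%:Z - 2 * a) * (n%:Z + 2 * a) by apply: mulr_ge0; lia.
by congr (_ <= _); ring.
Qed.

Lemma parab_gt0 a : - n%:Z < 2 * a < n%:Z -> 0 < parab a.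
Proof.
move=> h; rewrite /parab.
have : 0 < (n%:Z - 2 * a) * (n%:Z + 2 * a) by apply: mulr_gt0; lia.
by congr (_ < _); ring.
Qed.

(** The model is cos p cos q - cos s cos t = (cos (p - q) - cos (t - s)) / 2 for p + q = s + t,
    which is positive while the spread t - s is at most half a period. *)
Lemma mprof_lt_near (p q s t : int) : s < p -> p <= q -> p + q = s + t ->
  t - s <= n%:Z -> mprof s * mprof t < mprof p * mprof q.
Proof.
(* Shifts by 2n and possibly one by [n], which changes all four signs, bring [s] into the interval
   around 0. The cases then depend on which of the other arguments have passed the zero at n/2. *)
have base (s' p' q' t' : int) : - n%:Z < 2 * s' -> 2 * s' <= n%:Z -> s' < p' -> p' <= q' ->
    p' + q' = s' + t' -> t' - s' <= n%:Z -> mprof s' * mprof t' < mprof p' * mprof q'.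
  move=> s1 s2 sp pq pqst ts.
  have shift b : - n%:Z <= 2 * (b - n%:Z) <= n%:Z -> mprof b = - parab (b - n%:Z).
    by move=> h; rewrite -mprof_small // mprofBn opprK.
  have [t1|t1] := leP (2 * t') n%:Z.
    by rewrite !mprof_small; try lia; apply: parab_lt; lia.
  rewrite (@mprof_small s') ?(shift t'); try lia.
  have [q1|q1] := leP (2 * q') n%:Z.
    rewrite !mprof_small; try lia.
    have : 0 < parab s' * parab (t' - n%:Z) by apply: mulr_gt0; apply: parab_gt0; lia.
    have : 0 <= parab p' * parab q' by apply: mulr_ge0; apply: parab_ge0; lia.
    by move=> h1 h2; rewrite mulrN; apply: lt_le_trans h1; rewrite oppr_lt0.
  rewrite (shift q'); last lia.
  have [p1|p1] := leP (2 * p') n%:Z.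
    rewrite mprof_small; last lia.
    rewrite !mulrN ltrN2 [ltRHS]mulrC [ltLHS]mulrC; apply: parab_lt; lia.
  rewrite (shift p'); last lia.
  have : 0 <= parab s' * parab (t' - n%:Z) by apply: mulr_ge0; apply: parab_ge0; lia.
  have : 0 < parab (p' - n%:Z) * parab (q' - n%:Z) by apply: mulr_gt0; apply: parab_gt0; lia.
  by move=> h1 h2; rewrite mulrNN mulrN; apply: le_lt_trans h1; rewrite oppr_le0.
move=> sp pq pqst ts.
have sh k b : mprof (b + 2 * n%:Z * k) = mprof b.
  have [j [c [hc h]]] := mprof_split b; have hc' : - n%:Z <= 2 * c <= n%:Z by lia.
  case: h => ->; rewrite -!addrA -!mulrDr ?addrA.
    by have [-> _] := mprofE (j + k) hc'; have [-> _] := mprofE j hc'.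
  by have [_ ->] := mprofE (j + k) hc'; have [_ ->] := mprofE j hc'.
have [k [b [hb [h|h]]]] := mprof_split s.
  have := base (s + 2 * n%:Z * (- k)) (p + 2 * n%:Z * (- k)) (q + 2 * n%:Z * (- k))
    (t + 2 * n%:Z * (- k)).
  by rewrite !sh; apply; lia.
have sn c : mprof (c - n%:Z + 2 * n%:Z * (- k)) = - mprof c by rewrite sh mprofBn.
have := base (s - n%:Z + 2 * n%:Z * (- k)) (p - n%:Z + 2 * n%:Z * (- k))
  (q - n%:Z + 2 * n%:Z * (- k)) (t - n%:Z + 2 * n%:Z * (- k)).
by rewrite !sn !mulrNN; apply; lia.
Qed.

(** With a cosine in place of [mprof], and angles in units of pi/n, this would be sin x sin (g -
    d). *)
Definition minor (x d g : int) : int :=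
  mprof d * mprof (g - x) - mprof (d - x) * mprof g.

(* [mprof] plays the role of a cosine: the curve (mprof d, mprof (d - x))
   turns counterclockwise, by half a turn when d increases by n. *)
Lemma minor_gt0 x d g : 0 < x < n%:Z -> 0 < g - d < n%:Z -> 0 < minor x d g.
Proof.
move=> hx hg; rewrite subr_gt0.
have [le|gt] := leP (g - (d - x)) n%:Z.
  have [c|c] := leP d (g - x); first by apply: mprof_lt_near; lia.
  by rewrite [ltRHS]mulrC; apply: mprof_lt_near; lia.
(* The spread exceeds [n]. Moving [g] down and [d - x] up by [n] changes both signs and leaves a
   spread below [n]. *)
have -> : mprof (d - x) * mprof g = mprof (g - n%:Z) * mprof (d - x + n%:Z).
  by rewrite mprofDn mprofBn mulrNN mulrC.
have [c|c] := leP d (g - x); first by apply: mprof_lt_near; lia.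
by rewrite [ltRHS]mulrC; apply: mprof_lt_near; lia.
Qed.

Lemma mprof_le a : `|mprof a| <= n%:Z ^+ 2.
Proof.
have [k [b [hb h]]] := mprof_split a; have hb' : - n%:Z <= 2 * b <= n%:Z by lia.
have p0 := parab_ge0 hb'.
have p1 : parab b <= n%:Z ^+ 2 by rewrite /parab; have := sqr_ge0 b; lia.
by case: h => ->; have [e1 e2] := mprofE k hb'; rewrite ?e1 ?e2 ?normrN ger0_norm.
Qed.
End Profile.
End ProfileFunction.

(** * Letters on the boundary of a rhombus and their pairing *)

Module BoundaryEndpoints.
Import CyclicPeeling ProfileFunction.
Import Order.TTheory GRing.Theory Num.Theory.
Local Open Scope ring_scope.

Section Mult.
Variable n : nat.
Hypothesis n_gt1 : (1 < n)%N.

(** The factor 2 makes every value even, hence every [level] odd. The factor n^2+1, just above the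
    bound n^2 for |mprof|, yields [mdet_gt]. *)
Definition mult (a : int) : int := 2 * (n%:Z ^+ 2 + 1) * mprof n a.

Lemma multDn a : mult (a + n%:Z) = - mult a.
Proof. by rewrite /mult mprofDn // mulrN. Qed.

Lemma multBn a : mult (a - n%:Z) = - mult a.
Proof. by rewrite /mult mprofBn // mulrN. Qed.

Lemma multN a : mult (- a) = mult a.
Proof. by rewrite /mult mprofN. Qed.

Lemma mult_ge0 a : - n%:Z <= 2 * a <= n%:Z -> 0 <= mult a.
Proof.
move=> h; rewrite /mult mprof_small //.
by have := parab_ge0 n_gt1 h; have := sqr_ge0 n%:Z; nia.
Qed.

Lemma mult_gt0 a : - n%:Z < 2 * a < n%:Z -> 1 < mult a.
Proof.
move=> h; rewrite /mult mprof_small //; last lia.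
by have := parab_gt0 n_gt1 h; have := sqr_ge0 n%:Z; nia.
Qed.

Lemma mult_gt0_inv a : - n%:Z <= 2 * a <= n%:Z -> 0 < mult a -> - n%:Z < 2 * a < n%:Z.
Proof.
move=> h; rewrite /mult mprof_small // /parab => h1.
suff : 2 * a != n%:Z /\ 2 * a != - n%:Z by lia.
split; apply/eqP => e; move: h1.
  by have -> : n%:Z ^+ 2 - 4 * a ^+ 2 = 0; [rewrite -e; ring|rewrite mulr0 ltxx].
have -> : n%:Z ^+ 2 - 4 * a ^+ 2 = 0; last by rewrite mulr0 ltxx.
have -> : n%:Z = - (2 * a) by rewrite e opprK.
ring.
Qed.

(** Up to positive factors, the cross product of the chord vectors of directions [d] and [g] in the
    square, see [chord_vector]. *)
Definition mdet (x d g : int) : int := mult d * mult (g - x) - mult (d - x) * mult g.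

Lemma mdetE x d g : mdet x d g = 4 * (n%:Z ^+ 2 + 1) ^+ 2 * minor n x d g.
Proof. by rewrite /mdet /mult /minor; ring. Qed.

(** [minor] is a positive integer, so the determinant is at least 4(n^2+1)^2, whereas two
    multiplicities add up to at most 4 n^2 (n^2+1). *)
Lemma mdet_gt x d g c c' : 0 < x < n%:Z -> 0 < g - d < n%:Z ->
  `|mult c| + `|mult c'| < mdet x d g.
Proof.
move=> hx hg; have h := minor_gt0 n_gt1 hx hg.
rewrite mdetE /mult !normrM.
have := mprof_le n_gt1 c; have := mprof_le n_gt1 c'.
set K := n%:Z ^+ 2 in h *; have K0 : 0 <= K by apply: sqr_ge0.
have -> : `|2 : int| = 2 by [].
have -> : `|K + 1| = K + 1 by rewrite ger0_norm //; lia.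
move=> h1 h2.
apply: (@lt_le_trans _ _ (4 * (K + 1) ^+ 2)); last by nia.
nia.
Qed.

Lemma mdet_gt0 x d g : 0 < x < n%:Z -> 0 < g - d < n%:Z -> 0 < mdet x d g.
Proof.
move=> hx hg; have := mdet_gt 0 0 hx hg.
by apply: le_lt_trans; rewrite addr_ge0.
Qed.

Lemma mdetC x d g : mdet x g d = - mdet x d g.
Proof. by rewrite /mdet; ring. Qed.

Lemma mult_mod k a : mult (a + 2 * n%:Z * k) = mult a.
Proof.
have [j [c [hc h]]] := mprof_split n_gt1 a; have hc' : - n%:Z <= 2 * c <= n%:Z by lia.
rewrite /mult; congr (_ * _); case: h => ->; rewrite -!addrA -!mulrDr ?addrA.
  by have [-> _] := mprofE n_gt1 (j + k) hc'; have [-> _] := mprofE n_gt1 j hc'.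
by have [_ ->] := mprofE n_gt1 (j + k) hc'; have [_ ->] := mprofE n_gt1 j hc'.
Qed.

Lemma mdet_mod x d g k : mdet x d (g + 2 * n%:Z * k) = mdet x d g.
Proof. by rewrite /mdet (addrAC g) !mult_mod. Qed.

Lemma mdetDn x d g : mdet x d (g + n%:Z) = - mdet x d g.
Proof. by rewrite /mdet (addrAC g) !multDn; ring. Qed.

Definition residue (d : int) : int := (d %% (2 * n)%:Z)%Z.

Lemma residue_spec d : exists k, d = residue d + 2 * n%:Z * k /\ 0 <= residue d < 2 * n%:Z.
Proof.
exists (d %/ (2 * n)%:Z)%Z; have := divz_eq d (2 * n)%:Z.
have := @modz_ge0 d (2 * n)%:Z; have := @ltz_mod d (2 * n)%:Z; rewrite /residue.
have n0 : (2 * n)%:Z = 2 * n%:Z by rewrite PoszM.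
move=> h1 h2 h3; split; first by rewrite [LHS]h3 n0; ring.
have := h2; have := h1; rewrite n0; lia.
Qed.

Lemma residue_small d k : 0 <= d < 2 * n%:Z -> residue (d + 2 * n%:Z * k) = d.
Proof.
move=> h; rewrite /residue PoszM (mulrC (2 * _)) modzDMr modz_small //; lia.
Qed.

Lemma mdet_sign x d g : 0 < x < n%:Z ->
  [\/ 0 < residue (g - d) < n%:Z /\ 0 < mdet x d g,
      n%:Z < residue (g - d) < 2 * n%:Z /\ mdet x d g < 0,
      residue (g - d) = 0 /\ mdet x d g = 0 |
      residue (g - d) = n%:Z /\ mdet x d g = 0].
Proof.
move=> hx; have [k [e hr]] := residue_spec (g - d).
set r := residue _ in e hr *.
have -> : mdet x d g = mdet x d (d + r).
  by rewrite -(mdet_mod x d (d + r) k); congr mdet; lia.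
have [r0|r0] := eqVneq r 0.
  by constructor 3; split=> //; rewrite r0 addr0 /mdet mulrC subrr.
have [rn|rn] := eqVneq r n%:Z.
  by constructor 4; split=> //; rewrite rn mdetDn /mdet mulrC subrr oppr0.
have [lt|gt] := ltP r n%:Z.
  by constructor 1; split; [lia|apply: mdet_gt0 => //; lia].
constructor 2; split; first by lia.
have -> : d + r = d + (r - n%:Z) + n%:Z by ring.
by rewrite mdetDn oppr_lt0; apply: mdet_gt0 => //; lia.
Qed.
End Mult.

Section Endpoints.
Variables (n x : nat).
Hypothesis n_gt1 : (1 < n)%N.
Hypothesis hx : (0 < x < n)%N.
Local Notation mult := (mult n).
Local Notation N := n%:Z.
Local Notation X := x%:Z.

(* An endpoint (q, a, k) is the k-th occurrence of the letter a on the side q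
   of the enlarged rhombus, the sides being listed counterclockwise. *)
Definition endpoint : Type := (nat * int * int)%type.
Implicit Types e f : endpoint.

Definition side_dir (q : nat) : int := nth 0 [:: 0; X; N; N + X] q.
Definition turn (q : nat) : int := if odd q then N - X else X.
Definition dir e := side_dir e.1.1 + e.1.2.

Definition valid e :=
  [&& (e.1.1 < 4)%N, - N < 2 * e.1.2 < N & 0 <= e.2 < mult e.1.2].

(** The opposite direction occurs on the opposite side and, as letters satisfy 2|a| < n, on at most
    one adjacent side: the next one if 2a <= 2 turn q - n, the previous one otherwise. Letters are
    matched across the corner shared with that side, beginning at the corner, as long as both sides
    have some; the rest go to the opposite side. *)
Definition partner e : endpoint :=
  let: (q, a, k) := e in
  let w := mult (a - turn q) in
  let k' := mult a - 1 - k in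
  if 2 * a <= 2 * turn q - N then
    if k' < - w then (((q + 1) %% 4)%N, a + N - turn q, k')
    else (((q + 2) %% 4)%N, a, k' + w)
  else if k < w then (((q + 3) %% 4)%N, a - turn q, w - 1 - k)
       else (((q + 2) %% 4)%N, a, k' + w).

Arguments partner : simpl never.

(** Twice the linear form [height] of the direction of [e], taken at [e] and shifted to vanish at
    the centre of the square ([height_level]). The two ends of a chord have opposite levels because
    their directions are opposite. *)
Definition level e : int :=
  2 * e.2 + 1 - mult e.1.2 - mult (e.1.2 - turn e.1.1).

(** Levels are odd, so these are the two chords of a given direction nearest to the centre, one on
    each side of it. *)
Definition central e := (level e == 1) || (level e == -1).

Lemma turnP q : 0 < turn q < N.
Proof. by rewrite /turn; case: (odd q) => /=; lia. Qed.

Lemma turnS q : turn ((q + 1) %% 4)%N = N - turn q.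
Proof.
rewrite /turn; have -> : odd ((q + 1) %% 4)%N = ~~ odd q by lia.
by case: (odd q) => /=; lia.
Qed.

Lemma turnSS q : turn ((q + 2) %% 4)%N = turn q.
Proof. by rewrite /turn; have -> : odd ((q + 2) %% 4)%N = odd q by lia. Qed.

Lemma turnP3 q : turn ((q + 3) %% 4)%N = N - turn q.
Proof.
rewrite /turn; have -> : odd ((q + 3) %% 4)%N = ~~ odd q by lia.
by case: (odd q) => /=; lia.
Qed.

Variant partner_spec (q : nat) (a k : int) : endpoint -> Prop :=
| PartnerNext of 2 * a <= 2 * turn q - N & mult a - 1 - k < - mult (a - turn q) :
    partner_spec q a k (((q + 1) %% 4)%N, a + N - turn q, mult a - 1 - k)
| PartnerPrev of 2 * a > 2 * turn q - N & k < mult (a - turn q) :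
    partner_spec q a k (((q + 3) %% 4)%N, a - turn q, mult (a - turn q) - 1 - k)
| PartnerOpp of `|mult (a - turn q)| < mult a &
    (2 * a <= 2 * turn q - N -> mult (a - turn q) <= 0 /\ - mult (a - turn q) <= mult a - 1 - k) &
    (2 * a > 2 * turn q - N -> 0 <= mult (a - turn q) <= k) :
    partner_spec q a k (((q + 2) %% 4)%N, a, mult a - 1 - k + mult (a - turn q)).

Lemma partnerP q a k : valid (q, a, k) -> partner_spec q a k (partner (q, a, k)).
Proof.
case/and3P=> /= q4 ha hk; have := turnP q; rewrite /partner => ht.
case: ifPn => h1; last case: ifPn => h2.
- have w0 : mult (a - turn q) <= 0.
    have -> : a - turn q = (a + N - turn q) - N by ring.
    by rewrite multBn // oppr_le0; apply: mult_ge0 => //; lia.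
  case: ifPn => h2; first by constructor.
  by constructor; lia.
- by constructor => //; lia.
have w0 : 0 <= mult (a - turn q) by apply: mult_ge0 => //; lia.
by constructor; lia.
Qed.

Lemma mod4 q i : (((q + i) %% 4) < 4)%N. Proof. lia. Qed.

Lemma valid_partner e : valid e -> valid (partner e).
Proof.
case: e => [[q a] k] ve; have ht := turnP q.
have /and3P[/= q4 ha hk] := ve.
have multDr : mult (a + N - turn q) = - mult (a - turn q).
  by rewrite -multDn //; congr mult; ring.
case: (partnerP ve) => [h1 h2|h1 h2|h1 h2 h3]; apply/and3P; split; rewrite ?mod4 //=.
- by apply: mult_gt0_inv => //; [lia|rewrite multDr; lia].
- by rewrite multDr; lia.
- by apply: mult_gt0_inv => //; lia.
- by lia.
by lia.
Qed.

Lemma level_partner e : valid e -> level (partner e) = - level e.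
Proof.
case: e => [[q a] k] ve; rewrite /level /=.
case: (partnerP ve) => [h1 h2|h1 h2|h1 h2 h3] /=.
- rewrite turnS; have -> : a + N - turn q - (N - turn q) = a by ring.
  have -> : a + N - turn q = a - turn q + N by ring.
  by rewrite multDn //; ring.
- rewrite turnP3; have -> : a - turn q - (N - turn q) = a - N by ring.
  by rewrite multBn //; ring.
by rewrite turnSS; ring.
Qed.

Lemma partnerK e : valid e -> partner (partner e) = e.
Proof.
case: e => [[q a] k] ve; have ht := turnP q.
have /and3P[/= q4 ha hk] := ve.
have := valid_partner ve; case: (partnerP ve) => [h1 h2|h1 h2|h1 h2 h3] v'.
- rewrite /partner turnS ifN; last lia.
  have -> : a + N - turn q - (N - turn q) = a by ring.
  by rewrite ifT; [congr (_, _, _); lia | lia].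
- rewrite /partner turnP3 ifT; last lia.
  have -> : a - turn q - (N - turn q) = a - N by ring.
  rewrite multBn // opprK ifT; last lia.
  by congr (_, _, _); lia.
rewrite /partner turnSS; have [l1|l1] := leP (2 * a) (2 * turn q - N).
  have [w0 w1] := h2 l1.
  by rewrite ifN; [congr (_, _, _); lia|lia].
have w0 := h3 l1.
by rewrite ifN; [congr (_, _, _); lia|lia].
Qed.

Lemma dir_partner e : valid e -> dir (partner e) = dir e + N \/ dir (partner e) = dir e - N.
Proof.
case: e => [[q a] k] ve; have /and3P[/= q4 _ _] := ve.
have [t0 [t1 [t2 t3]]] : turn 0 = X /\ turn 1 = N - X /\ turn 2 = X /\ turn 3 = N - X by [].
rewrite /dir; case: (partnerP ve) => [h1 h2|h1 h2|h1 h2 h3] /=;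
  clear - q4 t0 t1 t2 t3 hx n_gt1;
  by case: q q4 => [|[|[|[|//]]]] _; rewrite /side_dir /= ?t0 ?t1 ?t2 ?t3; lia.
Qed.

(** Passing to the next side turns the pair of multiplicities by a quarter turn, in step with the
    sides of the square; this lets one computation serve all four sides. *)
Lemma multdir q a : (q < 4)%N ->
  let w := mult (a - turn q) in
  (mult (side_dir q + a), mult (side_dir q + a - X)) =
  nth (0, 0) [:: (mult a, w); (- w, mult a); (- mult a, - w); (w, - mult a)] q.
Proof.
case: q => [|[|[|[|//]]]] _; rewrite /side_dir /turn /=.
- by rewrite add0r.
- rewrite -multDn //; congr (mult _, mult _); ring.
- rewrite -!multDn //; congr (mult _, mult _); ring.
have -> : N + X + a = a - (N - X) + N + N by ring.
rewrite !multDn // opprK -multDn //; congr (_, mult _); ring.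
Qed.

(* The boundary of the rhombus is parametrised on the unit square. *)
Definition frac e : rat := (2 * e.2 + 1)%:~R / (2 * mult e.1.2)%:~R.
Definition ptx e : rat := nth 0 [:: frac e; 1; 1 - frac e; 0] e.1.1.
Definition pty e : rat := nth 0 [:: 0; frac e; 1; 1 - frac e] e.1.1.

Definition height d (p1 p2 : rat) : rat :=
  (mult d)%:~R * p1 + (mult (d - X))%:~R * p2.

Lemma frac_gt0_lt1 e : valid e -> 0 < frac e < 1.
Proof.
case: e => [[q a] k] /and3P[/= q4 ha hk]; rewrite /frac /=.
have m0 : 0 < (2 * mult a)%:~R :> rat by rewrite ltr0z; lia.
rewrite divr_gt0 // ?ltr0z; last lia.
by rewrite ltr_pdivrMr // mul1r ltr_int; lia.
Qed.

Lemma height_level e : valid e ->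
  2 * height (dir e) (ptx e) (pty e) - (mult (dir e) + mult (dir e - X))%:~R = (level e)%:~R.
Proof.
case: e => [[q a] k] ve; have /and3P[/= q4 ha hk] := ve.
rewrite /height /dir /=; have := multdir a q4.
move: (mult (side_dir q + a)) (mult (side_dir q + a - X)) => u v.
rewrite /level /ptx /pty /=; move: (mult (a - turn q)) => w.
have fE : (2 * mult a)%:~R * frac (q, a, k) = (2 * k + 1)%:~R.
  by rewrite /frac /= mulrC divfK // intr_eq0; lia.
move: fE; move: (frac _) (mult a) => s m fE.
by case: q q4 fE {ve} => [|[|[|[|//]]]] _ fE /= [-> ->]; move: fE;
  rewrite !(rmorphB, rmorphD, rmorphM, rmorphN, rmorph1, rmorph_nat) /=; lra.
Qed.

(** The vector is annihilated by [height (dir e)], so chords of one direction are parallel; the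
    positions (2k+1)/(2 mult a) are chosen for this. The factor is 1 / mult a between opposite
    sides, and is proportional to the triangle cut off at a corner otherwise. *)
Lemma chord_vector e : valid e -> exists2 l : rat, 0 < l &
  (ptx (partner e) = ptx e - l * (mult (dir e - X))%:~R) /\
  (pty (partner e) = pty e + l * (mult (dir e))%:~R).
Proof.
case: e => [[q a] k] ve; have /and3P[/= q4 ha hk] := ve.
have v' := valid_partner ve.
have := multdir a q4; rewrite /dir /=.
move: (mult (side_dir q + a)) (mult (side_dir q + a - X)) => u v uv.
have m0 : 0 < (mult a)%:~R :> rat by rewrite ltr0z; lia.
move: v'; case: (partnerP ve) => [h1 h2|h1 h2|h1 h2 h3] v'.
- have w0 : 0 < - (mult (a - turn q))%:~R :> rat by rewrite -rmorphN ltr0z; lia.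
  exists ((2 * (mult a - 1 - k) + 1)%:~R / (2 * mult a * - mult (a - turn q))%:~R).
    by apply: divr_gt0; rewrite ltr0z; [lia|apply: mulr_gt0; lia].
  have e1 : mult (a + N - turn q) = - mult (a - turn q).
    by rewrite -multDn //; congr mult; ring.
  clear - uv q4 m0 w0 e1 hx n_gt1.
  rewrite /ptx /pty /frac /= e1 {e1}; move: (mult (a - turn q)) (mult a) uv w0 m0 => w m uv w0 m0.
  have m1 : m%:~R != 0 :> rat by rewrite gt_eqF.
  have w1 : w%:~R != 0 :> rat by apply/eqP => w1; move: w0; rewrite w1 ?oppr0 ltxx.
  by case: q q4 uv => [|[|[|[|//]]]] _ /= [-> ->];
  rewrite !(rmorphB, rmorphD, rmorphM, rmorphN) /=; split; field; rewrite ?oppr_eq0 ?m1 ?w1.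
- have w0 : 0 < (mult (a - turn q))%:~R :> rat by rewrite ltr0z; lia.
  exists ((2 * k + 1)%:~R / (2 * mult a * mult (a - turn q))%:~R).
    by apply: divr_gt0; rewrite ltr0z; [lia|apply: mulr_gt0; lia].
  clear - uv q4 m0 w0 hx n_gt1.
  rewrite /ptx /pty /frac /=; move: (mult (a - turn q)) (mult a) uv w0 m0 => w m uv w0 m0.
  have m1 : m%:~R != 0 :> rat by rewrite gt_eqF.
  have w1 : w%:~R != 0 :> rat by apply/eqP => w1; move: w0; rewrite w1 ?oppr0 ltxx.
  by case: q q4 uv => [|[|[|[|//]]]] _ /= [-> ->];
  rewrite !(rmorphB, rmorphD, rmorphM, rmorphN) /=; split; field; rewrite ?oppr_eq0 ?m1 ?w1.
exists (mult a)%:~R^-1; first by rewrite invr_gt0.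
clear - uv q4 m0 hx n_gt1.
rewrite /ptx /pty /frac /=; move: (mult (a - turn q)) (mult a) uv m0 => w m uv m0.
  have m1 : m%:~R != 0 :> rat by rewrite gt_eqF.
by case: q q4 uv => [|[|[|[|//]]]] _ /= [-> ->];
rewrite !(rmorphB, rmorphD, rmorphM, rmorphN) /=; split; field; rewrite ?m1.
Qed.
End Endpoints.
End BoundaryEndpoints.

(** * Orientation of boundary points of the square *)

Module OrientedTriples.
Import CyclicPeeling ProfileFunction BoundaryEndpoints.
Import Order.TTheory GRing.Theory Num.Theory.
Local Open Scope ring_scope.

Section Arrangement.
Variables (n x : nat).
Hypothesis n_gt1 : (1 < n)%N.
Hypothesis hx : (0 < x < n)%N.
Local Notation N := n%:Z.
Local Notation ptx := (ptx n).
Local Notation pty := (pty n).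
Local Notation frac := (frac n).
Local Notation valid := (valid n).
Let frac_gt0_lt1 := frac_gt0_lt1 n_gt1 hx.
Implicit Types e f g : endpoint.

Definition tri e f g : rat :=
  (ptx f - ptx e) * (pty g - pty e) - (pty f - pty e) * (ptx g - ptx e).

Lemma triC e f g : tri e f g = tri f g e. Proof. by rewrite /tri; ring. Qed.
Lemma tri_swap e f g : tri e g f = - tri e f g. Proof. by rewrite /tri; ring. Qed.

(** Weak order along the boundary, counterclockwise from the corner (0, 0); distinct letters may
    share a point. *)
Definition before e f := (e.1.1 < f.1.1)%N || (e.1.1 == f.1.1) && (frac e <= frac f).

Lemma before_trans e f g : before e f -> before f g -> before e g.
Proof.
rewrite /before; case: (ltngtP e.1.1 f.1.1) => //= [lt _|-> le1].
  by case/orP => [lt'|/andP[/eqP<- _]]; [rewrite (ltn_trans lt lt')|rewrite lt].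
by case/orP => [->//|/andP[-> /(le_trans le1) ->]]; rewrite orbT.
Qed.

(** Points met in this order on the boundary of a convex region are never clockwise. The value 0
    arises from coincident points or from three points on one side. *)
Lemma tri_ge0 e f g : valid e -> valid f -> valid g ->
  before e f -> before f g -> 0 <= tri e f g.
Proof.
move=> ve vf vg; have := frac_gt0_lt1 ve; have := frac_gt0_lt1 vf; have := frac_gt0_lt1 vg.
case/and3P: ve vf vg => q1 _ _ /and3P[q2 _ _] /and3P[q3 _ _].
rewrite /before /tri /BoundaryEndpoints.ptx /BoundaryEndpoints.pty.
move: (frac e) (frac f) (frac g) => s1 s2 s3 h3 h2 h1.
case: e.1.1 q1 => [|[|[|[|//]]]] _; case: f.1.1 q2 => [|[|[|[|//]]]] _ //=;
case: g.1.1 q3 => [|[|[|[|//]]]] _ //=; nra.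
Qed.

Definition sbefore e f := (e.1.1 < f.1.1)%N || (e.1.1 == f.1.1) && (frac e < frac f).

Lemma tri_gt0 e f g : valid e -> valid f -> valid g ->
  sbefore e f -> sbefore f g -> e.1.1 != g.1.1 -> 0 < tri e f g.
Proof.
move=> ve vf vg; have := frac_gt0_lt1 ve; have := frac_gt0_lt1 vf; have := frac_gt0_lt1 vg.
case/and3P: ve vf vg => q1 _ _ /and3P[q2 _ _] /and3P[q3 _ _].
rewrite /sbefore /tri /BoundaryEndpoints.ptx /BoundaryEndpoints.pty.
move: (frac e) (frac f) (frac g) => s1 s2 s3 h3 h2 h1.
case: e.1.1 q1 => [|[|[|[|//]]]] _; case: f.1.1 q2 => [|[|[|[|//]]]] _ //=;
case: g.1.1 q3 => [|[|[|[|//]]]] _ //=; nra.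
Qed.

Lemma before_strict e f : before e f -> sbefore e f \/ (e.1.1, frac e) = (f.1.1, frac f).
Proof.
rewrite /before /sbefore => /orP[->|/andP[/eqP-> h]]; first by left.
move: h; rewrite le_eqVlt => /orP[/eqP->|->]; first by right.
by left; rewrite eqxx orbT.
Qed.

Lemma before_side e f : before e f -> (e.1.1 <= f.1.1)%N.
Proof. by case/orP => [/ltnW|/andP[/eqP->]]. Qed.
End Arrangement.
End OrientedTriples.

(** * Chords as straight segments in the square *)

Module StraightChords.
Import CyclicPeeling ProfileFunction BoundaryEndpoints OrientedTriples.
Import Order.TTheory GRing.Theory Num.Theory.
Local Open Scope ring_scope.

Section Arrangement.
Variables (n x : nat).
Hypothesis n_gt1 : (1 < n)%N.
Hypothesis hx : (0 < x < n)%N.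
Local Notation mult := (mult n).
Local Notation N := n%:Z.
Local Notation X := x%:Z.
Local Notation ptx := (ptx n).
Local Notation pty := (pty n).
Local Notation frac := (frac n).
Local Notation partner := (partner n x).
Local Notation valid := (valid n).
Local Notation dir := (dir n x).
Local Notation height := (height n x).
Local Notation mdet := (mdet n x).
Let frac_gt0_lt1 := frac_gt0_lt1 n_gt1 hx.
Let valid_partner := valid_partner n_gt1 hx.
Let partnerP := partnerP n_gt1 hx.
Let chord_vector := chord_vector n_gt1 hx.
Implicit Types e f g : endpoint.

Local Notation tri := (tri n).
Lemma mdetR d d' : (mdet d d')%:~R =
  (mult d)%:~R * (mult (d' - X))%:~R - (mult (d - X))%:~R * (mult d')%:~R :> rat.
Proof.
rewrite /BoundaryEndpoints.mdet; move: (mult d) (mult d') (mult (d - X)) (mult (d' - X)) => a b c e.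
by rewrite rmorphB !rmorphM.
Qed.

Lemma partner_side e : valid e -> (partner e).1.1 != e.1.1.
Proof.
case: e => [[q a] k] ve; case/and3P: (ve) => q4 _ _.
have {}q4 : (q < 4)%N := q4.
have pm i : (0 < i < 4)%N -> ((q + i) %% 4)%N != q by clear - q4; lia.
by case: (partnerP ve) => *; apply: pm.
Qed.

(** On one side 2|a| < n, so parallel directions come from the same letter, whose occurrences have
    different positions. *)
Lemma same_point e f m : valid e -> valid f -> (e.1.1, frac e) = (f.1.1, frac f) ->
  dir f = dir e + N * m -> f = e.
Proof.
case: e f => [[q a] k] [[q' a'] k'] /and3P[/= _ h1 h2] /and3P[/= _ h3 h4] [<-].
rewrite /BoundaryEndpoints.dir /= => fr dr.
have am : a' = a.
  suff : m = 0 by move=> m0; move: dr; rewrite m0; lia.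
  have : a' - a = N * m by lia.
  move: h1 h3 n_gt1; clear; nia.
move: fr; rewrite am in h4 *; rewrite /BoundaryEndpoints.frac /= => /mulIf.
rewrite invr_eq0 intr_eq0 => h; have {h}/eqP : (2 * k + 1)%:~R = (2 * k' + 1)%:~R :> rat.
  by apply: h; lia.
by rewrite eqr_int => /eqP e2; congr (_, _, _); lia.
Qed.

Definition hgt d f := height d (ptx f) (pty f).

Lemma tri_hgt e : valid e -> exists2 l : rat, 0 < l &
  forall f, tri e f (partner e) = l * (hgt (dir e) f - hgt (dir e) e).
Proof.
move=> /chord_vector[l l0 [e1 e2]]; exists l => // f.
by rewrite /tri e1 e2 /hgt /BoundaryEndpoints.height; ring.
Qed.

Lemma hgt_partner d e : valid e -> exists2 l : rat, 0 < l &
  hgt d (partner e) - hgt d e = l * (mdet (dir e) d)%:~R.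
Proof.
move=> /chord_vector[l l0 [e1 e2]]; exists l => //.
by rewrite /hgt e1 e2 /BoundaryEndpoints.height mdetR; ring.
Qed.

Lemma boundary_point e : valid e -> [/\ 0 <= ptx e <= 1, 0 <= pty e <= 1 &
  ~ (0 < ptx e < 1 /\ 0 < pty e < 1)].
Proof.
move=> ve; have := frac_gt0_lt1 ve; case/and3P: ve => q _ _.
rewrite /BoundaryEndpoints.ptx /BoundaryEndpoints.pty; move: (frac e) => s hs.
by case: e.1.1 q => [|[|[|[|//]]]] _ /=; split; lra.
Qed.

(** Otherwise the interior point would lie on the line of the chord but not strictly between its
    ends. One end would then be a convex combination of this point, with positive weight, and the
    other end, hence itself interior to the square. *)
Lemma chord_cross e d z1 z2 : valid e -> 0 < z1 < 1 -> 0 < z2 < 1 ->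
  height (dir e) z1 z2 = hgt (dir e) e -> 0 < mdet (dir e) d ->
  hgt d e < height d z1 z2 < hgt d (partner e).
Proof.
move=> ve h1 h2 hz D0.
have [l l0 [e1 e2]] := chord_vector ve.
have [b1 b2 b3] := boundary_point ve.
have [c1 c2 c3] := boundary_point (valid_partner ve).
have {D0} : 0 < (mdet (dir e) d)%:~R :> rat by rewrite ltr0z.
move: hz; rewrite /hgt; rewrite /BoundaryEndpoints.height mdetR.
move: e1 e2 c1 c2 c3.
set A := (mult (dir e))%:~R; set B := (mult (dir e - X))%:~R.
set A' := (mult d)%:~R; set B' := (mult (d - X))%:~R.
move: A B A' B' => A B A' B'.
move: b1 b2 b3; move: (ptx e) (pty e) (ptx (partner e)) (pty (partner e)) => p1 p2 q1 q2.
move=> b1 b2 b3 e1 e2 c1 c2 c3 hz D0.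
set D := A * B' - B * A' in D0.
set u := (A' * z1 + B' * z2) - (A' * p1 + B' * p2).
have f1 : D * (z1 - p1) = - u * B.
  have -> : D * (z1 - p1) = B' * (A * z1 + B * z2 - (A * p1 + B * p2)) - u * B
    by rewrite /D /u; ring.
  by rewrite hz; ring.
have f2 : D * (z2 - p2) = u * A.
  have -> : D * (z2 - p2) = - A' * (A * z1 + B * z2 - (A * p1 + B * p2)) + u * A
    by rewrite /D /u; ring.
  by rewrite hz; ring.
have hq : A' * q1 + B' * q2 - (A' * p1 + B' * p2) = l * D by rewrite e1 e2 /D; ring.
have {f1 f2 hz hq} [g1 g2 g3] : [/\ D * l * (z1 - p1) = u * (q1 - p1),
    D * l * (z2 - p2) = u * (q2 - p2) &
    A' * q1 + B' * q2 - (A' * p1 + B' * p2) = l * D].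
  split=> //.
    have -> : D * l * (z1 - p1) = l * (D * (z1 - p1)) by rewrite (mulrC D) mulrA.
    by rewrite f1 e1; ring.
  have -> : D * l * (z2 - p2) = l * (D * (z2 - p2)) by rewrite (mulrC D) mulrA.
  by rewrite f2 e2; ring.
have Dl : 0 < D * l by apply: mulr_gt0.
rewrite -subr_gt0 -/u; apply/andP; split.
  rewrite ltNge; apply/negP => u0; apply: b3.
  move: Dl u0 g1 g2 h1 h2 b1 b2 c1 c2; clear; move: (D * l) => K.
  by move=> *; split; apply/andP; split; nra.
rewrite -subr_gt0; have -> : A' * q1 + B' * q2 - (A' * z1 + B' * z2) = D * l - u.
  by rewrite /u; lra.
rewrite ltNge; apply/negP => u0; apply: c3.
move: Dl u0 g1 g2 h1 h2 b1 b2 c1 c2; clear; move: (D * l) => K.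
by move=> *; split; apply/andP; split; nra.
Qed.
End Arrangement.
End StraightChords.

(** * Crossings of chords *)

Module ChordCrossings.
Import CyclicPeeling ProfileFunction BoundaryEndpoints OrientedTriples StraightChords.
Import Order.TTheory GRing.Theory Num.Theory.
Local Open Scope ring_scope.

Lemma lra_aux1 (o : rat) : o < -1 -> o <= 1. Proof. lra. Qed.
Lemma lra_aux2 (o : rat) : 1 < o -> -1 <= o. Proof. lra. Qed.
Lemma lra_aux3 (l o1 o2 o3 o4 : rat) : l <= o1 -> l <= o2 -> o3 <= l -> o4 <= l ->
  1 < l \/ l < -1 -> o1 <= 1 \/ o2 <= 1 -> -1 <= o3 \/ -1 <= o4 -> False.
Proof. by move=> ? ? ? ? [?|?] [?|?] [?|?]; lra. Qed.

Section Arrangement.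
Variables (n x : nat).
Hypothesis n_gt1 : (1 < n)%N.
Hypothesis hx : (0 < x < n)%N.
Local Notation mult := (mult n).
Local Notation N := n%:Z.
Local Notation X := x%:Z.
Local Notation ptx := (ptx n).
Local Notation pty := (pty n).
Local Notation frac := (frac n).
Local Notation partner := (partner n x).
Local Notation valid := (valid n).
Local Notation dir := (dir n x).
Local Notation level := (level n x).
Local Notation height := (height n x).
Local Notation mdet := (mdet n x).
Local Notation residue := (residue n).
Let partnerK := partnerK n_gt1 hx.
Let valid_partner := valid_partner n_gt1 hx.
Let level_partner := level_partner n_gt1 hx.
Let dir_partner := dir_partner n_gt1 hx.
Let height_level := height_level n_gt1 hx.
Implicit Types e f g : endpoint.

Local Notation tri := (tri n).
Local Notation before := (before n).
Let tri_ge0 := tri_ge0 n_gt1 hx.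
Let tri_gt0 := tri_gt0 n_gt1 hx.
Let before_strict := @before_strict n.
Let before_side := @before_side n.
Local Notation hgt := (hgt n x).
Let mdetR := @mdetR n x.
Let partner_side := partner_side n_gt1 hx.
Let same_point := same_point n_gt1 hx.
Let tri_hgt := tri_hgt n_gt1 hx.
Let hgt_partner := hgt_partner n_gt1 hx.
Let chord_cross := chord_cross n_gt1 hx.
Local Notation central := (central n x).

Let x_range : 0 < X < N. Proof. by clear - hx; lia. Qed.

(** Signed position of [e] relative to the centre of the square, measured across direction [d]; it
    extends [level] to other directions. *)
Definition offset d e : rat := 2 * hgt d e - (mult d + mult (d - X))%:~R.

Lemma offset_level e : valid e -> offset (dir e) e = (level e)%:~R.
Proof. exact: height_level. Qed.

(** A central chord meets both innermost lines of direction [d], those of offset 1 and -1, inside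
    the open square, and so runs across the whole strip between them. *)
Lemma central_offset e d : valid e -> central e -> 0 < mdet (dir e) d ->
  offset d e < -1 /\ 1 < offset d (partner e).
Proof.
move=> ve ce D0.
have ineq : (`|mult (d - X)| + `|mult (dir e - X)| < mdet (dir e) d) /\
            (`|mult d| + `|mult (dir e)| < mdet (dir e) d).
  have hX := x_range.
  have [[h _]|[_ h]|[_ h]|[_ h]] := mdet_sign n_gt1 (dir e) d hX; try by move: D0; lia.
  have [k [dE _]] := residue_spec n_gt1 (d - dir e).
  have -> : mdet (dir e) d = mdet (dir e) (dir e + residue (d - dir e)).
    by rewrite -(mdet_mod n_gt1 x (dir e) (dir e + residue (d - dir e)) k); congr BoundaryEndpoints.mdet; lia.
  by split; apply: mdet_gt => //; rewrite addrAC subrr add0r.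
have [t tE t1] : exists2 t : rat, t = (level e)%:~R & (t = 1 \/ t = -1).
  by exists (level e)%:~R => //; case/orP: ce => /eqP->; [left|right].
have := offset_level ve; rewrite /offset -tE => lv.
have cross (eta : rat) : eta = 1 \/ eta = -1 ->
    2 * hgt d e - (mult d + mult (d - X))%:~R < eta <
    2 * hgt d (partner e) - (mult d + mult (d - X))%:~R.
  move=> heta.
  have D1 : 0 < (mdet (dir e) d)%:~R :> rat by rewrite ltr0z.
  pose D : rat := (mdet (dir e) d)%:~R.
  (* Cramer's rule for the point of offset [t] in the direction of [e] and [eta] in direction [d].
     As |t| = |eta| = 1, the bounds in [ineq] keep both coordinates within 1/2 of the centre. *)
  pose z1 : rat := 1 / 2 + (t * (mult (d - X))%:~R - eta * (mult (dir e - X))%:~R) / (2 * D).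
  pose z2 : rat := 1 / 2 + (eta * (mult (dir e))%:~R - t * (mult d)%:~R) / (2 * D).
  have [j1 j2] := ineq.
  have i1 : `|(mult (d - X))%:~R| + `|(mult (dir e - X))%:~R| < D.
    by rewrite -!intr_norm -intrD ltr_int.
  have i2 : `|(mult d)%:~R| + `|(mult (dir e))%:~R| < D.
    by rewrite -!intr_norm -intrD ltr_int.
  have bound (a b : rat) : `|a| + `|b| < D ->
      0 < 1 / 2 + (t * a - eta * b) / (2 * D) < 1.
    move=> ab.
    have : `|(t * a - eta * b) / (2 * D)| < 1 / 2.
      rewrite normrM normfV (gtr0_norm (_ : 0 < 2 * D)); last by rewrite mulr_gt0.
      rewrite ltr_pdivrMr ?mulr_gt0 // mulrA divrK ?unitfE // mul1r.
      apply: le_lt_trans ab; apply: le_trans (ler_normB _ _) _.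
      by rewrite !normrM; case: t1 => ->; case: heta => ->; rewrite ?normrN normr1 !mul1r.
    by rewrite ltr_norml; lra.
  have hz1 : 0 < z1 < 1 by exact: (bound _ _ i1).
  have hz2 : 0 < z2 < 1.
    have -> : z2 = 1 / 2 + (t * - (mult d)%:~R - eta * - (mult (dir e))%:~R) / (2 * D).
      by rewrite /z2; congr (_ + _ / _); rewrite !mulrN opprK addrC.
    by apply: bound; rewrite !normrN.
  have DN : D != 0 by rewrite gt_eqF.
  have e1 : 2 * height (dir e) z1 z2 - (mult (dir e) + mult (dir e - X))%:~R = t.
    rewrite /BoundaryEndpoints.height /z1 /z2 rmorphD /= /D; move: DN; rewrite /D mdetR.
    set A := (mult (dir e))%:~R; set B := (mult (dir e - X))%:~R.
    set A' := (mult d)%:~R; set B' := (mult (d - X))%:~R.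
    move=> DN; field; exact: DN.
  have e2 : 2 * height d z1 z2 - (mult d + mult (d - X))%:~R = eta.
    rewrite /BoundaryEndpoints.height /z1 /z2 rmorphD /= /D; move: DN; rewrite /D mdetR.
    set A := (mult (dir e))%:~R; set B := (mult (dir e - X))%:~R.
    set A' := (mult d)%:~R; set B' := (mult (d - X))%:~R.
    move=> DN; field; exact: DN.
  have := chord_cross (d := d) ve hz1 hz2 _ D0; move: e2 lv e1; rewrite /StraightChords.hgt.
  move=> e2 lv e1 /(_ _) h; have {h} : height (dir e) z1 z2 = height (dir e) (ptx e) (pty e) by lra.
  by move=> hh; have := chord_cross (d := d) ve hz1 hz2 hh D0; rewrite /StraightChords.hgt; lra.
have := cross 1 (or_introl erefl); have := cross (-1) (or_intror erefl); lra.
Qed.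

Lemma central_offset_neg e d : valid e -> central e -> mdet (dir e) d < 0 ->
  1 < offset d e /\ offset d (partner e) < -1.
Proof.
move=> ve ce D0.
have [h1 h2] : offset d (partner e) < -1 /\ 1 < offset d (partner (partner e)).
  apply: central_offset; first exact: valid_partner.
    by move: ce; rewrite /BoundaryEndpoints.central level_partner //; lia.
  have mN a : mdet (a + N) d = - mdet a d.
    by rewrite BoundaryEndpoints.mdetC mdetDn // opprK BoundaryEndpoints.mdetC.
  case: (dir_partner ve) => ->; first by rewrite mN oppr_gt0.
  by rewrite -oppr_lt0 -mN subrK.
by rewrite partnerK // in h2.
Qed.

Section Boundary.
Variable s : seq endpoint.
Hypothesis us : uniq s.
Hypothesis vs : all valid s.
Hypothesis partner_s : {in s, forall e, partner e \in s}.
Hypothesis before_s : {in s &, forall e f, (index e s < index f s)%N -> before e f}.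

Let sv e : e \in s -> valid e. Proof. exact: (allP vs). Qed.

Lemma cyc_tri_ge0 : {in s & &, forall e f g, cyc s e f g -> 0 <= tri e f g}.
Proof.
have T : {in s & &, forall e f g, (index e s < index f s < index g s)%N -> 0 <= tri e f g}.
  by move=> e f g es fs gs /andP[h1 h2]; apply: tri_ge0; auto.
move=> e f g es fs gs /or3P[]; first exact: T.
  by move=> h; rewrite triC; apply: T.
by move=> h; rewrite -triC; apply: T.
Qed.

(** Only strict orientation decides the cyclic order: letters at a common point are ordered by the
    list alone. *)
Lemma cyc_of_tri : {in s & &, forall e f g, 0 < tri e f g -> cyc s e f g}.
Proof.
move=> e f g es fs gs t0.
have ne : [/\ e != f, f != g & g != e].
  by split; apply: contraTneq t0 => ->; rewrite /OrientedTriples.tri -leNgt; nra.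
case: ne => n1 n2 n3; apply/negPn/negP => h.
have := cyc_flip es fs gs n1 n2 n3 h.
by move/(cyc_tri_ge0 es gs fs); rewrite tri_swap oppr_ge0 leNgt t0.
Qed.

Lemma cyc_tri_neq0 : {in s & &, forall e f g, cyc s e f g -> e.1.1 != g.1.1 ->
  (e.1.1, frac e) <> (f.1.1, frac f) -> (f.1.1, frac f) <> (g.1.1, frac g) ->
  0 < tri e f g}.
Proof.
move=> e f g es fs gs.
have [ve vf vg] : [/\ valid e, valid f & valid g] by split; apply: sv.
have st a b : a \in s -> b \in s -> (index a s < index b s)%N -> before a b by exact: before_s.
case/or3P => /andP[h1 h2] neg ef fg.
- have [b1|//] := before_strict (st _ _ es fs h1).
  have [b2|//] := before_strict (st _ _ fs gs h2).
  exact: tri_gt0.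
- have [b1|//] := before_strict (st _ _ fs gs h1).
  have b2 := st _ _ gs es h2.
  have [b3|eg] := before_strict b2; last by case: eg neg => -> _; rewrite eqxx.
  rewrite triC; apply: tri_gt0 => //.
  have i1 := before_side (st _ _ fs gs h1); have i2 := before_side b2.
  by clear - i1 i2 neg; lia.
have [b1|//] := before_strict (st _ _ es fs h2).
have b2 := st _ _ gs es h1.
have [b3|eg] := before_strict b2; last by case: eg neg => -> _; rewrite eqxx.
rewrite -triC; apply: tri_gt0 => //.
have i1 := before_side (st _ _ es fs h2); have i2 := before_side b2.
by clear - i1 i2 neg; lia.
Qed.

Lemma cyc_hgt e f : e \in s -> f \in s -> cyc s e f (partner e) ->
  hgt (dir e) e <= hgt (dir e) f.
Proof.
move=> es fs /(cyc_tri_ge0 es fs (partner_s es)).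
have [l l0 ->] := tri_hgt (sv es).
by rewrite pmulr_rge0 // subr_ge0.
Qed.

Lemma cyc_hgt' e f : e \in s -> f \in s -> cyc s e (partner e) f ->
  hgt (dir e) f <= hgt (dir e) e.
Proof.
move=> es fs /(cyc_tri_ge0 es (partner_s es) fs).
have [l l0 h] := tri_hgt (sv es).
by rewrite tri_swap h oppr_ge0 pmulr_rle0 // subr_le0.
Qed.

Lemma hgt_cyc e f : e \in s -> f \in s -> hgt (dir e) e < hgt (dir e) f ->
  cyc s e f (partner e).
Proof.
move=> es fs lt; apply: cyc_of_tri => //; first exact: partner_s.
have [l l0 ->] := tri_hgt (sv es).
by rewrite pmulr_rgt0 // subr_gt0.
Qed.

Lemma hgt_cyc' e f : e \in s -> f \in s -> hgt (dir e) f < hgt (dir e) e ->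
  cyc s e (partner e) f.
Proof.
move=> es fs lt; apply: cyc_of_tri => //; first exact: partner_s.
have [l l0 h] := tri_hgt (sv es).
by rewrite tri_swap h oppr_gt0 pmulr_rlt0 // subr_lt0.
Qed.

Definition crosses e f := (0 < residue (dir f - dir e) < N).

Lemma boundary_parallel e f m : e \in s -> f \in s -> mdet (dir e) (dir f) = 0 ->
  cyc s e f (partner e) -> cyc s e (partner e) (partner f) ->
  dir f = dir e + N * m -> False.
Proof.
move=> es fs D0 c1 c2 dE.
have ve := sv es; have vf := sv fs; have vp := valid_partner ve.
have h1 := cyc_hgt es fs c1; have h2 := cyc_hgt' es (partner_s fs) c2.
have [l l0 hl] := hgt_partner (dir e) vf.
have h0 : hgt (dir e) f = hgt (dir e) e.
  by move: hl; rewrite BoundaryEndpoints.mdetC D0 oppr0 mulr0 => hl; apply/eqP; rewrite eq_le h1 andbT -(subrK (hgt (dir e) f) (hgt (dir e) (partner f))) hl add0r in h2 *.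
have t0 : ~ 0 < tri e f (partner e).
  by have [l' _ ->] := tri_hgt ve; rewrite h0 subrr mulr0 ltxx.
have [n1 n2 n3] := cyc_neq c1.
apply: t0; apply: cyc_tri_neq0 => //; first exact: partner_s.
- by rewrite eq_sym partner_side.
- by move=> pE; case/eqP: n1; rewrite (same_point ve vf pE dE).
move=> pE; case/eqP: n2.
case: (dir_partner ve) => dp.
  by apply: (same_point (m := m - 1) vp vf (esym pE)); rewrite dp dE; ring.
by apply: (same_point (m := m + 1) vp vf (esym pE)); rewrite dp dE; ring.
Qed.

(** The chord of [f] starts weakly above the line of [e] and ends weakly below it, and [hgt_partner]
    ties this descent to the sign of [mdet (dir f) (dir e)]. Parallel chords are excluded by
    [boundary_parallel]. *)
Lemma boundary_positive : positive partner crosses s.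
Proof.
move=> e f es fs c1 c2.
have hX := x_range.
have ve := sv es; have vf := sv fs.
have h1 := cyc_hgt es fs c1; have h2 := cyc_hgt' es (partner_s fs) c2.
have [l l0 hl] := hgt_partner (dir e) vf.
have Dle : 0 <= mdet (dir e) (dir f).
  have : l * (mdet (dir f) (dir e))%:~R <= 0 by rewrite -hl; lra.
  by rewrite pmulr_rle0 // BoundaryEndpoints.mdetC lerz0 oppr_le0.
rewrite /crosses; have [k [dE _]] := residue_spec n_gt1 (dir f - dir e).
have [[//]|[_]|[r0 D0]|[r0 D0]] := mdet_sign n_gt1 (dir e) (dir f) hX.
- by rewrite ltNge Dle.
- by case: (boundary_parallel es fs D0 c1 c2 (m := 2 * k)); rewrite r0 in dE; clear - dE; lia.
by case: (boundary_parallel es fs D0 c1 c2 (m := 2 * k + 1)); rewrite r0 in dE; clear - dE; lia.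
Qed.

Lemma mult_even a : exists b, mult a = 2 * b.
Proof. by exists ((N ^+ 2 + 1) * mprof n a); rewrite /BoundaryEndpoints.mult mulrA. Qed.

Lemma level_odd e : exists b, level e = 2 * b + 1.
Proof.
rewrite /BoundaryEndpoints.level; have [b ->] := mult_even e.1.2.
have [c ->] := mult_even (e.1.2 - turn n x e.1.1).
by exists (e.2 - b - c); ring.
Qed.

Lemma offset_mod d k e : offset (d + 2 * N * k) e = offset d e.
Proof. by rewrite /offset /StraightChords.hgt /BoundaryEndpoints.height (addrAC d) !mult_mod. Qed.

Lemma offsetDn d e : offset (d + N) e = - offset d e.
Proof.
rewrite /offset /StraightChords.hgt /BoundaryEndpoints.height (addrAC d) !multDn //.
by move: (mult d) (mult (d - X)) => a b; ring.
Qed.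

Lemma offset_residue0 d e : valid e -> residue (d - dir e) = 0 ->
  offset d e = (level e)%:~R.
Proof.
move=> ve r0; have [k [dE _]] := residue_spec n_gt1 (d - dir e).
rewrite -offset_level // -(offset_mod (dir e) k); congr offset; rewrite r0 in dE; lia.
Qed.

Lemma offset_residueN d e : valid e -> residue (d - dir e) = N ->
  offset d e = - (level e)%:~R.
Proof.
move=> ve r0; have [k [dE _]] := residue_spec n_gt1 (d - dir e).
rewrite -offset_level // -(offset_mod (dir e) k) -offsetDn; congr offset; rewrite r0 in dE; lia.
Qed.

Lemma ltr_offset d e f : (offset d e < offset d f) = (hgt d e < hgt d f).
Proof. by rewrite ltrD2r ltr_pM2l. Qed.

Lemma ler_offset d e f : (offset d e <= offset d f) = (hgt d e <= hgt d f).
Proof. by rewrite lerD2r ler_pM2l. Qed.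

Lemma centralP e : central e -> (level e)%:~R = 1 :> rat \/ (level e)%:~R = -1 :> rat.
Proof. by case/orP => /eqP ->; [left|right]. Qed.

(** A chord that is not central has level above 1 or below -1. Across any direction a central chord
    has an end of offset at most 1 and an end of offset at least -1, so it cannot lie entirely
    beyond such a chord as seen from the centre. *)
Lemma boundary_separated : separated partner central s.
Proof.
move=> g gs nCg c c' cs cs' Cc Cc' /(cyc_hgt gs cs) h1 /(cyc_hgt gs (partner_s cs)) h2.
move=> /(cyc_hgt' gs cs') h3 /(cyc_hgt' gs (partner_s cs')) h4.
move: h1 h2 h3 h4; rewrite -!ler_offset (offset_level (sv gs)) => h1 h2 h3 h4.
have hX := x_range.
have lv : 1 < (level g)%:~R :> rat \/ (level g)%:~R < -1 :> rat.
  rewrite -[1]/(1%:~R) -[-1]/((-1)%:~R) !ltr_int.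
  have [b lE] := level_odd g; move: nCg; rewrite /BoundaryEndpoints.central lE; clear; lia.
have k1 : offset (dir g) c <= 1 \/ offset (dir g) (partner c) <= 1.
  have vc := sv cs; have [[_ D0]|[_ D0]|[r0 _]|[r0 _]] := mdet_sign n_gt1 (dir c) (dir g) hX.
  - by have [a _] := central_offset vc Cc D0; left; exact: lra_aux1.
  - by have [_ a] := central_offset_neg vc Cc D0; right; exact: lra_aux1.
  - by rewrite (offset_residue0 vc r0); case: (centralP Cc) => ->; left.
  - by rewrite (offset_residueN vc r0); case: (centralP Cc) => ->; left; rewrite ?opprK.
have k2 : -1 <= offset (dir g) c' \/ -1 <= offset (dir g) (partner c').
  have vc := sv cs'; have [[_ D0]|[_ D0]|[r0 _]|[r0 _]] := mdet_sign n_gt1 (dir c') (dir g) hX.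
  - by have [_ a] := central_offset vc Cc' D0; right; exact: lra_aux2.
  - by have [a _] := central_offset_neg vc Cc' D0; left; exact: lra_aux2.
  - by rewrite (offset_residue0 vc r0); case: (centralP Cc') => ->; left.
  - by rewrite (offset_residueN vc r0); case: (centralP Cc') => ->; left; rewrite ?opprK.
exact: lra_aux3 h1 h2 h3 h4 lv k1 k2.
Qed.

(** Equal direction and level put [f] on the line of [e]. If it is not [e], parallelism keeps it
    away from the points of both ends, and three different boundary points, two of them on different
    sides, cannot be collinear. *)
Lemma line_unique e f : e \in s -> f \in s -> residue (dir f - dir e) = 0 ->
  level f = level e -> f = e.
Proof.
move=> es fs r0 le; have ve := sv es; have vf := sv fs; have vp := valid_partner ve.
have [k [dE _]] := residue_spec n_gt1 (dir f - dir e); rewrite r0 in dE.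
apply/eqP/negPn/negP => nef.
have sp1 : (e.1.1, frac e) <> (f.1.1, frac f).
  by move=> pE; case/eqP: nef; apply: (same_point (m := 2 * k) ve vf pE); clear - dE; lia.
have nfp : f <> partner e.
  by move=> fE; move: le; rewrite fE level_partner //; have [b ->] := level_odd e; clear; lia.
have sp2 : (f.1.1, frac f) <> ((partner e).1.1, frac (partner e)).
  move=> pE; apply: nfp; case: (dir_partner ve) => dp.
    by apply: (same_point (m := 2 * k - 1) vp vf (esym pE)); rewrite dp; clear - dE; lia.
  by apply: (same_point (m := 2 * k + 1) vp vf (esym pE)); rewrite dp; clear - dE; lia.
have h0 : hgt (dir e) f = hgt (dir e) e.
  have r1 : residue (dir e - dir f) = 0.
    have -> : dir e - dir f = 0 + 2 * N * (- k) by clear - dE; lia.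
    by apply: residue_small => //; clear - n_gt1; lia.
  have := offset_residue0 vf r1; rewrite le -offset_level // => o.
  by apply/eqP; rewrite eq_le -!ler_offset o lexx.
have ps := partner_s es; have pe := partner_side ve.
have [l' _ tE] := tri_hgt ve; have := tE f; rewrite h0 subrr mulr0 => t0.
have [c|c] := boolP (cyc s e f (partner e)).
  by have := cyc_tri_neq0 es fs ps c; rewrite t0 ltxx eq_sym pe => /(_ isT sp1 sp2).
have c' : cyc s (partner e) f e.
  rewrite cycR cycR; apply: cyc_flip => //; first by rewrite eq_sym.
  by apply/eqP.
  by apply: contraNneq pe => ->.
have := cyc_tri_neq0 ps fs es c' pe (fun E => sp2 (esym E)) (fun E => sp1 (esym E)).
by rewrite triC tri_swap -triC tri_swap triC -(oppr0) -t0 /OrientedTriples.tri; lra.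
Qed.

(** Across the direction of [e], the ends of [f] lie beyond the lines of offset 1 and -1 on either
    side ([central_offset_neg]), and the chord of [e] is on one of these lines. *)
Lemma central_cross e f : e \in s -> f \in s -> central e -> central f ->
  0 < residue (dir f - dir e) < N ->
  cyc s e f (partner e) /\ cyc s e (partner e) (partner f).
Proof.
move=> es fs Ce Cf hr; have ve := sv es; have vf := sv fs.
have hX := x_range.
have D0 : mdet (dir f) (dir e) < 0.
  rewrite BoundaryEndpoints.mdetC oppr_lt0.
  have [[_ h]//|[h _]|[h _]|[h _]] := mdet_sign n_gt1 (dir e) (dir f) hX.
  - by exfalso; move: hr h; clear - n_gt1; move: (residue _) => r; lia.
  - by exfalso; move: hr h; clear - n_gt1; move: (residue _) => r; lia.
  by exfalso; move: hr h; clear - n_gt1; move: (residue _) => r; lia.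
have [a b] := central_offset_neg vf Cf D0.
have := offset_level ve; case: (centralP Ce) => -> lv.
- by split; [apply: hgt_cyc|apply: hgt_cyc'] => //; rewrite ?partner_s // -ltr_offset lv // (lt_trans b).
- by split; [apply: hgt_cyc|apply: hgt_cyc'] => //; rewrite ?partner_s // -ltr_offset lv // (lt_trans _ a).
Qed.

Lemma central_cross' e f : e \in s -> f \in s -> central e -> central f ->
  N < residue (dir f - dir e) ->
  cyc s e (partner f) (partner e) /\ cyc s e (partner e) f.
Proof.
move=> es fs Ce Cf hr; have vf := sv fs.
have [k [dE hb]] := residue_spec n_gt1 (dir f - dir e).
have := central_cross es (partner_s fs) Ce; rewrite partnerK //; apply.
  by move: Cf; rewrite /BoundaryEndpoints.central level_partner //; clear; lia.
set r := residue _ in dE hb hr.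
case: (dir_partner vf) => ->.
  have -> : dir f + N - dir e = (r - N) + 2 * N * (k + 1) by clear - dE; lia.
  by rewrite residue_small //; clear - hb hr; lia.
have -> : dir f - N - dir e = (r - N) + 2 * N * k by clear - dE; lia.
by rewrite residue_small //; clear - hb hr; lia.
Qed.

(** The two central chords of one direction do not cross; the four facts record on which side of
    each the other one lies. *)
Lemma central_sibling e f : e \in s -> f \in s -> residue (dir f - dir e) = 0 ->
  level e = -1 -> level f = 1 ->
  [/\ cyc s e f (partner e), cyc s e (partner f) (partner e),
      cyc s f (partner f) e & cyc s f (partner f) (partner e)].
Proof.
move=> es fs r0 le lf; have ve := sv es; have vf := sv fs.
have [k [dE _]] := residue_spec n_gt1 (dir f - dir e); rewrite r0 in dE.
have r1 : residue (dir e - dir f) = 0.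
  have -> : dir e - dir f = 0 + 2 * N * (- k) by clear - dE; lia.
  by apply: residue_small => //; clear - n_gt1; lia.
have rN m a b : dir a = dir b + N + 2 * N * m -> residue (dir a - dir b) = N.
  move=> ->; have -> : dir b + N + 2 * N * m - dir b = N + 2 * N * m by ring.
  by apply: residue_small => //; clear - n_gt1; lia.
have q1 : residue (dir e - dir (partner f)) = N.
  case: (dir_partner vf) => h; first by apply: (rN (- k - 1)); clear - h dE; lia.
  by apply: (rN (- k)); clear - h dE; lia.
have q2 : residue (dir f - dir (partner e)) = N.
  case: (dir_partner ve) => h; first by apply: (rN (k - 1)); clear - h dE; lia.
  by apply: (rN k); clear - h dE; lia.
have o1 := offset_level ve; have o2 := offset_level vf.
have o3 := offset_residue0 vf r1; have o4 := offset_residue0 ve r0.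
have o5 := offset_residueN (valid_partner vf) q1; have o6 := offset_residueN (valid_partner ve) q2.
rewrite level_partner // in o5; rewrite level_partner // in o6.
rewrite le in o1 o4 o6; rewrite lf in o2 o3 o5.
split; [apply: hgt_cyc|apply: hgt_cyc|apply: hgt_cyc'|apply: hgt_cyc'] => //; rewrite ?partner_s //.
all: by rewrite -ltr_offset ?o1 ?o2 ?o3 ?o4 ?o5 ?o6.
Qed.
End Boundary.
End Arrangement.
End ChordCrossings.

(** * Cyclic order of the central chords *)

Module CentralChords.
Import CyclicPeeling ProfileFunction BoundaryEndpoints OrientedTriples StraightChords ChordCrossings.
Import Order.TTheory GRing.Theory Num.Theory.
Local Open Scope ring_scope.

Section Cyc3Facts.
Variables z a b pz pa pb : nat.

(** In this and the next five facts [pz], [pa], [pb] stand for the other ends of the chords at [z],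
    [a], [b]. Each covers one pattern of crossing and parallel chords in [central_order]. *)
Lemma cyc3_sibling_cross : cyc3 z a pz -> cyc3 z pa pz -> cyc3 a pa z ->
  cyc3 z b pz -> cyc3 z pz pb -> cyc3 a b pa -> cyc3 a pa pb -> cyc3 z a b.
Proof. cyc_lia. Qed.

Lemma cyc3_cross_cross : cyc3 z a pz -> cyc3 z pz pa ->
  cyc3 z b pz -> cyc3 z pz pb -> cyc3 a b pa -> cyc3 a pa pb -> cyc3 z a b.
Proof. cyc_lia. Qed.

Lemma cyc3_cross_sibling : cyc3 z a pz -> cyc3 z pz pa ->
  cyc3 z b pz -> cyc3 z pz pb -> cyc3 a b pa -> cyc3 a pb pa -> cyc3 b pb a ->
  cyc3 z a b.
Proof. cyc_lia. Qed.

Lemma cyc3_cross_opposite : cyc3 z pb pz -> cyc3 z b pz -> cyc3 pb b z ->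
  cyc3 z a pz -> cyc3 z pz pa -> cyc3 pb a b -> cyc3 pb b pa -> cyc3 z a b.
Proof. cyc_lia. Qed.

Lemma cyc3_second_cross : cyc3 z pa pz -> cyc3 z pz a ->
  cyc3 z pb pz -> cyc3 z pz b -> cyc3 pa pb a -> cyc3 pa a b -> cyc3 z a b.
Proof. cyc_lia. Qed.

Lemma cyc3_second_sibling : cyc3 z pa pz -> cyc3 z pz a ->
  cyc3 z pb pz -> cyc3 z pz b -> cyc3 pb pa b -> cyc3 pb a b -> cyc3 pa a pb ->
  cyc3 z a b.
Proof. cyc_lia. Qed.
End Cyc3Facts.

Section Arrangement.
Variables (n x : nat).
Hypothesis n_gt1 : (1 < n)%N.
Hypothesis hx : (0 < x < n)%N.
Local Notation mult := (mult n).
Local Notation N := n%:Z.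
Local Notation X := x%:Z.
Local Notation ptx := (ptx n).
Local Notation pty := (pty n).
Local Notation frac := (frac n).
Local Notation partner := (partner n x).
Local Notation valid := (valid n).
Local Notation dir := (dir n x).
Local Notation level := (level n x).
Local Notation height := (height n x).
Local Notation mdet := (mdet n x).
Local Notation residue := (residue n).
Let partnerK := partnerK n_gt1 hx.
Let level_partner := level_partner n_gt1 hx.
Let dir_partner := dir_partner n_gt1 hx.
Implicit Types e f g : endpoint.

Local Notation before := (before n).
Local Notation hgt := (hgt n x).
Let partner_side := partner_side n_gt1 hx.
Let chord_cross := chord_cross n_gt1 hx.
Local Notation central := (central n x).
Let mult_even := @mult_even n.

Section Boundary.
Variable s : seq endpoint.
Hypothesis us : uniq s.
Hypothesis vs : all valid s.
Hypothesis partner_s : {in s, forall e, partner e \in s}.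
Hypothesis before_s : {in s &, forall e f, (index e s < index f s)%N -> before e f}.
Let sv e : e \in s -> valid e. Proof. exact: (allP vs). Qed.
Let x_range : 0 < X < N. Proof. by clear - hx; lia. Qed.
Let line_unique := line_unique n_gt1 hx us vs partner_s before_s.
Let central_cross := central_cross n_gt1 hx vs partner_s before_s.
Let central_cross' := central_cross' n_gt1 hx vs partner_s before_s.
Let central_sibling := central_sibling n_gt1 hx us vs partner_s before_s.
Let cyc_hgt' := @cyc_hgt' _ _ n_gt1 hx s vs partner_s before_s.

Lemma central_level e : central e -> level e = 1 \/ level e = -1.
Proof. by case/orP => /eqP; [left|right]. Qed.

Lemma central_partner e : e \in s -> central e -> central (partner e).
Proof. by move=> es; rewrite /BoundaryEndpoints.central level_partner ?sv //; clear; lia. Qed.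

Lemma residue_sub c d m : residue (d - c) = m -> exists k, d = c + m + 2 * N * k.
Proof.
have [k [dE _]] := residue_spec n_gt1 (d - c) => <-; exists k.
by move: dE; clear; lia.
Qed.

Lemma residueE c d m k : d = c + m + 2 * N * k -> 0 <= m < 2 * N -> residue (d - c) = m.
Proof.
move=> -> hm; transitivity (residue (m + 2 * N * k)); last exact: residue_small.
by congr BoundaryEndpoints.residue; ring.
Qed.

Lemma residue_bounds d : 0 <= residue d < 2 * N.
Proof. by have [k []] := residue_spec n_gt1 d. Qed.

Lemma residue_shift d a b : residue (dir a - d) <= residue (dir b - d) ->
  residue (dir b - dir a) = residue (dir b - d) - residue (dir a - d).
Proof.
have [k ka] := residue_sub (erefl (residue (dir a - d))).
have [l lb] := residue_sub (erefl (residue (dir b - d))).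
have := residue_bounds (dir a - d); have := residue_bounds (dir b - d).
move: (residue (dir a - d)) (residue (dir b - d)) ka lb => r r' ka lb h h' le.
by apply: (@residueE _ _ _ (l - k)); [rewrite ka lb; ring|clear - h h' le; lia].
Qed.

Lemma residue_partner z e : e \in s -> N <= residue (dir e - dir z) ->
  residue (dir (partner e) - dir z) = residue (dir e - dir z) - N.
Proof.
move=> es; have [k ka] := residue_sub (erefl (residue (dir e - dir z))).
have := residue_bounds (dir e - dir z); move: (residue _) ka => r ka h h'.
have [->|->] := dir_partner (sv es); rewrite ka.
  by apply: (@residueE _ _ _ (k + 1)); [ring|clear - h h'; lia].
by apply: (@residueE _ _ _ k); [ring|clear - h h'; lia].
Qed.

Section Order.
Variable z : endpoint.
Hypothesis zs : z \in s.
Hypothesis Cz : central z.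
Hypothesis lz : level z = -1.

(** The expected place of a central endpoint counterclockwise from [z]: directions increase, and of
    two equal directions the one at level -1 comes first. The other end of [z] has rank 2n+1. *)
Definition rank e : int := 2 * residue (dir e - dir z) + (level e == 1)%:Z.

Let pz := partner_s zs.
Let lpz : level (partner z) = 1. Proof. by rewrite level_partner ?sv // lz. Qed.
Let zz : residue (dir z - dir z) = 0.
Proof. by apply: (@residueE _ _ _ 0); [ring|clear - n_gt1; lia]. Qed.

Let partner_z e : e \in s -> residue (dir e - dir z) = N -> level e = 1 -> e = partner z.
Proof.
move=> es r1 l1; rewrite -[LHS](partnerK (sv es)); congr partner.
apply: line_unique => //; first exact: partner_s.
  by rewrite residue_partner ?r1 ?subrr.
by rewrite level_partner ?sv // l1 lz.
Qed.

Let sibling_z e : e \in s -> central e -> residue (dir e - dir z) = N -> level e = -1 ->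
  [/\ cyc s z (partner e) (partner z), cyc s z e (partner z),
      cyc s (partner e) e z & cyc s (partner e) e (partner z)].
Proof.
move=> es Ce r1 l1; have := central_sibling zs (partner_s es); rewrite partnerK ?sv //; apply=> //.
  by rewrite residue_partner ?r1 ?subrr.
by rewrite level_partner ?sv // l1.
Qed.

Let rankP e : central e -> exists2 r, r = residue (dir e - dir z) &
  0 <= r < 2 * N /\ (level e = 1 /\ rank e = 2 * r + 1 \/ level e = -1 /\ rank e = 2 * r).
Proof.
move=> Ce; exists (residue (dir e - dir z)) => //; split; first exact: residue_bounds.
by rewrite /rank; case: (central_level Ce) => ->; [left|right]; rewrite ?eqxx ?addr0.
Qed.

Let cross_z e : e \in s -> central e -> 0 < residue (dir e - dir z) < N ->
  cyc s z e (partner z) /\ cyc s z (partner z) (partner e).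
Proof. by move=> es Ce; apply: central_cross. Qed.

Let cross_z' e : e \in s -> central e -> N < residue (dir e - dir z) ->
  cyc s z (partner e) (partner z) /\ cyc s z (partner z) e.
Proof. by move=> es Ce; apply: central_cross'. Qed.

Lemma central_first_half e : e \in s -> central e -> 0 < rank e < 2 * N + 1 ->
  cyc s z e (partner z).
Proof.
move=> es Ce; have [r rE [rb lr]] := rankP Ce => hr.
have [r0|r0] := eqVneq r 0.
  case: lr => -[l1 rk]; last by move: hr; rewrite rk r0.
  by have := central_sibling zs es (etrans (esym rE) r0) lz l1; case.
have [rN|rN|rN] := ltgtP r N.
- by have [] := cross_z es Ce; rewrite -?rE //; clear - rb r0 rN; lia.
- by move: hr; clear - lr rN; lia.
case: lr => -[l1 rk]; first by move: hr; clear - rk rN; lia.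
by have := sibling_z es Ce (etrans (esym rE) rN) l1; case.
Qed.

Lemma central_second_half e : e \in s -> central e -> 2 * N + 1 < rank e ->
  cyc s z (partner z) e.
Proof.
move=> es Ce; have [r rE [rb lr]] := rankP Ce => hr.
have [] := cross_z' es Ce => //; rewrite -rE; move: hr; clear - lr; lia.
Qed.

(** If rank 2n+1 separates the two ranks, transitivity through [partner z] suffices. Otherwise the
    chords are compared with that of [z] and with each other, by way of their partners when both
    ranks exceed 2n+1. *)
Lemma central_order a b : a \in s -> b \in s -> central a -> central b ->
  0 < rank a -> rank a < rank b -> cyc s z a b.
Proof.
move=> as_ bs Ca Cb a0 ab.
have [ra raE [rab lra]] := rankP Ca; have [rb rbE [rbb lrb]] := rankP Cb.
have le : ra <= rb by clear - lra lrb ab; lia.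
have sub : residue (dir b - dir a) = rb - ra.
  by rewrite raE rbE; apply: residue_shift; rewrite -raE -rbE.
have [aN|aN|aN] := ltgtP (rank a) (2 * N + 1); last first.
- have -> : a = partner z.
    apply: partner_z; rewrite // -?raE; clear - lra aN; lia.
  by apply: central_second_half; rewrite // -aN.
- have bN := lt_trans aN ab.
  have [p1 p2] : cyc s z (partner a) (partner z) /\ cyc s z (partner z) a.
    by apply: cross_z'; rewrite // -raE; clear - lra aN; lia.
  have [p3 p4] : cyc s z (partner b) (partner z) /\ cyc s z (partner z) b.
    by apply: cross_z'; rewrite // -rbE; clear - lrb bN; lia.
  have sab : residue (dir (partner b) - dir (partner a)) = rb - ra.
    have pra : residue (dir (partner a) - dir z) = ra - N.
      by rewrite raE; apply: residue_partner; rewrite // -raE; clear - lra aN; lia.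
    have prb : residue (dir (partner b) - dir z) = rb - N.
      by rewrite rbE; apply: residue_partner; rewrite // -rbE; clear - lrb bN; lia.
    rewrite (@residue_shift (dir z)) pra prb; first by ring.
    by clear - le; lia.
  have [lt|eq] : ra < rb \/ ra = rb by clear - le; lia.
    have [p5 p6] : cyc s (partner a) (partner b) (partner (partner a)) /\
        cyc s (partner a) (partner (partner a)) (partner (partner b)).
      apply: central_cross; rewrite ?partner_s ?central_partner // sab.
      by clear - lt aN rbb lra; lia.
    rewrite !partnerK ?sv // in p5 p6.
    exact: cyc3_second_cross p1 p2 p3 p4 p5 p6.
  have [la lb] : level a = -1 /\ level b = 1 by clear - eq ab lra lrb; lia.
  have := central_sibling (partner_s bs) (partner_s as_).
  rewrite !level_partner ?sv // la lb !partnerK ?sv // => /(_ _ erefl erefl) [].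
    have : residue (dir (partner b) - dir (partner a)) = 0 by rewrite sab eq subrr.
    case/residue_sub => k h; apply: (@residueE _ _ _ (- k)).
      by rewrite h; ring.
    by clear - n_gt1; lia.
  by move=> p5 p6 p7 p8; apply: cyc3_second_sibling p1 p2 p3 p4 p5 p6 p7.
have [bN|bN|bN] := ltgtP (rank b) (2 * N + 1); last 2 first.
- apply: cyc3_trans (central_second_half bs Cb bN).
  by apply: central_first_half; rewrite // a0.
- have -> : b = partner z.
    by apply: partner_z; rewrite // -?rbE; clear - lrb bN; lia.
  by apply: central_first_half; rewrite // a0.
have b0 := lt_trans a0 ab.
have cb := central_first_half bs Cb; rewrite b0 in cb; have {}cb := cb bN.
(* In this case [a] is the sibling of [z]: same direction, level 1. *)
have [r0|r0] := eqVneq ra 0.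
  have la : level a = 1 by clear - lra r0 a0; lia.
  have [s1 s2 s3 s4] := central_sibling zs as_ (etrans (esym raE) r0) lz la.
  have [rbN|rbN] := eqVneq rb N.
    have lb : level b = -1 by clear - lrb rbN bN; lia.
    have <- : partner a = b; last by rewrite cycR.
    apply: line_unique; rewrite ?partner_s ?level_partner ?sv ?la //.
    have [k h] := residue_sub sub; rewrite r0 rbN subr0 in h.
    have [->|->] := dir_partner (sv as_); rewrite h.
      by apply: (@residueE _ _ _ (- k)); [ring|clear - n_gt1; lia].
    by apply: (@residueE _ _ _ (- k - 1)); [ring|clear - n_gt1; lia].
  have [p1 p2] : cyc s z b (partner z) /\ cyc s z (partner z) (partner b).
    by apply: cross_z; rewrite // -rbE; clear - lrb lra bN ab a0 r0 rbN la; lia.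
  have [p3 p4] : cyc s a b (partner a) /\ cyc s a (partner a) (partner b).
    by apply: central_cross; rewrite // sub r0 subr0; clear - lrb lra bN ab a0 r0 rbN la; lia.
  exact: cyc3_sibling_cross s1 s2 s3 p1 p2 p3 p4.
have [p1 p2] : cyc s z a (partner z) /\ cyc s z (partner z) (partner a).
  by apply: cross_z; rewrite // -raE; clear - lra aN r0 rab ab bN; lia.
(* In this case [b] is antiparallel to [z] and its other end is the sibling of [z]. *)
have [rbN|rbN] := eqVneq rb N.
  have lb : level b = -1 by clear - lrb rbN bN; lia.
  have [s1 s2 s3 s4] := sibling_z bs Cb (etrans (esym rbE) rbN) lb.
  have sw : residue (dir (partner b) - dir z) = 0.
    by rewrite residue_partner // -rbE rbN ?subrr.
  have sw' : residue (dir a - dir (partner b)) = ra.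
    by rewrite (@residue_shift (dir z)) sw -raE ?subr0 //; clear - rab; lia.
  have [p3 p4] : cyc s (partner b) a (partner (partner b)) /\
      cyc s (partner b) (partner (partner b)) (partner a).
    apply: central_cross; rewrite ?partner_s ?central_partner // sw'.
    by clear - lra aN r0 rab ab bN; lia.
  rewrite partnerK ?sv // in p3 p4.
  exact: cyc3_cross_opposite s1 s2 s3 p1 p2 p3 p4.
have [p3 p4] : cyc s z b (partner z) /\ cyc s z (partner z) (partner b).
  by apply: cross_z; rewrite // -rbE; clear - lrb bN rbN le lra aN r0 rab; lia.
have [eq|lt] : ra = rb \/ ra < rb by clear - le; lia.
  have [la lb] : level a = -1 /\ level b = 1 by clear - eq ab lra lrb; lia.
  have [] := central_sibling as_ bs _ la lb; first by rewrite sub eq subrr.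
  move=> p5 p6 p7 p8; exact: cyc3_cross_sibling p1 p2 p3 p4 p5 p6 p7.
have [p5 p6] : cyc s a b (partner a) /\ cyc s a (partner a) (partner b).
  by apply: central_cross; rewrite // sub; clear - lt lrb bN rbN lra r0 rab; lia.
exact: cyc3_cross_cross p1 p2 p3 p4 p5 p6.
Qed.
End Order.

Hypothesis full_s : forall e, valid e -> e \in s.

Lemma mult_valid a : 0 < mult a -> exists k b, a = b + 2 * N * k /\ - N < 2 * b < N.
Proof.
have [k [b [hb [->|->]]]] := mprof_split n_gt1 a.
  rewrite mult_mod // => h; exists k, b; split=> //.
  by apply: mult_gt0_inv => //; clear - hb; lia.
rewrite mult_mod // multDn // oppr_gt0 => h.
have h2 : 0 <= mult b by apply: mult_ge0 => //; clear - hb; lia.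
by move: h; rewrite ltNge h2.
Qed.

(** The side [q] is found by turning the nonzero pair (mult d, mult (d - x)) by quarter turns until
    it falls into the quarter plane around the first axis. Which bounding ray belongs to that
    quarter plane depends on [t], because the index [k] solving the level equation must satisfy 0 <=
    k < m q. *)
Lemma central_exists d t : t = 1 \/ t = -1 ->
  exists2 e, valid e & residue (dir e - d) = 0 /\ level e = t.
Proof.
move=> ht.
have uv0 : mult d != 0 \/ mult (d - X) != 0.
  have : 0 < BoundaryEndpoints.mdet n X d (d + 1).
    by apply: mdet_gt0 => //; clear - n_gt1; lia.
  rewrite /BoundaryEndpoints.mdet; have [->|] := eqVneq (mult d) 0; last by left.
  by have [->|] := eqVneq (mult (d - X)) 0; [rewrite !mul0r subrr ltxx|right].
have [b1 u2] := mult_even d; have [b2 v2] := mult_even (d - X).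
pose m q := nth 0 [:: mult d; mult (d - X); - mult d; - mult (d - X)] q.
pose w q := nth 0 [:: mult (d - X); - mult d; - mult (d - X); mult d] q.
have [q q4 [k hk [hm kE]]] : exists2 q, (q < 4)%N &
    exists2 k, 0 <= k < m q & 0 < m q /\ 2 * k + 1 - m q - w q = t.
  rewrite /m /w; move: uv0; rewrite u2 v2 {m w u2 v2}; move: b1 b2 => a b uv0.
  have [q q4 h] : exists2 q, (q < 4)%N &
      let P := nth 0 [:: a; b; - a; - b] q in let Q := nth 0 [:: b; - a; - b; a] q in
      0 < P /\ (if t == 1 then - P <= Q < P else - P < Q <= P).
    have [c|[c|[c|c]]] : 0 < a /\ (if t == 1 then - a <= b < a else - a < b <= a) \/
      (0 < b /\ (if t == 1 then - b <= - a < b else - b < - a <= b) \/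
      (0 < - a /\ (if t == 1 then - - a <= - b < - a else - - a < - b <= - a) \/
      0 < - b /\ (if t == 1 then - - b <= a < - b else - - b < a <= - b))).
      by move: uv0; case: (t == 1); clear; lia.
    - by exists 0%N.
    - by exists 1%N.
    - by exists 2%N.
    by exists 3%N.
  exists q => //; case: q q4 h => [|[|[|[|//]]]] _ /= h.
  - by exists (a + b + (if t == 1 then 0 else -1));
      case: ht h => -> /=; clear; lia.
  - by exists (b - a + (if t == 1 then 0 else -1));
      case: ht h => -> /=; clear; lia.
  - by exists (- a - b + (if t == 1 then 0 else -1));
      case: ht h => -> /=; clear; lia.
  - by exists (- b + a + (if t == 1 then 0 else -1));
      case: ht h => -> /=; clear; lia.
pose a := d - side_dir n x q.
have [am aw] : mult a = m q /\ mult (a - turn n x q) = w q.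
  have := multdir x n_gt1 a q4; rewrite /a addrCA subrr addr0 /m /w.
  move: (mult (d - side_dir n x q)) (mult (d - side_dir n x q - turn n x q)) => m' w'.
  clear - q4; case: q q4 => [|[|[|[|//]]]] _ /= [-> ->]; by rewrite ?opprK.
have [|j [b [aE hb]]] := @mult_valid a; first by rewrite am.
have bm : mult b = m q by rewrite -am aE mult_mod.
exists (q, b, k); first by rewrite /BoundaryEndpoints.valid /= q4 hb bm.
split.
  apply: (@residueE _ _ _ (- j)); last by clear - n_gt1; lia.
  by rewrite /BoundaryEndpoints.dir /=; move: aE; rewrite /a; clear; lia.
rewrite /BoundaryEndpoints.level /= bm -kE; congr (_ - _ - _).
by rewrite -aw aE addrAC mult_mod.
Qed.

(** Each direction occurs at two levels, hence twice in succession and [j./2]: the core is the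
    boundary word of a regular 2n-gon of side 2. *)
Lemma central_rot d0 : exists i,
  [seq residue (dir e - d0) | e <- rot i (filter central s)] =
  [seq (j./2)%:Z | j <- iota 0 (4 * n)].
Proof.
have ex j : has (fun e => (residue (dir e - d0) == (j./2)%:Z) &&
    (level e == if odd j then 1 else -1)) s || (4 * n <= j)%N.
  have [//|lt] := leqP (4 * n) j; rewrite ?orbT ?orbF //.
  have [|e ve [r0 le]] := @central_exists (d0 + (j./2)%:Z) (if odd j then 1 else -1).
    by case: (odd j); [left|right].
  apply/hasP; exists e; first exact: full_s.
  rewrite le eqxx andbT; apply/eqP.
  have [k h] := residue_sub r0; apply: (@residueE _ _ _ k); first by rewrite h; ring.
  by clear - lt; lia.
pose e0 : endpoint := (0%N, 0, 0).
pose cel j := nth e0 s (find (fun e => (residue (dir e - d0) == (j./2)%:Z) &&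
    (level e == if odd j then 1 else -1)) s).
have celP j : (j < 4 * n)%N -> [/\ cel j \in s, residue (dir (cel j) - d0) = (j./2)%:Z,
    level (cel j) = (if odd j then 1 else -1) & central (cel j)].
  move=> lt; have := ex j; rewrite leqNgt lt orbF => h.
  have /andP[/eqP r1 /eqP l1] := nth_find e0 h.
  split=> //; first by rewrite mem_nth // -has_find.
  by rewrite /BoundaryEndpoints.central l1; case: (odd j).
have n0 : (0 < 4 * n)%N by clear - n_gt1; lia.
have [zs zr lz Cz] := celP _ n0; rewrite /= in zr lz.
have rk j : (j < 4 * n)%N -> rank (cel 0%N) (cel j) = j%:Z.
  move=> lt; have [_ rj lj _] := celP _ lt.
  rewrite /rank lj.
  have -> : residue (dir (cel j) - dir (cel 0%N)) = (j./2)%:Z.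
    by rewrite (@residue_shift d0) zr rj ?subr0.
  by case: (boolP (odd j)) => oj; rewrite ?eqxx /=; clear - oj; lia.
have [] := @cyc_sorted_rot _ s central (cel 0%N) [seq cel j | j <- iota 1 (4 * n).-1].
- exact: us.
- have -> : cel 0%N :: [seq cel j | j <- iota 1 (4 * n).-1] = [seq cel j | j <- iota 0 (4 * n)].
    by rewrite -[in RHS](prednK n0).
  rewrite map_inj_in_uniq ?iota_uniq // => i j; rewrite !mem_iota /= !add0n => hi hj eij.
  by have := rk _ hi; rewrite eij rk // => -[].
- have -> : cel 0%N :: [seq cel j | j <- iota 1 (4 * n).-1] = [seq cel j | j <- iota 0 (4 * n)].
    by rewrite -[in RHS](prednK n0).
  move=> e; apply/mapP/andP => [[j]|[es Ce]].
    by rewrite mem_iota /= add0n => /celP[? ? ? ?] ->.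
  have rb := residue_bounds (dir e - d0).
  have [j jE] : exists j : nat, j%:Z = 2 * residue (dir e - d0) + (level e == 1)%:Z.
    by exists (absz (2 * residue (dir e - d0) + (level e == 1)%:Z)); rewrite gez0_abs //; clear - rb; lia.
  have jn : (j < 4 * n)%N by case: (level e == 1) jE; clear - rb; lia.
  exists j; first by rewrite mem_iota.
  have [cs cr cl cc] := celP _ jn; apply: line_unique => //.
    have [k h] := residue_sub cr; have [k' h'] := residue_sub (erefl (residue (dir e - d0))).
    apply: (@residueE _ _ _ (k' - k)); last by clear - n_gt1; lia.
    have jr : (j./2)%:Z = residue (dir e - d0) by case: (level e == 1) jE; clear; lia.
    by rewrite h h' jr; ring.
  by rewrite cl; case: (central_level Ce) jE => ->; rewrite ?eqxx /=; clear; case: ifP; lia.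
- rewrite pairwise_map; apply: (sub_in_pairwise (P := fun j => (0 < j < 4 * n)%N) (r := ltn)).
  + move=> i j /andP[i0 i1] /andP[j0 j1] ij.
    have [? _ _ ?] := celP _ i1; have [? _ _ ?] := celP _ j1.
    by apply: central_order; rewrite // !rk // ltz_nat.
  + by apply/allP => j; rewrite mem_iota; clear - n0; lia.
  + by rewrite -sorted_pairwise ?iota_ltn_sorted //; apply: ltn_trans.
move=> i zE; exists i; rewrite -zE.
have -> : cel 0%N :: [seq cel j | j <- iota 1 (4 * n).-1] = [seq cel j | j <- iota 0 (4 * n)].
  by rewrite -[in RHS](prednK n0).
rewrite -map_comp; apply/eq_in_map => j; rewrite mem_iota /= add0n => /celP[_ -> _ _].
by [].
Qed.

Definition first_end : endpoint := (0%N, 0, 0).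
Definition last_end : endpoint := (3%N, 0, mult 0 - 1).

Lemma mult0_gt1 : 1 < mult 0.
Proof. by apply: mult_gt0; rewrite ?mulr0 //; clear - n_gt1; lia. Qed.

Lemma valid_first : valid first_end.
Proof. by rewrite /BoundaryEndpoints.valid /=; have := mult0_gt1; clear - n_gt1; lia. Qed.

Lemma valid_last : valid last_end.
Proof. by rewrite /BoundaryEndpoints.valid /=; have := mult0_gt1; clear - n_gt1; lia. Qed.

Lemma mult_sum_gt2 : 2 < mult 0 + mult X.
Proof.
have m0 := mult0_gt1; have [h|h] := leP (2 * X) N.
  have : 0 <= mult X by apply: mult_ge0 => //; clear - h x_range; lia.
  have : 2 < mult 0.
    rewrite /BoundaryEndpoints.mult mprof_small //; last by clear - n_gt1; lia.
    by rewrite /parab expr0n /= mulr0 subr0; clear - n_gt1; nia.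
  by clear; lia.
have -> : mult X = - mult (X - N) by rewrite multBn // opprK.
rewrite /BoundaryEndpoints.mult.
rewrite !mprof_small //; [|clear - h x_range n_gt1; lia|clear - h x_range n_gt1; lia].
rewrite /parab expr0n /= mulr0 subr0.
have : 1 <= (X - N) ^+ 2.
  have -> : (X - N) ^+ 2 = (N - X) * (N - X) by ring.
  by rewrite -[leLHS]mul1r; apply: ler_pM => //; have := x_range; clear; lia.
have := sqr_ge0 N; move: (N ^+ 2) ((X - N) ^+ 2) => A B; clear; nia.
Qed.

(** The chords of the two letters adjacent to the corner cross. The corner swap removes exactly this
    crossing. *)
Lemma corner_order : cyc s first_end (partner last_end) (partner first_end).
Proof.
have vf := valid_first; have vl := valid_last.
have fs := full_s vf; have ls := full_s vl.
have m0 := mult0_gt1; have m1 := mult_sum_gt2.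
have mR : 0 < (mult 0)%:~R :> rat by rewrite ltr0z; clear - m0; lia.
have sR : 1 < (mult 0)%:~R + (mult X)%:~R :> rat by rewrite -rmorphD ltr1z (lt_trans _ m1).
have d1 : dir first_end = 0 by [].
have d2 : dir last_end = N + X by rewrite /BoundaryEndpoints.dir /= addr0.
have mX : mult (- X) = mult X by rewrite multN.
(* Both chords lie on lines that meet the diagonal of the square in (c, c). *)
pose c : rat := 1 / (2 * ((mult 0)%:~R + (mult X)%:~R)).
have c01 : 0 < c < 1.
  have s0 : 0 < 2 * ((mult 0)%:~R + (mult X)%:~R) :> rat by lra.
  rewrite /c divr_gt0 // ltr_pdivrMr // mul1r; lra.
have hc : ((mult 0)%:~R + (mult X)%:~R) * c = 1 / 2 :> rat.
  rewrite /c; move: sR; set S := _ + _ => sR; have S0 : S != 0 by rewrite gt_eqF // (lt_trans _ sR).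
  by move: S S0 {c sR c01} => S S0; field.
have cr := chord_cross (d := 0) vl c01 c01.
have {cr} [_ h2] : hgt 0 last_end < height 0 c c /\ height 0 c c < hgt 0 (partner last_end).
  apply/andP; apply: cr.
    rewrite d2 /StraightChords.hgt /BoundaryEndpoints.height /BoundaryEndpoints.ptx /BoundaryEndpoints.pty /= mulr0 add0r.
    have -> : N + X - X = 0 + N by ring.
    rewrite (addrC N) !multDn // !rmorphN /= -mulrDl -opprD mulNr addrC hc.
    rewrite /BoundaryEndpoints.frac /=; move: mR; move: (mult 0) => m mR.
    by field; rewrite gt_eqF.
  rewrite d2 -(mdet_mod n_gt1 X (N + X) 0 1); apply: mdet_gt0 => //.
  by clear - x_range; lia.
have h1 : height 0 c c = hgt (dir first_end) first_end.
  rewrite d1 /StraightChords.hgt /BoundaryEndpoints.height /BoundaryEndpoints.ptx /BoundaryEndpoints.pty /= mulr0 addr0 sub0r mX -mulrDl hc.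
  rewrite /BoundaryEndpoints.frac /=; move: mR; move: (mult 0) => m mR.
  by field; rewrite gt_eqF.
have pl := partner_s ls; have pf := partner_s fs.
have dpl := dir_partner vl; have dpf := dir_partner vf.
apply/negPn/negP => nc.
have := cyc_flip fs pl pf; move/(_ _ _ _ nc) => h.
have {}h : cyc s first_end (partner first_end) (partner last_end).
  apply: h.
  - apply/eqP => E; move: dpl; rewrite -E d1 d2; clear - x_range; lia.
  - by apply/eqP => /(congr1 partner); rewrite !partnerK.
  - by apply: contraNneq (partner_side vf) => ->.
have := cyc_hgt' fs pl h; rewrite -h1 d1 leNgt h2.
by [].
Qed.

End Boundary.
End Arrangement.
End CentralChords.

(** * The letters of an edge *)

Module EdgeWord.
Import CyclicPeeling ProfileFunction BoundaryEndpoints OrientedTriples StraightChords ChordCrossings CentralChords.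
Import Order.TTheory GRing.Theory Num.Theory.
Local Open Scope ring_scope.

Section Word.
Variable n : nat.
Hypothesis n_gt1 : (1 < n)%N.
Local Notation N := n%:Z.
Local Notation mult := (mult n).

Definition position (p : nat * nat) : rat := (2 * p.2 + 1)%:R / (2 * mult p.1%:Z)%:~R.

Definition half_count (b : nat) : nat := (absz (mult b%:Z))./2.

Definition half_letters : seq (nat * nat) :=
  sort (fun p q => position p <= position q)
    [seq (b, k) | b <- iota 0 (uphalf n), k <- iota 0 (half_count b)].

(** Opposite letters have equal multiplicities and so equal positions; listed in succession they
    bring the path back to its axis after each pair. *)
Definition mirror_pair (p : nat * nat) : seq (int * int) :=
  if p.1 == 0%N then [:: (0, p.2%:Z)] else [:: (p.1%:Z, p.2%:Z); (- p.1%:Z, p.2%:Z)].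

Definition half_word : seq (int * int) := flatten (map mirror_pair half_letters).

(* The letters of an edge: the k-th occurrence of a lies at (2k+1)/(2 mult a).
   The second half mirrors the first one, so the letters form a palindrome. *)
Definition word : seq (int * int) :=
  half_word ++ rev [seq (p.1, mult p.1 - 1 - p.2) | p <- half_word].

Lemma uphalfP b : (b < uphalf n)%N = (2 * b < n)%N.
Proof. by rewrite uphalf_half; lia. Qed.

Lemma half_countP b : (2 * b < n)%N -> mult b%:Z = 2 * (half_count b)%:Z.
Proof.
move=> hb; have m0 : 0 < mult b%:Z.
  have : 1 < mult b%:Z by apply: mult_gt0 => //; lia.
  by lia.
have [c hc] := mult_even n b%:Z.
by rewrite /half_count hc; lia.
Qed.

Lemma mem_half_letters b k :
  ((b, k) \in half_letters) = (2 * b < n)%N && (k < half_count b)%N.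
Proof.
rewrite mem_sort; apply/allpairsPdep/andP => [[b' [k' [hb hk [-> ->]]]]|[hb hk]].
  by move: hb hk; rewrite !mem_iota /= !add0n uphalfP.
by exists b, k; rewrite !mem_iota /= !add0n uphalfP.
Qed.

Lemma half_letters_uniq : uniq half_letters.
Proof.
rewrite sort_uniq; apply: allpairs_uniq_dep; first exact: iota_uniq.
  by move=> *; apply: iota_uniq.
by move=> [a b] [c d] _ _ /= [-> ->].
Qed.

Lemma half_letters_sorted : pairwise (fun p q => position p <= position q) half_letters.
Proof.
rewrite -sorted_pairwise; last by move=> ? ? ?; apply: le_trans.
by apply: sort_sorted => p q; apply: le_total.
Qed.

Lemma mem_half_word a k : ((a, k) \in half_word) =
  (- N < 2 * a < N) && (0 <= 2 * k < mult a).
Proof.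
apply/flattenP/andP => [[_ /mapP[[b j] h ->]]|[ha hk]].
  move: h; rewrite mem_half_letters => /andP[hb hj].
  have hm := half_countP hb.
  rewrite /mirror_pair /=; case: eqP => [b0|_]; rewrite !inE.
    rewrite b0 in hm hb hj; have hm0 : mult 0 = 2 * (half_count 0)%:Z by [].
    by move=> /eqP[-> ->]; split; lia.
  by case/orP => /eqP[-> ->]; rewrite ?multN //; split; lia.
have ab : (2 * absz a < n)%N by lia.
have mE : mult (absz a)%:Z = mult a.
  by have [a0|a0] := leP 0 a; [rewrite gez0_abs|rewrite ltz0_abs // multN].
exists (mirror_pair (absz a, absz k)).
  apply: map_f; rewrite mem_half_letters ab /=.
  by have := half_countP ab; rewrite mE; lia.
have kE : (absz k)%:Z = k by lia.
rewrite /mirror_pair /= kE; case: eqP => [a0|a0]; rewrite !inE.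
  by rewrite xpair_eqE eqxx andbT; lia.
by rewrite !xpair_eqE !eqxx !andbT; lia.
Qed.

Lemma half_word_uniq : uniq half_word.
Proof.
rewrite /half_word; have := half_letters_uniq; have := mem_half_letters.
move: half_letters => l hl; have {hl} : all (fun _ => true) l by apply/allP.
elim: l => //= -[b k] l IH _ /andP[nl ul].
rewrite cat_uniq IH //; last by apply/allP.
have -> : uniq (mirror_pair (b, k)).
  rewrite /mirror_pair /=; case: eqP => //= b0; rewrite andbT inE xpair_eqE eqxx andbT; lia.
rewrite andbT /=; apply/hasPn => -[a j] /flattenP[_ /mapP[[c i] ci ->]] h.
apply: contra nl; move: h.
rewrite /mirror_pair /=; case: eqP => hc; case: eqP => hb; rewrite !inE !xpair_eqE.
- by move=> /andP[/eqP-> /eqP->] /andP[_ /eqP[<-]]; rewrite hb -hc.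
- by move=> /andP[/eqP-> /eqP->]; lia.
- by move=> h1 /andP[/eqP a0 _]; lia.
- move=> h1 h2; have -> // : (b, k) = (c, i) by congr pair; lia.
Qed.

Lemma word_letters_rev : rev (map fst word) = map fst word.
Proof.
rewrite /word map_cat map_rev rev_cat revK -map_comp.
by congr (_ ++ _); rewrite -map_rev map_rev.
Qed.

Lemma mem_word a k : ((a, k) \in word) = (- N < 2 * a < N) && (0 <= k < mult a).
Proof.
rewrite mem_cat mem_rev mem_half_word.
have [b mb] := mult_even n a.
have -> : ((a, k) \in [seq (p.1, mult p.1 - 1 - p.2) | p <- half_word]) =
    ((a, mult a - 1 - k) \in half_word).
  apply/mapP/idP => [[[c j] h [-> ->]] /=|h].
    by have -> : mult c - 1 - (mult c - 1 - j) = j by ring.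
  by exists (a, mult a - 1 - k) => //=; congr pair; ring.
by rewrite mem_half_word; case: (- N < 2 * a < N) => //=; rewrite mb; lia.
Qed.

Lemma word_uniq : uniq word.
Proof.
rewrite /word cat_uniq half_word_uniq rev_uniq map_inj_in_uniq ?half_word_uniq ?andbT /=.
  apply/hasPn => -[a k]; rewrite mem_rev => /mapP[[c j] h [-> ->]].
  move: h; rewrite !mem_half_word => /andP[-> h] /=.
  by have [b mb] := mult_even n c; rewrite mb in h *; lia.
by move=> [a k] [c j] _ _ /= [-> h]; congr pair; lia.
Qed.

Definition fraction (p : int * int) : rat := (2 * p.2 + 1)%:~R / (2 * mult p.1)%:~R.

Lemma fraction_mirror p q : p \in mirror_pair q -> fraction p = position q.
Proof.
case: q => b k; rewrite /mirror_pair /fraction /position /=; case: eqP => [b0|_]; rewrite !inE.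
  by move=> /eqP->; rewrite b0 /= -[(2 * k + 1)%:R]/((2 * k + 1)%N%:Z%:~R) PoszD PoszM.
case/orP => /eqP-> /=; rewrite ?multN //;
by rewrite -[(2 * k + 1)%:R]/((2 * k + 1)%N%:Z%:~R) PoszD PoszM.
Qed.

Lemma half_word_sorted : pairwise (fun p q => fraction p <= fraction q) half_word.
Proof.
rewrite /half_word; have := half_letters_sorted.
elim: half_letters => //= q l IH /andP[ql /IH {}IH].
rewrite pairwise_cat IH andbT; apply/andP; split.
  apply/allrelP => x y xq /flattenP[_ /mapP[q' q'l ->]] yq'.
  by rewrite (fraction_mirror xq) (fraction_mirror yq') (allP ql).
have : {in mirror_pair q &, forall x y, fraction x <= fraction y}.
  by move=> x y xq yq; rewrite (fraction_mirror xq) (fraction_mirror yq).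
rewrite /mirror_pair; case: ifP => //= _ h; rewrite !andbT.
by apply: h; rewrite !inE eqxx ?orbT.
Qed.

Lemma word_sorted : pairwise (fun p q => fraction p <= fraction q) word.
Proof.
have fr0 a k : (a, k) \in half_word -> fraction (a, mult a - 1 - k) = 1 - fraction (a, k).
  rewrite mem_half_word /fraction /= => /andP[ha hk].
  have m0 : (2 * mult a)%:~R != 0 :> rat by rewrite intr_eq0; lia.
  apply: (mulIf m0); rewrite divfK // mulrBl divfK // mul1r.
  by rewrite -rmorphB /=; congr (_%:~R); ring.
have lt2 p : p \in half_word -> fraction p <= 1 / 2.
  case: p => a k; rewrite mem_half_word /fraction /= => /andP[ha hk].
  have [b mb] := mult_even n a; rewrite mb in hk *.
  have m0 : 0 < (2 * (2 * b))%:~R :> rat by rewrite ltr0z; lia.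
  rewrite ler_pdivrMr //.
  have le1 : (2 * k + 1)%:~R <= (2 * b)%:~R :> rat by rewrite ler_int; lia.
  have -> : (2 * (2 * b))%:~R = 2 * (2 * b)%:~R :> rat by rewrite [in LHS]intrM.
  by lra.
rewrite /word pairwise_cat half_word_sorted /=; apply/andP; split.
  apply/allrelP => x y xh; rewrite mem_rev => /mapP[[c j] h ->].
  by rewrite /= fr0 // (le_trans (lt2 _ xh)) //; have := lt2 _ h; lra.
have trf : transitive (fun p q => fraction p <= fraction q) by move=> ? ? ?; apply: le_trans.
have trf' : transitive (fun p q => fraction q <= fraction p).
  by move=> ? ? ? h1 h2; apply: le_trans h2 h1.
rewrite -sorted_pairwise // rev_sorted sorted_pairwise // pairwise_map.
have := half_word_sorted; apply: sub_in_pairwise (allss _) => -[a k] [c j] /= h1 h2 le.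
by rewrite !fr0 // lerD2l lerN2.
Qed.

Lemma mult_decr a b : (a < b)%N -> (2 * b < n)%N -> mult b%:Z < mult a%:Z.
Proof.
move=> ab bn; rewrite /mult !mprof_small //; try lia.
rewrite /parab ltr_pM2l; last by move: (sqr_ge0 n%:Z); move: (n%:Z ^+ 2) => c; lia.
by rewrite ltrD2l ltrN2 ltr_pM2l // ltr_pXn2r ?nnegrE //; lia.
Qed.

(** Multiplicities decrease with the size of the letter, so each smaller letter occurs before any
    occurrence of [b]. The diamond estimate [half_prefix] rests on this. *)
Lemma position_lt a b k : (a < b)%N -> (2 * b < n)%N -> position (a, 0%N) < position (b, k).
Proof.
move=> ab bn; have := mult_decr ab bn.
have : 1 < mult b%:Z by apply: mult_gt0 => //; lia.
rewrite /position /=; move: (mult b%:Z) (mult a%:Z) => m m' m1 mm.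
rewrite ltr_pdivrMr ?ltr0z; last lia.
rewrite mulrAC ltr_pdivlMr ?ltr0z; last lia.
rewrite !pmulrn -!intrM ltr_int; nia.
Qed.

Lemma position_lt0 k : (0 < k)%N -> position (0, 0)%N < position (0%N, k).
Proof.
move=> k0; rewrite /position /= ltr_pM2r ?ltr_nat; first lia.
have : 1 < mult 0 by apply: mult_gt0 => //; lia.
by rewrite invr_gt0 ltr0z -[(0%N)%:Z]/(0 : int); move: (mult 0) => m; lia.
Qed.

Lemma half_letters_cons : exists l, half_letters = (0, 0)%N :: l.
Proof.
have m0 : (0, 0)%N \in half_letters.
  rewrite mem_half_letters.
  have h0 : mult 0 = 2 * (half_count 0)%:Z by apply: (@half_countP 0%N); lia.
  have : 1 < mult 0 by apply: mult_gt0 => //; lia.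
  by rewrite h0; lia.
have := half_letters_sorted.
case E: half_letters m0 => [//|[b k] l]; rewrite inE => m0 /andP[/allP srt _]; exists l; congr cons.
case/orP: m0 => [/eqP//|m0]; have {}srt := srt _ m0.
have : (b, k) \in half_letters by rewrite E mem_head.
rewrite mem_half_letters => /andP[bn _].
have [b0|b0] := posnP b; last by have := position_lt k b0 bn; rewrite ltNge srt.
subst b; have [->//|k0] := posnP k.
by have := position_lt0 k0; rewrite ltNge srt.
Qed.

(** The straight letter 0 at both ends makes the rhombus split off at a corner a copy of the
    prototile. *)
Lemma word_ends : exists w, word = (0, 0) :: rcons w (0, mult 0 - 1).
Proof.
have [l hl] := half_letters_cons.
rewrite /word /half_word hl /= rev_cons.
set w := flatten _; exists (w ++ rev [seq (p.1, mult p.1 - 1 - p.2) | p <- w]).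
by rewrite subr0 -rcons_cat.
Qed.
End Word.
End EdgeWord.

(** * Rings of rhombuses in a regular 2n-gon *)

Module RingFilling.
Import CyclicPeeling ProfileFunction BoundaryEndpoints OrientedTriples StraightChords ChordCrossings CentralChords EdgeWord.
Import Order.TTheory GRing.Theory Num.Theory.
Local Open Scope ring_scope.

Arguments quad : simpl never.

Section PathMap.
Variables (V : zmodType) (A : comNzRingType) (E : eqType) (u : E -> V).

Lemma psum_map (Phi : V -> V -> A) p s : psum u Phi p s = psum id Phi p (map u s).
Proof. by elim: s p => //= e s IH p; rewrite IH. Qed.

(** The closed path leaves [p] by [e] and returns to it by [f]. Cutting off the parallelogram at [p]
    exchanges these two steps. *)
Lemma psum_corner (Phi : V -> V -> A) p e m f f' : antisym Phi -> u f' = - u f ->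
  \sum_(x <- e :: rcons m f) u x = 0 ->
  psum u Phi p (e :: rcons m f) =
  quad u Phi (p, e, f') + psum u Phi (p + u e) (rcons (rcons m e) f).
Proof.
move=> aP uf; rewrite big_cons -cats1 big_cat big_seq1 => cl.
have em : p + u e + \sum_(i <- m) u i = p + u f'.
  by rewrite uf -addrA; congr (p + _); apply: (addIr (u f)); rewrite addNr -addrA cl.
rewrite /quad /= -!cats1 !psum_cat /= !big_cat /= !big_seq1 !addr0 addrA em -addrA.
have -> : p + u e + (\sum_(i <- m) u i + u e) = p + u e + u f'.
  by rewrite addrA em addrAC.
have -> : u f = - u f' by rewrite uf opprK.
rewrite (addrAC p (u f') (u e)) !addrK.
rewrite (aP (p + u e) (p + u e + u f')) (aP (p + u e + u f') (p + u f')); ring.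
Qed.
End PathMap.

Section Ring.
Variables (V : zmodType) (A : comNzRingType) (n : nat) (U : int -> V).
Hypothesis Un : forall d, U (d + n%:Z) = - U d.
Implicit Type Phi : V -> V -> A.

Lemma antiperiodic_double d : U (d + (2 * n)%:Z) = U d.
Proof. by rewrite mul2n -addnn PoszD addrA !Un opprK. Qed.

Definition ring_point p r (c : int) : V := p + \sum_(i < r) U (c + 1 + i%:Z).

Lemma ring_pointS p r c : ring_point p r.+1 c = ring_point p r c + U (c + 1 + r%:Z).
Proof. by rewrite /ring_point big_ord_recr /= addrA. Qed.

Lemma ring_pointSl p r c : ring_point p r.+1 c = ring_point p r (c + 1) + U (c + 1).
Proof.
rewrite /ring_point big_ord_recl /= addr0 -addrA [U (c + 1) + _]addrC; congr (_ + (_ + _)).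
by apply: eq_bigr => i _; congr U; rewrite /bump /= add1n intS; ring.
Qed.

Lemma ring_point_periodic p r c : ring_point p r (c + (2 * n)%:Z) = ring_point p r c.
Proof.
congr (_ + _); apply: eq_bigr => i _; rewrite -[RHS]antiperiodic_double; congr U; ring.
Qed.

(** When [U d] is the unit vector of angle d pi/n, ring [r] consists of 2n rhombuses of angle (r+1)
    pi/n. Ring 0 is the star around [p], and the n-1 rings dissect the regular 2n-gon of side 2. *)
Definition ring_rhombs p : seq (V * int * int) :=
  [seq (ring_point p r (c%:Z + 1), c%:Z + 1, c%:Z + 2 + r%:Z) |
     c <- iota 0 (2 * n), r <- iota 0 n.-1].

Lemma sum_shift (F : int -> A) m : (forall c, F (c + m%:Z) = F c) ->
  \sum_(c <- iota 0 m) F (c%:Z + 1) = \sum_(c <- iota 0 m) F c%:Z.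
Proof.
have ordE (G : nat -> A) : \sum_(c <- iota 0 m) G c = \sum_(c < m) G c.
  by rewrite -(big_mkord xpredT) /index_iota subn0.
rewrite !ordE.
case: m {ordE} => [|m] per; first by rewrite !big_ord0.
rewrite big_ord_recr [RHS]big_ord_recl /= addrC; congr (_ + _).
  by rewrite -[RHS]per; congr F; rewrite intS; ring.
by apply: eq_bigr => i _; congr F; rewrite /bump /= add1n intS; ring.
Qed.

(** Each quadrilateral is a combination of edge terms of consecutive rings. Summed over a period
    they telescope from the degenerate ring at [p] to the outermost zigzag, whose steps pair up into
    straight sides. *)
Lemma ring_fill p Phi : antisym Phi -> (0 < n)%N ->
  \sum_(t <- ring_rhombs p) quad U Phi t =
  psum U Phi (ring_point p n 0) [seq n%:Z + 1 + (j./2)%:Z | j <- iota 0 (4 * n)].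
Proof.
move=> aP n0.
pose a r c := Phi (ring_point p r (c + 1)) (ring_point p r.+1 c).
pose b r c := Phi (ring_point p r c) (ring_point p r.+1 c).
have bper r c : b r (c + (2 * n)%:Z) = b r c by rewrite /b !ring_point_periodic.
have quadE r c : quad U Phi (ring_point p r (c + 1), c + 1, c + 2 + r%:Z) =
    a r c + b r.+1 c - a r.+1 c - b r (c + 1).
  have e1 : c + 2 + r%:Z = c + 1 + r.+1%:Z by rewrite intS; ring.
  have e2 : c + 2 + r%:Z = c + 1 + 1 + r%:Z by ring.
  rewrite /quad -ring_pointSl {1 2}e1 -ring_pointS e2 -!ring_pointS.
  rewrite /a /b (aP (ring_point p r.+1 (c + 1)) (ring_point p r.+2 c)) (aP (ring_point p r (c + 1)) (ring_point p r.+1 (c + 1))).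
  by ring.
have lhs m : \sum_(c <- iota 0 (2 * n)) \sum_(r <- iota 0 m)
    quad U Phi (ring_point p r (c%:Z + 1), c%:Z + 1, c%:Z + 2 + r%:Z) =
    \sum_(c <- iota 0 (2 * n)) (b m c%:Z - a m c%:Z).
  elim: m => [|m IH].
    rewrite big1 => [|c _]; last by rewrite big_nil.
    rewrite big1 // => c _; rewrite /a /b /ring_point !big_ord0 subrr //.
  under eq_bigr => c _ do rewrite -addn1 iotaD big_cat /= big_seq1 add0n quadE.
  rewrite big_split /= IH -big_split /=.
  transitivity (\sum_(c <- iota 0 (2 * n)) (b m c%:Z - b m (c%:Z + 1) + (b m.+1 c%:Z - a m.+1 c%:Z))).
    by apply: eq_bigr => c _; ring.
  rewrite big_split /= sumrB sum_shift ?subrr ?add0r // => c; exact: bper.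
rewrite /ring_rhombs big_allpairs_dep lhs sumrB -(sum_shift (bper n.-1)) -sumrB.
have -> : (4 * n = 2 * (2 * n))%N by lia.
suff: forall m, psum U Phi (ring_point p n 0) [seq n%:Z + 1 + (j./2)%:Z | j <- iota 0 (2 * m)] =
    \sum_(c <- iota 0 m) (b n.-1 (c%:Z + 1) - a n.-1 c%:Z) /\
    ring_point p n 0 + \sum_(c <- [seq n%:Z + 1 + (j./2)%:Z | j <- iota 0 (2 * m)]) U c =
    ring_point p n m%:Z.
  by move=> /(_ (2 * n)%N)[].
elim=> [|m [IH1 IH2]]; first by rewrite /= !big_nil addr0.
have -> : (2 * m.+1 = 2 * m + 2)%N by lia.
rewrite -[m.+1]addn1 (iotaD _ (2 * m)) (iotaD _ m 1) map_cat psum_cat !big_cat /= !big_cons !big_nil !addr0.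
rewrite IH1 addrA IH2 !add0n.
have -> : ((2 * m)./2 = m)%N by lia.
have -> : (uphalf (2 * m) = m)%N by rewrite uphalf_half; lia.
have UE : U (n%:Z + 1 + m%:Z) = - U (m%:Z + 1) by rewrite -Un; congr U; ring.
have e1 : ring_point p n m%:Z + U (n%:Z + 1 + m%:Z) = ring_point p n.-1 (m%:Z + 1).
  by rewrite -[in LHS](prednK n0) ring_pointSl prednK // UE addrK.
have e2 : ring_point p n.-1 (m%:Z + 1) + U (n%:Z + 1 + m%:Z) = ring_point p n (m%:Z + 1).
  rewrite -[in RHS](prednK n0) ring_pointS; congr (_ + U _).
  by rewrite -[in LHS](prednK n0) intS; ring.
rewrite [X in _ /\ X = _]addrA !e1 e2 PoszD; split; last by rewrite addrA IH2 e1 e2.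
congr (_ + _); rewrite /a /b prednK // (aP (ring_point p n.-1 (m%:Z + 1)) (ring_point p n m%:Z)).
by ring.
Qed.

Lemma ring_rhombs_residue p t : t \in ring_rhombs p -> 0 < t.2 - t.1.2 < n%:Z.
Proof. by case/allpairsP => -[c r] /= [_]; rewrite mem_iota => h -> /=; lia. Qed.

Lemma ring_rhombs_star p c : (1 < n)%N -> (c < 2 * n)%N ->
  (p, c%:Z + 1, c%:Z + 2) \in ring_rhombs p.
Proof.
move=> n1 c2; apply/allpairsP; exists (c, 0%N) => /=.
by rewrite !mem_iota addr0 /ring_point big_ord0 addr0; split=> //; lia.
Qed.
End Ring.
End RingFilling.

(** * Exchanging the two letters at a corner *)

Module CornerSwap.
Import CyclicPeeling ProfileFunction BoundaryEndpoints OrientedTriples StraightChords ChordCrossings CentralChords EdgeWord RingFilling.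
Import Order.TTheory GRing.Theory Num.Theory.
Local Open Scope ring_scope.

Lemma pairwise_index (T : eqType) (r : rel T) s : pairwise r s ->
  {in s &, forall e f, (index e s < index f s)%N -> r e f}.
Proof.
move=> pw e f es fs lt; have/(pairwiseP e) := pw => /(_ (index e s) (index f s)).
by rewrite !inE !index_mem !nth_index //; apply.
Qed.

Section Swap.
Variables (E : eqType) (V : zmodType) (u : E -> V) (sg : E -> E) (good : rel E) (C : pred E).
Variables (e f : E) (m : seq E).
Let s := e :: rcons m f.
Let s' := rcons (rcons m e) f.
Hypothesis hs : chordal u sg C s.
Hypothesis corner : cyc s e (sg f) (sg e).
Hypotheses (nCe : ~~ C e) (nCf : ~~ C f).

Let perm_s : perm_eq s' s.
Proof. by rewrite /s' /s -!cats1 -cat_cons perm_cat2r cats1 perm_rcons. Qed.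

Let mem_s x : (x \in s') = (x \in s). Proof. exact: perm_mem. Qed.

Let cyc_s a b c : a \in s -> b \in s -> c \in s ->
  (e \notin [:: a; b; c]) || (f \notin [:: a; b; c]) -> cyc s' a b c = cyc s a b c.
Proof. by case: hs => us _ _; apply: cyc_swap. Qed.

Lemma swap_chordal : chordal u sg C s'.
Proof.
case: hs => us cl hs'; split; first by rewrite (perm_uniq perm_s).
  by rewrite (perm_big _ perm_s).
by move=> x; rewrite mem_s => /hs'; rewrite mem_s.
Qed.

(** The letters [e] and [f] belong to different chords outside [C], so no triple made of the two
    ends of a chord and a letter of [C] contains both, and [cyc_swap] applies. *)
Lemma swap_separated : separated sg C s -> separated sg C s'.
Proof.
case: hs => us cl hs' sep g; rewrite mem_s => gs nC c c'; rewrite !mem_s => cs cs' Cc Cc'.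
have ne_sf : sg f != e by have [h _ _] := cyc_neq corner; rewrite eq_sym.
have es : e \in s by rewrite mem_head.
have fs : f \in s by rewrite inE mem_rcons mem_head orbT.
have nchord g' : g' \in s -> (e \notin [:: g'; sg g']) || (f \notin [:: g'; sg g']).
  move=> gs'; have [_ sgK _ _ _] := hs' _ gs'; rewrite -negb_and; apply/negP.
  rewrite !inE => /andP[]; case/orP=> /eqP eE; case/orP => /eqP fE.
  - by move: us; rewrite /s fE eE /= mem_rcons mem_head.
  - by move: ne_sf; rewrite fE sgK eE eqxx.
  - by move: ne_sf; rewrite fE eE eqxx.
  - by move: us; rewrite /s fE eE /= mem_rcons mem_head.
have ok d a b : d \in s -> C d -> perm_eq [:: a; b; d] [:: g; sg g; d] ->
    (e \notin [:: a; b; d]) || (f \notin [:: a; b; d]).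
  move=> ds Cd /perm_mem h; rewrite !h.
  have nde : d != e by apply: contraNneq nCe => <-.
  have ndf : d != f by apply: contraNneq nCf => <-.
  have := nchord g gs; rewrite !inE !negb_or => /orP[] /andP[-> ->].
    by rewrite (eq_sym e d) nde.
  by rewrite (eq_sym f d) ndf orbT.
have [sgs _ _ _ _] := hs' _ gs.
have mk d : d \in s -> C d ->
   (cyc s' g d (sg g) = cyc s g d (sg g)) * (cyc s' g (sg g) d = cyc s g (sg g) d).
  move=> ds Cd; split.
    rewrite cycR cyc_s //; first by rewrite -cycR.
    rewrite !inE; have := ok d g (sg g) ds Cd (perm_refl _); rewrite !inE.
    by case: (e == g) => //=; case: (e == d) => //=; case: (e == sg g) => //=;
       case: (f == g) => //=; case: (f == d) => //=; case: (f == sg g).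
  by rewrite cyc_s //; apply: ok => //; apply: perm_refl.
have [scs _ _ _ Csc] := hs' _ cs; have [scs' _ _ _ Csc'] := hs' _ cs'.
by rewrite !mk // ?Csc ?Csc' //; apply: sep.
Qed.

(** Only the relation between the chords of [e] and [f] changes. They crossed by [corner] and no
    longer cross after the swap, so the condition on them becomes vacuous. *)
Lemma swap_positive : positive sg good s -> positive sg good s'.
Proof.
case: hs => us cl hs' ps g h; rewrite !mem_s => gs hs1.
have es : e \in s by rewrite mem_head.
have fs : f \in s by rewrite inE mem_rcons mem_head orbT.
have us' : uniq s' by rewrite (perm_uniq perm_s).
have [sgs sgK sgn _ _] := hs' _ gs; have [shs shK shn _ _] := hs' _ hs1.
have [ses seK _ _ _] := hs' _ es; have [sfs sfK _ _ _] := hs' _ fs.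
have [n1 n2 n3] := cyc_neq corner.
have nef : e != f by move: us; rewrite /s /= mem_rcons inE negb_or => /andP[/andP[]].
have nsef : sg e != f by apply: contraNneq n1 => <-; rewrite seK.
have [sfm sem] : sg f \in m /\ sg e \in m.
  have nff : sg f != f by have [] := hs' _ fs.
  move: sfs ses; rewrite /s !inE !mem_rcons !inE (negbTE nff) (negbTE nsef).
  by rewrite (eq_sym (sg f)) (negbTE n1) (negbTE n3).
have [order1 order2] : (index (sg f) s' < index (sg e) s' < index e s')%N /\ (index e s' < index f s')%N.
  have lt : (index (sg f) m < index (sg e) m)%N.
    have := corner; rewrite /s cyc_head ?mem_rcons ?inE ?sfm ?sem ?orbT //.
    by rewrite -cats1 !index_cat sfm sem.
  move: us'; rewrite /s' -!cats1 -catA cat_uniq => /and3P[_ /hasPn nm _].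
  have em := nm e; have fm := nm f; rewrite !inE !eqxx orbT /= in em fm.
  rewrite !index_cat sfm sem (negbTE (em isT)) (negbTE (fm isT)) /= eqxx (negbTE nef).
  rewrite !inE eqxx (eq_sym f) (negbTE nef) /=.
  by move: sem; rewrite -index_mem lt; clear; split; lia.
have [h1|] := boolP ((e \notin [:: g; sg g; h; sg h]) || (f \notin [:: g; sg g; h; sg h])).
  rewrite !cyc_s //; first exact: (ps g h).
    move: h1; rewrite !inE !negb_or => /orP[] /and4P[h2 h3 h4 h5]; by rewrite ?h2 ?h3 ?h4 ?h5 ?orbT.
  move: h1; rewrite !inE !negb_or => /orP[] /and4P[h2 h3 h4 h5]; by rewrite ?h2 ?h3 ?h4 ?h5 ?orbT.
rewrite negb_or !negbK => /andP[eI fI].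
have chordE a b : b \in s -> a \in [:: b; sg b] -> (b = a \/ b = sg a).
  move=> bs; have [_ bK _ _ _] := hs' _ bs.
  by rewrite !inE => /orP[] /eqP->; rewrite ?bK; [left|right].
have sub4 a : a \in [:: g; sg g; h; sg h] -> a \in [:: g; sg g] \/ a \in [:: h; sg h].
  by rewrite !inE => /or4P[] -> ; rewrite ?orbT; auto.
have ge_or : forall b, b \in s -> e \in [:: b; sg b] -> f \in [:: b; sg b] -> False.
  move=> b bs /(chordE _ _ bs) [] bE /(chordE _ _ bs) [] bE'.
  - by move: nef; rewrite -bE -bE' eqxx.
  - by move: n1; rewrite -bE' bE eqxx.
  - by move: nsef; rewrite -bE bE' eqxx.
  - by move: nef; rewrite -(seK) -bE bE' sfK eqxx.
case: (sub4 _ eI) => h1; case: (sub4 _ fI) => h2.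
- by case: (ge_or g gs h1 h2).
- case: (chordE _ _ gs h1) => ->; case: (chordE _ _ hs1 h2) => ->; rewrite ?seK ?sfK /cyc;
  move: order1 order2; move: (index e s') (index f s') (index (sg e) s') (index (sg f) s');
  clear; move=> a b c d o1 o2 c1 c2; exfalso; move: c1 c2; cyc_lia.
- case: (chordE _ _ hs1 h1) => ->; case: (chordE _ _ gs h2) => ->; rewrite ?seK ?sfK /cyc;
  move: order1 order2; move: (index e s') (index f s') (index (sg e) s') (index (sg f) s');
  clear; move=> a b c d o1 o2 c1 c2; exfalso; move: c1 c2; cyc_lia.
- by case: (ge_or h hs1 h1 h2).
Qed.
End Swap.
End CornerSwap.

(** * Dissection of the inflated rhombus *)

Module RhombusInflation.
Import CyclicPeeling ProfileFunction BoundaryEndpoints OrientedTriples StraightChords ChordCrossings CentralChords EdgeWord RingFilling CornerSwap.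
Import Order.TTheory GRing.Theory Num.Theory.
Local Open Scope ring_scope.

Section Inflation.
Variables (n x : nat).
Hypothesis n_gt1 : (1 < n)%N.
Hypothesis hx : (0 < x < n)%N.
Local Notation N := n%:Z.
Local Notation X := x%:Z.
Local Notation partner := (partner n x).
Local Notation dir := (dir n x).
Local Notation central := (central n x).

Definition boundary : seq endpoint := [seq (q, p.1, p.2) | q <- iota 0 4, p <- word n].

Lemma mem_boundary e : (e \in boundary) = valid n e.
Proof.
case: e => -[q a] k; rewrite /valid /=; apply/allpairsP/and3P => [[[q' [b j]] []]|[hq ha hk]].
  by rewrite mem_iota mem_word //= => hq /andP[hb hj] [-> -> ->]; split.
by exists (q, (a, k)); rewrite mem_iota mem_word //= ha hk.
Qed.

Lemma boundary_uniq : uniq boundary.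
Proof.
by apply: allpairs_uniq; rewrite ?iota_uniq ?word_uniq // => -[q [a k]] [q' [b j]] _ _ [-> -> ->].
Qed.

Lemma boundary_before : {in boundary &, forall e f,
  (index e boundary < index f boundary)%N -> before n e f}.
Proof.
apply: pairwise_index; rewrite /boundary.
have : pairwise (fun i j => (i < j)%N) (iota 0 4) by [].
elim: (iota 0 4) => //= q l IH /andP[/allP ql /IH{}IH].
rewrite pairwise_cat IH andbT pairwise_map; apply/andP; split.
  apply/allrelP => e f /mapP[p _ ->] /allpairsP[[q' p'] /= [/ql h _ ->]].
  by rewrite /before /= h.
have := word_sorted n_gt1; apply: sub_pairwise => -[a k] [b j] h.
by rewrite /before /= eqxx h orbT.
Qed.

Lemma boundary_partner : {in boundary, forall e, partner e \in boundary}.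
Proof. by move=> e; rewrite !mem_boundary; apply: valid_partner. Qed.

Lemma boundary_ends : exists m, boundary = first_end :: rcons m (last_end n).
Proof.
have [w hw] := word_ends n_gt1.
pose g q : seq endpoint := [seq (q, p.1, p.2) | p <- word n].
have E : boundary = g 0%N ++ g 1%N ++ g 2 ++ g 3 by rewrite /boundary /= cats0.
pose h q : seq endpoint := [seq (q, p.1, p.2) | p <- w].
exists (rcons (h 0%N) (0%N, 0, mult n 0 - 1) ++ g 1%N ++ g 2 ++ (3, 0, 0) :: h 3).
rewrite E {1 4}/g hw /= !map_rcons -/(h _) -rcons_cons -!rcons_cat.
by [].
Qed.

Variables (V : zmodType) (A : comNzRingType) (U : int -> V).
Hypothesis Un : forall d, U (d + N) = - U d.

Let U2n := antiperiodic_double Un.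

Lemma antiperiodic_mod d k : U (d + 2 * N * k) = U d.
Proof.
have pos j e : U (e + 2 * N * j%:Z) = U e.
  elim: j e => [|j IH] e; first by rewrite mulr0 addr0.
  by rewrite intS mulrDr mulr1 addrA IH -[RHS](U2n e) PoszM.
case: k => k; first exact: pos.
by rewrite NegzE -[LHS](pos k.+1); congr U; ring.
Qed.

Lemma antiperiodic_residue d c : U (c + residue n (d - c)) = U d.
Proof.
have [k [h _]] := residue_spec n_gt1 (d - c).
by rewrite -[RHS](antiperiodic_mod d (- k)); congr U; clear - h; lia.
Qed.

Lemma chordal_boundary : chordal (U \o dir) partner central boundary.
Proof.
split; first exact: boundary_uniq.
  rewrite /boundary big_allpairs_dep /= !big_cons big_nil /= addr0.
  have opp c : \sum_(p <- word n) U (c + N + p.1) = - \sum_(p <- word n) U (c + p.1).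
    by rewrite -sumrN; apply: eq_bigr => p _; rewrite -Un; congr U; ring.
  have h0 := opp 0; have h1 := opp X; rewrite add0r in h0; rewrite (addrC X) in h1.
  by rewrite /dir /side_dir /= h0 h1 addrCA addrA addrA addrK subrr.
move=> e eb; have ve : valid n e by rewrite -mem_boundary.
split; first exact: boundary_partner.
- exact: partnerK.
- by have := partner_side n_gt1 hx ve; apply: contraNneq => ->.
- by rewrite /=; case: (dir_partner n_gt1 hx ve) => ->; rewrite ?Un // -[in RHS](subrK N (dir e)) Un opprK.
- by rewrite /central (level_partner n_gt1 hx ve) eqr_oppLR eqr_opp orbC.
Qed.

(** The identity says that the four edge paths, as a chain, bound the listed rhombuses, which are
    positively oriented by the first condition. The prototile at the corner and the complete star
    are what later makes the tiling grow. *)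
Theorem inflation : exists2 tl : seq (V * int * int),
    [/\ all (fun t => 0 < residue n (t.2 - t.1.2) < N) tl, (0, 0, X) \in tl &
        exists p, forall c : nat, (c < 2 * n)%N -> (p, c%:Z + 1, c%:Z + 2) \in tl] &
    forall Phi : V -> V -> A, antisym Phi ->
      psum (U \o dir) Phi 0 boundary = \sum_(t <- tl) quad U Phi t.
Proof.
have hs := chordal_boundary; have [us cl _] := hs.
have vs : all (valid n) boundary by apply/allP => e; rewrite mem_boundary.
have full e : valid n e -> e \in boundary by rewrite mem_boundary.
have pos := boundary_positive n_gt1 hx vs boundary_partner boundary_before.
have sep := boundary_separated n_gt1 hx us vs boundary_partner boundary_before.
have co := corner_order n_gt1 hx vs boundary_partner boundary_before full.
have rotE := central_rot n_gt1 hx us vs boundary_partner boundary_before full.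
have [m bE] := boundary_ends.
move: hs cl pos sep co rotE; rewrite bE => hs cl pos sep co rotE.
set e := first_end in bE hs cl pos sep co rotE *.
set f := last_end n in bE hs cl pos sep co rotE *.
have m0 := mult0_gt1 n_gt1; have m1 := mult_sum_gt2 n_gt1 hx.
(* The corner letters have levels 1 - mult 0 - mult x and its negative, which differ from 1 and -1
   since the two multiplicities add up to more than 2. *)
have nCe : ~~ central e.
  rewrite /central /level /= /turn /= sub0r multN //; move: m0 m1; move: (mult n 0) (mult n X) => a b.
  by clear; lia.
have nCf : ~~ central f.
  rewrite /central /level /= /turn /= opprB add0r multBn //.
  by move: m0 m1; move: (mult n 0) (mult n X) => a b; clear; lia.
have hs1 := swap_chordal hs; have pos1 := swap_positive hs co pos.
have sep1 := swap_separated hs co nCe nCf sep.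
have filE : filter central (rcons (rcons m e) f) = filter central (e :: rcons m f).
  by rewrite -!cats1 /= !filter_cat /= (negbTE nCe) (negbTE nCf) !cats0.
have [tl [i [gtl [p' HP]]]] := chord_peel A (0 + U (dir e)) hs1 pos1 sep1.
(* The direction n+1 is the one in which [ring_fill] starts the outer polygon. *)
rewrite filE in HP; have [j rj] := rotE (N + 1).
set F := filter _ _ in HP rj.
have UF : map (U \o dir) (rot j F) = map U [seq N + 1 + (j./2)%:Z | j <- iota 0 (4 * n)].
  have -> : [seq N + 1 + (j./2)%:Z | j <- iota 0 (4 * n)] =
      [seq N + 1 + r | r <- [seq (j./2)%:Z | j <- iota 0 (4 * n)]] by rewrite -map_comp.
  by rewrite -rj -!map_comp; apply: eq_map => g /=; rewrite antiperiodic_residue.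
have clF : \sum_(g <- F) (U \o dir) g = 0.
  rewrite -(perm_big _ (permEl (perm_rot j F))) -(big_map _ xpredT id) UF.
  rewrite (_ : (4 * n = 2 * (n + n))%N); last by lia.
  have half k : \sum_(g <- map U [seq N + 1 + (j./2)%:Z | j <- iota 0 (2 * k)]) g =
      \sum_(c < k) U (N + 1 + c%:Z) *+ 2.
    elim: k => [|k IH]; first by rewrite big_nil big_ord0.
    have -> : (2 * k.+1 = 2 * k + 2)%N by lia.
    rewrite (iotaD _ (2 * k)) !map_cat big_cat IH big_ord_recr /= !big_cons big_nil addr0 add0n.
    have -> : ((2 * k)./2 = k)%N by lia.
    have -> : (uphalf (2 * k) = k)%N by rewrite uphalf_half; lia.
    by rewrite mulr2n.
  rewrite half big_split_ord /= -big_split /= big1 // => c _.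
  have -> : U (N + 1 + (n + c)%N%:Z) = - U (N + 1 + c%:Z).
    by rewrite -Un; congr U; rewrite PoszD; ring.
  by rewrite mulNrn subrr.
have [r Hr] : exists r, rot j F = rot r (rot i F).
  have [k hk] := rot_rot_ex (size F - i) i F.
  have iK : rot (size F - i) (rot i F) = F.
    have [le|lt] := leqP i (size F); first by rewrite -{1}(size_rot i F) -/(rotr i (rot i F)) rotK.
    by move/eqP: (ltnW lt) => ->; rewrite rot0 rot_oversize // ltnW.
  by have [r hr] := rot_rot_ex j (size F - i) (rot i F); exists r; rewrite -hr iK.
have clF' : \sum_(g <- rot i F) (U \o dir) g = 0.
  by rewrite (perm_big F) // perm_rot.
have [p1 Hp1] := psum_rot A r p' clF'.
(* The centre of the polygon, chosen so that [ring_point] with r = n and c = 0 gives the corner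
   [p1]. *)
pose c0 := p1 - \sum_(k < n) U (0 + 1 + k%:Z).
pose tr (t : V * endpoint * endpoint) : V * int * int := (t.1.1, dir t.1.2, dir t.2).
have ef : U (dir (partner f)) = - U (dir f).
  have fv : f \in e :: rcons m f by rewrite inE mem_rcons mem_head orbT.
  by case: hs => _ _ /(_ f fv)[].
have rs d : 0 <= d < 2 * N -> residue n d = d.
  by move=> h; have := residue_small 0 h; rewrite mulr0 addr0.
exists ((0, 0, X) :: map tr tl ++ ring_rhombs n U c0).
  split.
  - rewrite /= subr0 all_cat all_map.
    rewrite rs; last by clear - hx; lia.
    have -> : 0 < X < N by clear - hx; lia.
    rewrite (eq_all (a2 := fun t => crosses n x t.1.2 t.2)) // gtl /=.
    apply/allP => t /ring_rhombs_residue; move: (t.2 - t.1.2) => d h; rewrite rs ?h //.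
    by move: h; clear; lia.
  - by rewrite inE eqxx.
  exists c0 => c c2; rewrite inE mem_cat ring_rhombs_star ?orbT //.
move=> Phi aP.
rewrite (psum_corner 0 aP (f' := partner f)) // (HP Phi aP) big_cons big_cat /= big_map.
congr (_ + (_ + _)).
  have UX : U (dir (partner f)) = U X.
    by rewrite ef /dir /side_dir /= addr0 addrC Un opprK.
  by rewrite /quad /= UX /dir /side_dir /= addr0.
  by apply: eq_bigr => -[[q g] h] _.
rewrite (Hp1 Phi) -Hr psum_map UF -psum_map ring_fill //; last by lia.
by congr (psum _ _ _ _); rewrite /ring_point /c0 subrK.
Qed.
End Inflation.
End RhombusInflation.

From mathcomp Require Import complex.
From mathcomp Require Import all_classical all_reals all_analysis.
Require Import Defs.

(** * Crossing numbers with a vertical ray *)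

Module RayCrossing.
Import CyclicPeeling.
Import Order.TTheory GRing.Theory Num.Theory.
Local Open Scope ring_scope.

Section Plane.
Variable R : realType.
Local Notation plane := (plane R).
Implicit Types (a b c o p u v w z : plane) (s t : R).

Definition re z : R := complex.Re z.
Definition im z : R := complex.Im z.

Lemma planeP a b : re a = re b -> im a = im b -> a = b.
Proof. by case: a b => [x y] [x' y'] /= -> ->. Qed.

Lemma reD a b : re (a + b) = re a + re b. Proof. by case: a b => [? ?] []. Qed.
Lemma imD a b : im (a + b) = im a + im b. Proof. by case: a b => [? ?] []. Qed.
Lemma reN a : re (- a) = - re a. Proof. by case: a. Qed.
Lemma imN a : im (- a) = - im a. Proof. by case: a. Qed.
Lemma reM a b : re (a * b) = re a * re b - im a * im b.
Proof. by case: a b => [? ?] []. Qed.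
Lemma imM a b : im (a * b) = re a * im b + im a * re b.
Proof. by case: a b => [? ?] []. Qed.
Lemma reZ s a : re (scale s a) = s * re a.
Proof. by case: a => x y; rewrite /scale reM /re /=; ring. Qed.
Lemma imZ s a : im (scale s a) = s * im a.
Proof. by case: a => x y; rewrite /scale imM /im /=; ring. Qed.
Lemma re0 : re 0 = 0. Proof. by []. Qed.
Lemma im0 : im 0 = 0. Proof. by []. Qed.
Lemma re1 : re 1 = 1. Proof. by []. Qed.
Lemma im1 : im 1 = 0. Proof. by []. Qed.

Definition coordE := (reD, imD, reN, imN, reM, imM, reZ, imZ, re0, im0, re1, im1).

Definition cross a b : R := re a * im b - im a * re b.
Definition dot a b : R := re a * re b + im a * im b.

(** The vertical line through [z] counts with one side only, so a ray through a vertex is counted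
    once. *)
Definition below z p : R := ((re p <= re z)%R)%:R.

(* The signed crossing number of the segment from a to b with the vertical ray
   above z. *)
Definition crossing z a b : R :=
  let h := below z b - below z a in
  if 0 < cross (b - a) (z - a) then Num.max h 0
  else if cross (b - a) (z - a) < 0 then Num.min h 0 else 0.

Lemma belowP z p : (re p <= re z /\ below z p = 1) \/ (re z < re p /\ below z p = 0).
Proof. by rewrite /below; case: leP; [left|right]. Qed.

Lemma crossingP z a b (D := cross (b - a) (z - a)) (h := below z b - below z a) :
  [\/ 0 < D /\ ((0 <= h /\ crossing z a b = h) \/ (h <= 0 /\ crossing z a b = 0)),
      D < 0 /\ ((h <= 0 /\ crossing z a b = h) \/ (0 <= h /\ crossing z a b = 0)) |
      D = 0 /\ crossing z a b = 0].
Proof.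
rewrite /crossing -/D -/h.
case: (ltgtP 0 D) => hD; [constructor 1|constructor 2|constructor 3] => //; split=> //.
- by case: (leP h 0); [right|left]; split=> //; apply: ltW.
- by case: (leP h 0); [left|right]; split=> //; apply: ltW.
Qed.

Lemma crossing_antisym z : antisym (crossing z).
Proof.
move=> a b; have [hD|hD|hD] := crossingP z a b; have [gD|gD|gD] := crossingP z b a;
move: hD gD; rewrite /cross !coordE; nra.
Qed.

Lemma crossing_additive z a c t (b := a + scale t (c - a)) : 0 <= t <= 1 ->
  crossing z a c = crossing z a b + crossing z b c.
Proof.
move=> /andP[t0 t1]; rewrite {}/b; set b := a + _.
have D1 : cross (b - a) (z - a) = t * cross (c - a) (z - a).
  by rewrite /b /cross !coordE; ring.
have D2 : cross (c - b) (z - b) = (1 - t) * cross (c - a) (z - a).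
  by rewrite /b /cross !coordE; ring.
have bE : re b = re a + t * (re c - re a) by rewrite /b !coordE.
have b0 : t = 0 -> below z b = below z a by move=> t0'; rewrite /below bE t0' mul0r addr0.
have b1 : t = 1 -> below z b = below z c.
  by move=> t1'; rewrite /below bE t1' mul1r addrCA subrr addr0.
have mono : (below z a <= below z b <= below z c) \/ (below z c <= below z b <= below z a).
  by have [[??]|[??]] := belowP z a; have [[??]|[??]] := belowP z b;
     have [[??]|[??]] := belowP z c; (left; nra) || (right; nra).
have [t00|t00] := eqVneq t 0.
  have -> : crossing z a b = 0 by rewrite /crossing D1 t00 mul0r ltxx.
  by rewrite /crossing D2 b0 // t00 subr0 mul1r add0r.
have [t11|t11] := eqVneq t 1.
  have -> : crossing z b c = 0 by rewrite /crossing D2 t11 subrr mul0r ltxx.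
  by rewrite /crossing D1 b1 // t11 mul1r addr0.
have {}t0 : 0 < t by rewrite lt_neqAle eq_sym t00.
have {}t1 : 0 < 1 - t by rewrite subr_gt0 lt_neqAle t11.
rewrite /crossing D1 D2 !pmulr_rgt0 // !pmulr_rlt0 //.
have [/andP[m1 m2]|/andP[m1 m2]] := mono.
  rewrite !max_l ?subr_ge0 // ?(le_trans m1 m2) //.
  rewrite !min_r ?subr_ge0 // ?(le_trans m1 m2) //.
  by case: (ltgtP 0 (cross _ _)) => _; rewrite ?addr0 //; lra.
rewrite !max_r ?subr_le0 // ?(le_trans m1 m2) //.
rewrite !min_l ?subr_le0 // ?(le_trans m1 m2) //.
by case: (ltgtP 0 (cross _ _)) => _; rewrite ?addr0 //; lra.
Qed.

(** If the half-plane lies above its border, every segment in it that spans the abscissa of [z]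
    passes above [z]; otherwise none does. The crossing number is thus an increment of a function of
    the ends, and telescopes along paths in the half-plane. *)
Lemma crossing_half d o a b z : 0 <= cross d (a - o) -> 0 <= cross d (b - o) ->
  cross d (z - o) < 0 ->
  crossing z a b = if 0 < re d then below z b - below z a else 0.
Proof.
move=> ha hb hz.
have [same|diff] := eqVneq (below z b) (below z a).
  by rewrite /crossing same subrr maxxx minxx !if_same.
have key : re a <= re z < re b \/ re b <= re z < re a ->
  [\/ 0 < re d /\ 0 < (re a - re b) * cross (b - a) (z - a) |
      re d < 0 /\ (re a - re b) * cross (b - a) (z - a) < 0].
  move: ha hb hz; rewrite /cross !coordE.
  move: (re a) (im a) (re b) (im b) (re z) (im z) (re d) (im d) (re o) (im o).
  move=> ax ay bx by_ zx zy dx dy ox oy ha hb hz ht.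
  have E : dx * ((bx - ax) * (zy - ay) - (by_ - ay) * (zx - ax)) =
     (bx - ax) * (dx * (zy - oy) - dy * (zx - ox))
     - (bx - zx) * (dx * (ay - oy) - dy * (ax - ox)) - (zx - ax) * (dx * (by_ - oy) - dy * (bx - ox)) by ring.
  set D := (bx - ax) * _ - _ in E *.
  have F : 0 < dx * ((ax - bx) * D).
    rewrite mulrCA E.
    move: ha hb hz; set fa := _ - _; set fb := _ - _; set fz := _ - _ => ha hb hz.
    case: ht => /andP[h1 h2].
      have l1 : 0 < bx - ax by lra.
      have l2 : 0 <= zx - ax by lra.
      have l3 : 0 <= bx - zx by lra.
      rewrite nmulr_rgt0; last lra.
      have := mulr_ge0 l3 ha; have := mulr_ge0 l2 hb.
      by have : (bx - ax) * fz < 0 by [rewrite pmulr_rlt0]; lra.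
    have l1 : bx - ax < 0 by lra.
    have l2 : zx - ax <= 0 by lra.
    have l3 : bx - zx <= 0 by lra.
    rewrite pmulr_rgt0; last lra.
    have := mulr_le0_ge0 l3 ha; have := mulr_le0_ge0 l2 hb.
    by have : 0 < (bx - ax) * fz by [rewrite nmulr_rgt0]; lra.
  have [d0|d0|d0] := ltgtP dx 0.
  - by right; split=> //; move: F; rewrite nmulr_rgt0.
  - by left; split=> //; move: F; rewrite pmulr_rgt0.
  - by move: F; rewrite d0 mul0r ltxx.
have [[a1 a2]|[a1 a2]] := belowP z a; have [[b1 b2]|[b1 b2]] := belowP z b;
  rewrite ?a2 ?b2 ?eqxx in diff *; try by case/eqP: diff.
- have [[-> h]|[d0 h]] := key (or_introl (introT andP (conj a1 b1))).
    have [[]|[]|[]] := crossingP z a b; rewrite ?a2 ?b2; nra.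
  rewrite ltNge (ltW d0) /=.
  by have [[]|[]|[]] := crossingP z a b; rewrite ?a2 ?b2; nra.
- have [[-> h]|[d0 h]] := key (or_intror (introT andP (conj b1 a1))).
    have [[]|[]|[]] := crossingP z a b; rewrite ?a2 ?b2; nra.
  rewrite ltNge (ltW d0) /=.
  by have [[]|[]|[]] := crossingP z a b; rewrite ?a2 ?b2; nra.
Qed.
End Plane.
End RayCrossing.

(** * Winding number of a parallelogram *)

Module ParallelogramWinding.
Import CyclicPeeling RingFilling RayCrossing.
Import Order.TTheory GRing.Theory Num.Theory.
Local Open Scope ring_scope.

(** The value s x + t y is a mean, with positive weights, of the corner values 0, x, x + y, y; if it
    is at least as large as all of them, they are equal. *)
Lemma bilinear_range (R : realType) (x y s t : R) : 0 < s < 1 -> 0 < t < 1 ->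
  0 <= s * x + t * y -> x <= s * x + t * y -> x + y <= s * x + t * y ->
  y <= s * x + t * y -> x = 0 /\ y = 0.
Proof.
move=> /andP[s0 s1] /andP[t0 t1]; set c := s * x + t * y => h1 h2 h3 h4.
have s1' : 0 < 1 - s by lra.
have t1' : 0 < 1 - t by lra.
have e1 := mulr_ge0 (ltW (mulr_gt0 s1' t1')) h1.
have e2 : 0 <= s * (1 - t) * (c - x) by rewrite !mulr_ge0 ?subr_ge0 // ltW.
have e3 : 0 <= s * t * (c - (x + y)) by rewrite !mulr_ge0 ?subr_ge0 // ltW.
have e4 : 0 <= (1 - s) * t * (c - y) by rewrite !mulr_ge0 ?subr_ge0 // ltW.
have E : (1 - s) * (1 - t) * c + s * (1 - t) * (c - x) + s * t * (c - (x + y)) +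
  (1 - s) * t * (c - y) = 0 by rewrite /c; ring.
have z1 : (1 - s) * (1 - t) * c = 0 by lra.
have z2 : s * (1 - t) * (c - x) = 0 by lra.
have z4 : (1 - s) * t * (c - y) = 0 by lra.
move/eqP: z1; rewrite !mulf_eq0 ?(gt_eqF s0) ?(gt_eqF t0) ?(gt_eqF s1') ?(gt_eqF t1') /= => /eqP c0.
move/eqP: z2; rewrite !mulf_eq0 ?(gt_eqF s0) ?(gt_eqF t0) ?(gt_eqF s1') ?(gt_eqF t1') /= => /eqP c1.
move/eqP: z4; rewrite !mulf_eq0 ?(gt_eqF s0) ?(gt_eqF t0) ?(gt_eqF s1') ?(gt_eqF t1') /= => /eqP c2.
by split; lra.
Qed.

Lemma oppr_pair (R : realType) (x y : R) : - x = 0 /\ - y = 0 -> x = 0 /\ y = 0.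
Proof. by case=> h1 h2; split; lra. Qed.

Section Parallelogram.
Variable R : realType.
Local Notation plane := (plane R).
Implicit Types (a b c o p u v w z : plane) (s t : R).

Definition al p u v z : R := cross (z - p) v / cross u v.
Definition be p u v z : R := cross u (z - p) / cross u v.

Definition closed_pg p u v z : Prop := 0 <= al p u v z <= 1 /\ 0 <= be p u v z <= 1.
Definition open_pg p u v z : Prop := 0 < al p u v z < 1 /\ 0 < be p u v z < 1.

Lemma open_closed_pg p u v z : open_pg p u v z -> closed_pg p u v z.
Proof. by move=> [/andP[h1 h2] /andP[h3 h4]]; split; rewrite !ltW. Qed.

Lemma pg_coords p u v z : cross u v != 0 ->
  z = p + scale (al p u v z) u + scale (be p u v z) v.
Proof.
rewrite /al /be /cross !coordE => h.
by apply: planeP; rewrite !coordE; field.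
Qed.

Lemma al_at p u v s t : cross u v != 0 -> al p u v (p + scale s u + scale t v) = s.
Proof. by rewrite /al /cross !coordE => h; field. Qed.

Lemma be_at p u v s t : cross u v != 0 -> be p u v (p + scale s u + scale t v) = t.
Proof. by rewrite /be /cross !coordE => h; field. Qed.

Lemma cross_rebase u v : cross v (- u) = cross u v.
Proof. by rewrite /cross !coordE; ring. Qed.

(** The frame p + u, v, -u is the same parallelogram seen from its next corner; arguments about the
    first edge thus extend to all four. *)
Lemma al_rebase p u v z : al (p + u) v (- u) z = be p u v z.
Proof. by rewrite /al /be cross_rebase; congr (_ / _); rewrite /cross !coordE; ring. Qed.

Lemma be_rebase p u v z : cross u v != 0 -> be (p + u) v (- u) z = 1 - al p u v z.
Proof.
move=> h; rewrite /al /be cross_rebase -{1}(divff h) -mulrBl; congr (_ / _).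
by rewrite /cross !coordE; ring.
Qed.

Lemma quad_rebase (Phi : plane -> plane -> R) p u v :
  quad id Phi (p + u, v, - u) = quad id Phi (p, u, v).
Proof.
rewrite /quad; have -> : p + u + v - u = p + v by rewrite addrAC addrK.
by rewrite addrK; ring.
Qed.

Lemma closed_rebase p u v z : cross u v != 0 ->
  closed_pg (p + u) v (- u) z <-> closed_pg p u v z.
Proof. by move=> h; rewrite /closed_pg al_rebase be_rebase //; split=> -[]; split=> //; lra. Qed.

Lemma open_rebase p u v z : cross u v != 0 ->
  open_pg (p + u) v (- u) z <-> open_pg p u v z.
Proof. by move=> h; rewrite /open_pg al_rebase be_rebase //; split=> -[]; split=> //; lra. Qed.

Definition winding z p u v : R := quad id (crossing z) (p, u, v).

Section Winding.
Variables (p u v z : plane).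
Hypothesis uv : 0 < cross u v.

Let d1 : cross (p + u - p) (z - p) = be p u v z * cross u v.
Proof. rewrite divfK ?gt_eqF // /cross !coordE; ring. Qed.
Let d2 : cross (p + u + v - (p + u)) (z - (p + u)) = (1 - al p u v z) * cross u v.
Proof. rewrite mulrBl divfK ?gt_eqF // /cross !coordE; ring. Qed.
Let d3 : cross (p + v - (p + u + v)) (z - (p + u + v)) = (1 - be p u v z) * cross u v.
Proof. rewrite mulrBl divfK ?gt_eqF // /cross !coordE; ring. Qed.
Let d4 : cross (p - (p + v)) (z - (p + v)) = al p u v z * cross u v.
Proof. rewrite divfK ?gt_eqF // /cross !coordE; ring. Qed.

Let outside d o : 0 <= cross d (p - o) -> 0 <= cross d (p + u - o) ->
  0 <= cross d (p + u + v - o) -> 0 <= cross d (p + v - o) -> cross d (z - o) < 0 ->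
  winding z p u v = 0.
Proof.
move=> h1 h2 h3 h4 hz; rewrite /winding /quad !(crossing_half (d := d) (o := o)) //.
by case: ifP => _; ring.
Qed.

(** The line of one side separates [z] from the parallelogram, and by [crossing_half] the four terms
    telescope. *)
Lemma winding_out : ~ closed_pg p u v z -> winding z p u v = 0.
Proof.
have uv0 := lt0r_neq0 uv.
have [h1|h1] := ltP (be p u v z) 0.
  move=> _.
  have hz : cross (u) (z - (p)) < 0.
    have -> : cross (u) (z - (p)) = be p u v z * cross u v by rewrite divfK.
    by rewrite pmulr_llt0 // ?subr_lt0.
  by apply: (outside _ _ _ _ hz); move: uv; rewrite /cross !coordE; lra.
have [h2|h2] := ltP 1 (al p u v z).
  move=> _.
  have hz : cross (v) (z - (p + u)) < 0.
    have -> : cross (v) (z - (p + u)) = (1 - al p u v z) * cross u v by rewrite -d2 /cross !coordE; ring.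
    by rewrite pmulr_llt0 // ?subr_lt0.
  by apply: (outside _ _ _ _ hz); move: uv; rewrite /cross !coordE; lra.
have [h3|h3] := ltP 1 (be p u v z).
  move=> _.
  have hz : cross (- u) (z - (p + u + v)) < 0.
    have -> : cross (- u) (z - (p + u + v)) = (1 - be p u v z) * cross u v by rewrite -d3 /cross !coordE; ring.
    by rewrite pmulr_llt0 // ?subr_lt0.
  by apply: (outside _ _ _ _ hz); move: uv; rewrite /cross !coordE; lra.
have [h4|h4] := ltP (al p u v z) 0.
  move=> _.
  have hz : cross (- v) (z - (p)) < 0.
    have -> : cross (- v) (z - (p)) = al p u v z * cross u v by rewrite divfK // /cross !coordE; ring.
    by rewrite pmulr_llt0 // ?subr_lt0.
  by apply: (outside _ _ _ _ hz); move: uv; rewrite /cross !coordE; lra.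
by case; split; apply/andP.
Qed.

Lemma crossing_ge0 a b : 0 <= cross (b - a) (z - a) -> 0 <= crossing z a b.
Proof. by move=> h; have [[? [] []]|[? [] []]|[]] := crossingP z a b; lra. Qed.

Lemma winding_ge0 : 0 <= winding z p u v.
Proof.
have [|/winding_out-> //] := pselect (closed_pg p u v z).
case=> /andP[a0 a1] /andP[b0 b1]; rewrite /winding /quad.
have uv0 := ltW uv.
have e1 : 0 <= crossing z p (p + u) by apply: crossing_ge0; rewrite d1 mulr_ge0.
have e2 : 0 <= crossing z (p + u) (p + u + v).
  by apply: crossing_ge0; rewrite d2 mulr_ge0 // subr_ge0.
have e3 : 0 <= crossing z (p + u + v) (p + v).
  by apply: crossing_ge0; rewrite d3 mulr_ge0 // subr_ge0.
have e4 : 0 <= crossing z (p + v) p by apply: crossing_ge0; rewrite d4 mulr_ge0.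
lra.
Qed.

(** From inside, each crossing is the positive part of an increment of [below]. Around the corners
    [below] rises exactly once, unless all corners are on one side of the vertical through [z],
    which [bilinear_range] excludes. *)
Lemma winding_in : open_pg p u v z -> winding z p u v = 1.
Proof.
case=> /andP[a0 a1] /andP[b0 b1]; rewrite /winding /quad.
have uv0 := lt0r_neq0 uv.
have cE a b : 0 < cross (b - a) (z - a) ->
    crossing z a b = Num.max (below z b - below z a) 0 by rewrite /crossing => ->.
rewrite (cE p) ?d1; last by apply: mulr_gt0.
rewrite (cE (p + u)) ?d2; last by apply: mulr_gt0 => //; rewrite subr_gt0.
rewrite (cE (p + u + v)) ?d3; last by apply: mulr_gt0 => //; rewrite subr_gt0.
rewrite (cE (p + v)) ?d4; last by apply: mulr_gt0.
have zE := congr1 (@re R) (pg_coords p z uv0); rewrite !coordE in zE.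
have nz : ~ (re u = 0 /\ re v = 0).
  by move=> [u0 v0]; move: uv; rewrite /cross u0 v0; lra.
move: a0 a1 b0 b1 zE nz; move: (al _ _ _ _) (be _ _ _ _) => a b a0 a1 b0 b1 zE nz.
have s0 : (0 : R) < 1 by [].
have m1 : (-1 : R) <= 0 by lra.
have [[c1 ->]|[c1 ->]] := belowP z p; have [[c2 ->]|[c2 ->]] := belowP z (p + u);
  have [[c3 ->]|[c3 ->]] := belowP z (p + u + v); have [[c4 ->]|[c4 ->]] := belowP z (p + v);
  rewrite ?subrr ?sub0r ?subr0 ?maxxx ?(max_l (ltW s0)) ?(max_r m1) ?addr0 ?add0r //;
  move: c1 c2 c3 c4; rewrite !coordE zE => c1 c2 c3 c4; try by exfalso; lra.
- by case: nz; apply: (bilinear_range (s := a) (t := b)); lra.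
- by case: nz; apply: oppr_pair; apply: (bilinear_range (s := a) (t := b)); lra.
Qed.
End Winding.
End Parallelogram.
End ParallelogramWinding.

(** * Tiles, their frames and boundary chains *)

Module TileFrames.
Import CyclicPeeling RingFilling RayCrossing ParallelogramWinding.
Import Order.TTheory GRing.Theory Num.Theory.
Local Open Scope classical_set_scope.
Local Open Scope ring_scope.

Section Angles.
Variables (R : realType) (n : nat).
Hypothesis n_gt1 : (1 < n)%N.
Local Notation plane := (plane R).
Implicit Types d e : int.

Definition theta : R := pi / n%:R.
Definition U d : plane := cis (d%:~R * theta).

Lemma n_gt0R : 0 < n%:R :> R.
Proof. by rewrite ltr0n; lia. Qed.

Lemma n_theta : n%:R * theta = pi.
Proof. by rewrite /theta mulrCA divff ?mulr1 // gt_eqF ?n_gt0R. Qed.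

Lemma theta_gt0 : 0 < theta.
Proof. by rewrite divr_gt0 ?pi_gt0 ?n_gt0R. Qed.

Lemma UD d : U (d + n%:Z) = - U d.
Proof.
rewrite /U rmorphD /= mulrDl -pmulrn n_theta /cis.
by apply: planeP; rewrite ?reN ?imN /re /im /= ?cosDpi ?sinDpi.
Qed.

Lemma UM d e : U d * U e = U (d + e).
Proof.
rewrite /U rmorphD /= mulrDl /cis.
by apply: planeP; rewrite ?reM ?imM /re /im /= ?cosD ?sinD; ring.
Qed.

Lemma U0 : U 0 = 1.
Proof. by rewrite /U mul0r /cis cos0 sin0. Qed.

Lemma reU d : re (U d) = cos (d%:~R * theta). Proof. by []. Qed.
Lemma imU d : im (U d) = sin (d%:~R * theta). Proof. by []. Qed.

Lemma sin_theta_gt0 : 0 < sin theta.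
Proof.
have t0 := theta_gt0; have nt := n_theta.
have n2 : 2 <= n%:R :> R by rewrite ler_nat.
by apply: sin_gt0_pi; have := pi_gt0 R; rewrite t0 /=; nra.
Qed.

Lemma theta_mul_bounds x : (0 < x)%N -> (2 * x <= n)%N ->
  theta <= x%:R * theta <= pi / 2.
Proof.
move=> x0 x2; have t0 := theta_gt0; have nt := n_theta.
have x1 : 1 <= x%:R :> R by rewrite ler1n.
have x3 : 2 * x%:R <= n%:R :> R by rewrite -natrM ler_nat.
apply/andP; split; first by nra.
by rewrite ler_pdivlMr // -nt; nra.
Qed.

Lemma cos_mul_bounds x : (0 < x)%N -> (2 * x <= n)%N ->
  0 <= cos (x%:R * theta) <= cos theta /\ sin theta <= sin (x%:R * theta).
Proof.
move=> x0 x2; have /andP[h1 h2] := theta_mul_bounds x0 x2.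
have t0 := theta_gt0; have p0 := pi_gt0 R.
have c0 : 0 <= cos (x%:R * theta) by apply: cos_ge0_pihalf; apply/andP; split; lra.
have c1 : cos (x%:R * theta) <= cos theta.
  have [<-//|ne] := eqVneq theta (x%:R * theta).
  rewrite ltW // ltr_cos ?in_itv /=; first by rewrite lt_neqAle ne h1.
    by apply/andP; split; lra.
  by apply/andP; split; lra.
split; first by rewrite c0 c1.
have s0 : 0 <= sin theta by apply: ltW; apply: sin_theta_gt0.
have s1 : 0 <= sin (x%:R * theta) by apply: sin_ge0_pi; apply/andP; split; lra.
have := cos2Dsin2 theta; have := cos2Dsin2 (x%:R * theta); nra.
Qed.

Lemma cos_theta_ge0 : 0 <= cos theta.
Proof.
have h : (2 * 1 <= n)%N by lia.
by have [/andP[+ _] _] := cos_mul_bounds (ltnSn 0) h; rewrite mul1r.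
Qed.

(** Unit sides at an angle between theta and pi - theta: a bound common to all prototiles and
    independent of the corner taken as origin. *)
Definition rhomb (u v : plane) : Prop :=
  [/\ dot u u = 1, dot v v = 1, sin theta <= cross u v & `|dot u v| <= cos theta].

Lemma rhomb_cross u v : rhomb u v -> 0 < cross u v.
Proof. by case=> _ _ h _; apply: lt_le_trans h; exact: sin_theta_gt0. Qed.

Lemma rhomb_rebase u v : rhomb u v -> rhomb v (- u).
Proof.
case=> h1 h2 h3 h4; split=> //.
- by rewrite -h1 /dot !coordE; ring.
- by rewrite cross_rebase.
- by have -> : dot v (- u) = - dot u v by [rewrite /dot !coordE; ring]; rewrite normrN.
Qed.
End Angles.

Section Tiles.
Variables (R : realType) (n : nat).
Hypothesis n_gt1 : (1 < n)%N.
Local Notation plane := (plane R).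
Local Notation tile := (tile R n).
Implicit Types (t : tile) (z : plane).

Definition corner t : plane := trans (tmotion t).
Definition side1 t : plane := rot (tmotion t).
Definition side2 t : plane := rot (tmotion t) * proto_side R (tproto t).

Lemma rot_dot (g : motion R) : dot (rot g) (rot g) = 1.
Proof.
have := rot_norm g; case: (rot g) => x y /eqP; rewrite normc_def => /(congr1 (@complex.Re R)) /= h.
rewrite /dot /re /im /= -!expr2; have := congr1 (fun x => x ^+ 2) h.
by rewrite sqr_sqrtr ?expr1n // addr_ge0 ?sqr_ge0.
Qed.

Lemma dotM (w u v : plane) : dot (w * u) (w * v) = dot w w * dot u v.
Proof. by rewrite /dot !coordE; ring. Qed.

Lemma crossM (w u v : plane) : cross (w * u) (w * v) = dot w w * cross u v.
Proof. by rewrite /cross /dot !coordE; ring. Qed.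

Lemma tproto_bound (T : proto n) : (2 * T.+1 <= n)%N.
Proof. by have := ltn_ord T; lia. Qed.

Lemma proto_sideE (T : proto n) : proto_side R T = U R n T.+1%:Z.
Proof. by rewrite /proto_side /U /theta mulrA. Qed.

Lemma tile_rhomb t : rhomb n (side1 t) (side2 t).
Proof.
have := cos_mul_bounds R n_gt1 (ltn0Sn (tproto t)) (tproto_bound _).
move=> [/andP[c0 c1] s1].
have e3 : cross (side1 t) (side2 t) = cross 1 (proto_side R (tproto t)).
  by rewrite /side2 -[side1 t]mulr1 crossM rot_dot mul1r.
have e4 : dot (side1 t) (side2 t) = dot 1 (proto_side R (tproto t)).
  by rewrite /side2 -[side1 t]mulr1 dotM rot_dot mul1r.
rewrite /rhomb e3 e4 /side2 dotM !rot_dot mul1r proto_sideE.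
rewrite /dot /cross re1 im1 !mul1r !mul0r addr0 subr0 reU imU -!pmulrn -!expr2.
by rewrite cos2Dsin2 ger0_norm.
Qed.

Definition inside t z := open_pg (corner t) (side1 t) (side2 t) z.

(** A tile described from any of its corners, so that a chosen edge can serve as the first side. *)
Definition frame t (p u v : plane) : Prop :=
  [/\ rhomb n u v, forall z, closed_pg p u v z <-> region t z &
      forall z, open_pg p u v z <-> inside t z].

Lemma tile_cross t : cross (side1 t) (side2 t) != 0.
Proof. by rewrite gt_eqF // (rhomb_cross n_gt1) //; exact: tile_rhomb. Qed.

Lemma motion_coords t (s s' : R) :
  motion_fun (tmotion t) (scale s 1 + scale s' (proto_side R (tproto t))) =
  corner t + scale s (side1 t) + scale s' (side2 t).
Proof.
rewrite /motion_fun /corner /side1 /side2.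
by apply: planeP; rewrite !coordE; ring.
Qed.

Lemma regionP t z : closed_pg (corner t) (side1 t) (side2 t) z <-> region t z.
Proof.
have h := tile_cross t; split.
  case=> h1 h2; exists (scale (al (corner t) (side1 t) (side2 t) z) 1 +
      scale (be (corner t) (side1 t) (side2 t) z) (proto_side R (tproto t))).
    by do 2!eexists; split; [exact: h1|exact: h2|].
  by rewrite motion_coords -pg_coords.
by case=> _ [a [b [ha hb ->]]] <-; rewrite motion_coords /closed_pg al_at // be_at.
Qed.

Lemma frame0 t : frame t (corner t) (side1 t) (side2 t).
Proof. by split=> // [|z]; [exact: tile_rhomb|exact: regionP]. Qed.

Lemma frame_rebase t p u v : frame t p u v -> frame t (p + u) v (- u).
Proof.
case=> h1 h2 h3; have c0 := lt0r_neq0 (rhomb_cross n_gt1 h1).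
split=> [|z|z]; first exact: rhomb_rebase.
  by rewrite -h2; exact: closed_rebase.
by rewrite -h3; exact: open_rebase.
Qed.

Definition dedges t : seq (plane * plane) :=
  let p := corner t in let u := side1 t in let v := side2 t in
  [:: (p, p + u); (p + u, p + u + v); (p + u + v, p + v); (p + v, p)].

Definition bd (Phi : plane -> plane -> R) t : R := \sum_(e <- dedges t) Phi e.1 e.2.

Lemma bdE Phi t : bd Phi t = quad id Phi (corner t, side1 t, side2 t).
Proof. by rewrite /bd /quad !big_cons big_nil /= addr0 !addrA. Qed.

Lemma frame_edge t a b : (a, b) \in dedges t -> exists v, frame t a (b - a) v.
Proof.
have f0 := frame0 t; have f1 := frame_rebase f0; have f2 := frame_rebase f1.
have f3 := frame_rebase f2; rewrite !inE => /or4P[] /eqP[-> ->].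
- by rewrite addrAC subrr add0r; eexists; exact: f0.
- by rewrite addrAC subrr add0r; eexists; exact: f1.
- have -> : corner t + side2 t - (corner t + side1 t + side2 t) = - side1 t.
    by apply: planeP; rewrite !coordE; ring.
  by eexists; exact: f2.
- have -> : corner t - (corner t + side2 t) = - side2 t.
    by apply: planeP; rewrite !coordE; ring.
  by move: f3; rewrite addrAC addrK => f3; eexists; exact: f3.
Qed.

Definition chi z t := bd (crossing z) t.

Lemma chiE z t : chi z t = winding z (corner t) (side1 t) (side2 t).
Proof. exact: bdE. Qed.

Lemma chi_ge0 z t : 0 <= chi z t.
Proof. by rewrite chiE winding_ge0 // (rhomb_cross n_gt1) //; exact: tile_rhomb. Qed.

Lemma chi_inside z t : inside t z -> chi z t = 1.
Proof. by move=> h; rewrite chiE winding_in // (rhomb_cross n_gt1) //; exact: tile_rhomb. Qed.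

Lemma chi_out z t : ~ region t z -> chi z t = 0.
Proof.
move=> h; rewrite chiE winding_out ?(rhomb_cross n_gt1) //; first exact: tile_rhomb.
by rewrite regionP.
Qed.

Lemma inside_region t z : inside t z -> region t z.
Proof. by move/open_closed_pg/regionP. Qed.

Lemma segmentC (a b : plane) : segment a b = segment b a.
Proof.
have sub (c d : plane) : segment c d `<=` segment d c.
  move=> z [s hs ->]; exists (1 - s); first by lra.
  by apply: planeP; rewrite !coordE; ring.
by apply/seteqP; split.
Qed.

Lemma motion_segment (g : motion R) (a b : plane) :
  motion_fun g @` segment a b = segment (motion_fun g a) (motion_fun g b).
Proof.
apply/seteqP; split=> z.
  by case=> _ [s hs ->] <-; exists s => //; rewrite /motion_fun; apply: planeP; rewrite !coordE; ring.
case=> s hs ->; exists (a + scale s (b - a)); first by exists s.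
by rewrite /motion_fun; apply: planeP; rewrite !coordE; ring.
Qed.

Lemma edgesP t e : edges t e <-> exists2 ab, ab \in dedges t & e = segment ab.1 ab.2.
Proof.
have c0 : motion_fun (tmotion t) 0 = corner t by rewrite /motion_fun mulr0 add0r.
have c1 : motion_fun (tmotion t) 1 = corner t + side1 t by rewrite /motion_fun mulr1 addrC.
have c3 : motion_fun (tmotion t) (proto_side R (tproto t)) = corner t + side2 t.
  by rewrite /motion_fun addrC.
have c2 : motion_fun (tmotion t) (1 + proto_side R (tproto t)) = corner t + side1 t + side2 t.
  by rewrite /motion_fun mulrDr mulr1 addrC addrA.
split.
  case=> _ [] -> <-; rewrite motion_segment ?c0 ?c1 ?c2 ?c3.
  - by exists (corner t, corner t + side1 t); rewrite ?inE ?eqxx.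
  - by exists (corner t + side1 t, corner t + side1 t + side2 t); rewrite ?inE ?eqxx ?orbT.
  - by exists (corner t + side1 t + side2 t, corner t + side2 t); rewrite ?inE ?eqxx ?orbT.
  - by exists (corner t + side2 t, corner t); rewrite ?inE ?eqxx ?orbT.
case=> -[a b]; rewrite !inE => /or4P[] /eqP[-> ->] /= ->.
- by exists (segment 0 1); [constructor 1|rewrite motion_segment c0 c1].
- by exists (segment 1 (1 + proto_side R (tproto t))); [constructor 2|rewrite motion_segment c1 c2].
- by exists (segment (1 + proto_side R (tproto t)) (proto_side R (tproto t)));
    [constructor 3|rewrite motion_segment c2 c3].
- by exists (segment (proto_side R (tproto t)) 0); [constructor 4|rewrite motion_segment c3 c0].
Qed.

Lemma verticesP t z : vertices t z <->
  exists s s' : bool, z = corner t + scale s%:R (side1 t) + scale s'%:R (side2 t).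
Proof.
have mE (s s' : bool) w : w = scale s%:R 1 + scale s'%:R (proto_side R (tproto t)) ->
    motion_fun (tmotion t) w = corner t + scale s%:R (side1 t) + scale s'%:R (side2 t).
  by move=> ->; rewrite motion_coords.
have z0 : 0 = scale false%:R 1 + scale false%:R (proto_side R (tproto t)) :> plane.
  by apply: planeP; rewrite !coordE /=; ring.
have z1 : 1 = scale true%:R 1 + scale false%:R (proto_side R (tproto t)) :> plane.
  by apply: planeP; rewrite !coordE /=; ring.
have z2 : 1 + proto_side R (tproto t) =
    scale true%:R 1 + scale true%:R (proto_side R (tproto t)) :> plane.
  by apply: planeP; rewrite !coordE /=; ring.
have z3 : proto_side R (tproto t) =
    scale false%:R 1 + scale true%:R (proto_side R (tproto t)) :> plane.
  by apply: planeP; rewrite !coordE /=; ring.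
split.
  by case=> _ [] -> <-; rewrite ?(mE _ _ _ z0) ?(mE _ _ _ z1) ?(mE _ _ _ z2) ?(mE _ _ _ z3);
    do 2!eexists.
case=> -[] [[] ->].
- by exists (1 + proto_side R (tproto t)); [constructor 3|exact: mE].
- by exists 1; [constructor 2|exact: mE].
- by exists (proto_side R (tproto t)); [constructor 4|exact: mE].
- by exists 0; [constructor 1|exact: mE].
Qed.
End Tiles.
End TileFrames.

(** * Lists of tiles covering a disc *)

Module ListCovers.
Import CyclicPeeling RingFilling RayCrossing ParallelogramWinding TileFrames.
Import Order.TTheory GRing.Theory Num.Theory.
Import numFieldNormedType.Exports.
Local Open Scope classical_set_scope.
Local Open Scope ring_scope.

Section Modulus.
Variable R : realType.
Local Notation plane := (plane R).
Implicit Types (z w c : plane).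

Definition modulus z : R := Num.sqrt (dot z z).

Lemma dot_ge0 z : 0 <= dot z z.
Proof. by rewrite /dot addr_ge0 // -expr2 sqr_ge0. Qed.

Lemma normE z : `|z| = real_complex R (modulus z).
Proof. by rewrite normc_def /modulus /dot !expr2. Qed.

Lemma modulus_ge0 z : 0 <= modulus z. Proof. exact: sqrtr_ge0. Qed.

Lemma modulusD z w : modulus (z + w) <= modulus z + modulus w.
Proof. by have := ler_normD z w; rewrite !normE -rmorphD lecR. Qed.

Lemma modulusN z : modulus (- z) = modulus z.
Proof. by rewrite /modulus /dot !coordE !mulrNN. Qed.

Lemma modulusB z w : modulus (z - w) = modulus (w - z).
Proof. by rewrite -modulusN opprB. Qed.

Lemma modulusM z w : modulus (z * w) = modulus z * modulus w.
Proof. by rewrite /modulus -sqrtrM ?dot_ge0 //; congr Num.sqrt; rewrite /dot !coordE; ring. Qed.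

Lemma modulus_scale (s : R) z : 0 <= s -> modulus (scale s z) = s * modulus z.
Proof.
move=> s0; rewrite /modulus (_ : dot _ _ = s ^+ 2 * dot z z); last by rewrite /dot !coordE; ring.
by rewrite sqrtrM ?sqr_ge0 // sqrtr_sqr ger0_norm.
Qed.

Lemma modulus1 z : dot z z = 1 -> modulus z = 1.
Proof. by rewrite /modulus => ->; rewrite sqrtr1. Qed.

Lemma modulus0 : modulus 0 = 0.
Proof. by rewrite /modulus /dot !coordE mul0r addr0 sqrtr0. Qed.

Lemma plane_nbhsP z (A : set plane) : nbhs z A <->
  exists2 e : R, 0 < e & forall w, modulus (w - z) < e -> A w.
Proof.
split.
  move/(@nbhs_ballP _ (R[i]^o)) => [e /= e0 he]; exists (complex.Re e).
    by move: e0; rewrite ltcE /= => /andP[].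
  move=> w hw; apply: he; rewrite -ball_normE /= -normrN opprB normE ltcE /=.
  by move: e0; rewrite ltcE /= => /andP[/eqP-> _]; rewrite eqxx.
case=> e e0 he; apply/(@nbhs_ballP _ (R[i]^o)); exists (real_complex R e) => /=.
  by rewrite ltcR.
by move=> w /=; rewrite -ball_normE /= -normrN opprB normE ltcR; apply: he.
Qed.

Definition toward w c (s : R) : plane := w + scale s (c - w).

Lemma modulus_toward w c s : 0 <= s -> modulus (toward w c s - w) = s * modulus (c - w).
Proof. by move=> s0; rewrite /toward addrAC subrr add0r modulus_scale. Qed.

Lemma toward_near w c (e : R) : 0 < e ->
  exists2 d : R, 0 < d & forall s, 0 < s < d -> modulus (toward w c s - w) < e.
Proof.
move=> e0; have m0 : 0 < modulus (c - w) + 1 by have := modulus_ge0 (c - w); lra.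
exists (e / (modulus (c - w) + 1)); first exact: divr_gt0.
move=> s /andP[s0]; rewrite ltr_pdivlMr // => h; rewrite modulus_toward ?ltW //.
by apply: le_lt_trans h; rewrite ler_pM2l // lerDl.
Qed.

Lemma nbhs_toward z c (A : set plane) : nbhs z A ->
  exists2 d : R, 0 < d & forall s, 0 < s < d -> A (toward z c s).
Proof.
by move=> /plane_nbhsP[e e0 he]; have [d d0 hd] := toward_near z c e0; exists d => // s /hd/he.
Qed.

Lemma affine_pos (x y : R) : 0 < x \/ 0 <= x /\ 0 < y ->
  exists2 d : R, 0 < d & forall s, 0 < s < d -> 0 < (1 - s) * x + s * y.
Proof.
case=> [x0|[x0 y0]].
  have m0 : 0 < x + `|y| + 1 by have := normr_ge0 y; lra.
  exists (x / (x + `|y| + 1)); first exact: divr_gt0.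
  move=> s /andP[s0]; rewrite ltr_pdivlMr // => h.
  have h2 : - `|y| <= y by have /andP[] : - `|y| <= y <= `|y| by rewrite -ler_norml.
  by have h3 : s * - `|y| <= s * y by [rewrite ler_pM2l]; lra.
exists 1 => // s /andP[s0 s1].
have h1 : 0 < s * y by exact: mulr_gt0.
by have h2 : 0 <= (1 - s) * x by [rewrite mulr_ge0 // subr_ge0 ltW]; lra.
Qed.

Lemma al_toward p u v w c s : cross u v != 0 ->
  al p u v (toward w c s) = (1 - s) * al p u v w + s * al p u v c.
Proof. by rewrite /al /toward /cross !coordE => h; field. Qed.

Lemma be_toward p u v w c s : cross u v != 0 ->
  be p u v (toward w c s) = (1 - s) * be p u v w + s * be p u v c.
Proof. by rewrite /be /toward /cross !coordE => h; field. Qed.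

Lemma ex_min2 (P Q : R -> Prop) : (exists2 d, 0 < d & forall s, 0 < s < d -> P s) ->
  (exists2 d, 0 < d & forall s, 0 < s < d -> Q s) ->
  exists2 d, 0 < d & forall s, 0 < s < d -> P s /\ Q s.
Proof.
case=> d d0 hd [e e0 he]; exists (Num.min d e); first by rewrite lt_min d0 ?ltr01.
by move=> s /andP[s0]; rewrite lt_min => /andP[h1 h2]; split; [apply: hd|apply: he]; rewrite s0.
Qed.

Lemma open_toward p u v w c : cross u v != 0 ->
  0 < al p u v w < 1 -> be p u v w < 1 ->
  0 < be p u v w \/ 0 <= be p u v w /\ 0 < be p u v c ->
  exists2 d, 0 < d & forall s, 0 < s < d -> open_pg p u v (toward w c s).
Proof.
move=> h /andP[a0 a1] b1 b0.
have h1 := affine_pos (y := al p u v c) (or_introl a0).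
have h2 : exists2 d : R, 0 < d & forall s, 0 < s < d ->
    0 < (1 - s) * (1 - al p u v w) + s * (1 - al p u v c).
  by apply: affine_pos; left; rewrite subr_gt0.
have h3 := affine_pos b0.
have h4 : exists2 d : R, 0 < d & forall s, 0 < s < d ->
    0 < (1 - s) * (1 - be p u v w) + s * (1 - be p u v c).
  by apply: affine_pos; left; rewrite subr_gt0.
have [d d0 hd] := ex_min2 (ex_min2 h1 h2) (ex_min2 h3 h4); exists d => // s /hd.
by rewrite /open_pg al_toward // be_toward //; move=> [[g1 g2] [g3 g4]]; split; lra.
Qed.

Lemma toward_open p u v w c s : cross u v != 0 -> closed_pg p u v w -> open_pg p u v c ->
  0 < s <= 1 -> open_pg p u v (toward w c s).
Proof.
rewrite /open_pg /closed_pg => h [] /andP[h1 h2] /andP[h3 h4] [] /andP[g1 g2] /andP[g3 g4] /andP[s0 s1].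
rewrite al_toward // be_toward //; split; nra.
Qed.
End Modulus.

Section Covers.
Variables (R : realType) (n : nat).
Hypothesis n_gt1 : (1 < n)%N.
Local Notation plane := (plane R).
Local Notation tile := (tile R n).
Implicit Types (t : tile) (z w : plane) (L A : seq tile).

(** The first clause counts tiles over every point, those on edges included. The second says that
    the boundary chain has no edge with both ends in the disc; arbitrary antisymmetric functions are
    allowed so that it also applies to sums along edge paths. *)
Definition covers (rho : R) L : Prop :=
  (forall z, modulus z < rho -> \sum_(t <- L) chi z t = 1) /\
  (forall Phi : plane -> plane -> R, antisym Phi ->
     (forall a b, modulus (b - a) = 1 -> rho <= modulus a -> Phi a b = 0) ->
     \sum_(t <- L) bd Phi t = 0).

Section Fixed.
Variables (rho : R) (L : seq tile).
Hypothesis cov : covers rho L.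

Lemma two_terms (f : tile -> R) t t' : (forall x, 0 <= f x) -> t \in L -> t' \in L -> t <> t' ->
  f t + f t' <= \sum_(x <- L) f x.
Proof.
move=> f0 tL t'L ne; rewrite (perm_big _ (perm_to_rem tL)) big_cons lerD2l.
have t'r : t' \in rem t L.
  have : t' \in t :: rem t L by rewrite -(perm_mem (perm_to_rem tL)).
  by rewrite inE => /orP[/eqP e|//]; case: ne.
by rewrite (perm_big _ (perm_to_rem t'r)) big_cons lerDl sumr_ge0.
Qed.

Lemma inside_unique t t' z : t \in L -> t' \in L -> modulus z < rho ->
  inside t z -> inside t' z -> t = t'.
Proof.
move=> tL t'L zr it it'; have [//|ne] := pselect (t = t').
have := two_terms (chi_ge0 n_gt1 z) tL t'L ne.
rewrite (proj1 cov z zr) !chi_inside // => h; exfalso; clear ne; lra.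
Qed.

Lemma covers_once t z : t \in L -> inside t z -> modulus z < rho -> (count_mem t L <= 1)%N.
Proof.
move=> tL it zr; rewrite (permP (perm_to_rem tL)) /= eqxx add1n ltnS leqn0.
apply/eqP/count_memPn/negP => tr.
have := proj1 cov z zr; rewrite (perm_big _ (perm_to_rem tL)) big_cons.
rewrite (perm_big _ (perm_to_rem tr)) big_cons chi_inside //.
move/eqP; rewrite gt_eqF // ltrDl; apply: ltr_pwDl => //.
by apply: sumr_ge0 => x _; exact: chi_ge0.
Qed.

Lemma center_ex t : exists c, inside t c.
Proof.
have h := tile_cross n_gt1 t.
exists (corner t + scale 2^-1 (side1 t) + scale 2^-1 (side2 t)).
by rewrite /inside /open_pg al_at // be_at //; lra.
Qed.

Lemma inside_toward t w c s : region t w -> inside t c -> 0 < s <= 1 -> inside t (toward w c s).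
Proof. by move=> /(regionP n_gt1); apply: toward_open; exact: tile_cross. Qed.

(** Points slightly off [w] towards [c] are inside [t'] by convexity and inside [t] by
    assumption. *)
Lemma meet_unique t t' w c : t \in L -> t' \in L -> modulus w < rho ->
  region t' w -> inside t' c ->
  (exists2 d, 0 < d & forall s, 0 < s < d -> inside t (toward w c s)) -> t = t'.
Proof.
move=> tL t'L wr rt' it' hin.
have [d1 d10 hd1] := toward_near w c (e := rho - modulus w) ltac:(lra).
have [d d0 hd] := ex_min2 (ex_intro2 _ _ d1 d10 hd1) hin.
pose s := Num.min d 1 / 2.
have m0 : 0 < Num.min d 1 by rewrite lt_min d0 ltr01.
have m1 : Num.min d 1 <= 1 by rewrite ge_min lexx orbT.
have m2 : Num.min d 1 <= d by rewrite ge_min lexx.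
have [h1 h2] : modulus (toward w c s - w) < rho - modulus w /\ inside t (toward w c s).
  by apply: hd; rewrite /s; lra.
apply: inside_unique h2 _ => //; last by apply: inside_toward => //; rewrite /s; lra.
by have := modulusD w (toward w c s - w); rewrite addrC subrK; lra.
Qed.

Lemma inside_region_unique t t' w : t \in L -> t' \in L -> modulus w < rho ->
  inside t w -> region t' w -> t = t'.
Proof.
move=> tL t'L wr it rt'; have [c hc] := center_ex t'.
apply: (meet_unique tL t'L wr rt' hc); case: it => h1 /andP[h2 h3].
by apply: open_toward => //; [exact: tile_cross|left].
Qed.

(** A point inside [t] close to [w] is still in the support of [Q], and the tile of [Q] containing
    it can only be [t]. *)
Lemma support_tile (Q : set tile) t w : (forall x, Q x -> x \in L) -> t \in L ->
  modulus w < rho -> region t w -> interior (support Q) w -> Q t.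
Proof.
move=> QL tL wr rt; have [c hc] := center_ex t => /(@nbhs_toward _ _ c) hn.
have [d1 d10 hd1] := toward_near w c (e := rho - modulus w) ltac:(lra).
have [d d0 hd] := ex_min2 (ex_intro2 _ _ d1 d10 hd1) hn.
pose s := Num.min d 1 / 2.
have m0 : 0 < Num.min d 1 by rewrite lt_min d0 ltr01.
have m1 : Num.min d 1 <= 1 by rewrite ge_min lexx orbT.
have m2 : Num.min d 1 <= d by rewrite ge_min lexx.
have [h1 [t' Qt' rt']] : modulus (toward w c s - w) < rho - modulus w /\ support Q (toward w c s).
  by apply: hd; rewrite /s; lra.
have -> // : t = t'.
apply: (@inside_region_unique _ _ (toward w c s)) => //; first exact: QL.
  by have := modulusD w (toward w c s - w); rewrite addrC subrK; lra.
by apply: inside_toward => //; rewrite /s; lra.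
Qed.

Lemma interiors_disjoint t t' : t \in L -> t' \in L -> t <> t' ->
  (forall w, region t w -> modulus w < rho) ->
  interior (region t) `&` interior (region t') = set0.
Proof.
move=> tL t'L ne hr; apply/seteqP; split=> // w [h1 h2]; apply: ne.
have rt := interior_subset h1.
apply: (@support_tile [set t'] t w) => //; first by move=> _ ->.
- exact: hr.
- by rewrite /support bigcup_set1.
Qed.

Lemma neighbour t a b : t \in L -> (a, b) \in dedges t -> modulus a < rho -> modulus b < rho ->
  exists2 t', t' \in L & (b, a) \in dedges t'.
Proof.
move=> tL abt ar br; have [//|none] := pselect (exists2 t', t' \in L & (b, a) \in dedges t').
pose Phi x y : R := ((x, y) == (a, b))%:R - ((x, y) == (b, a))%:R.
have aP : antisym Phi.
  by move=> x y; rewrite /Phi opprB !xpair_eqE; congr (_%:R - _%:R); rewrite andbC.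
have bdP t' : t' \in L -> bd Phi t' = \sum_(e <- dedges t') (e == (a, b))%:R.
  move=> t'L; apply: eq_big_seq => -[x y] /= xy; rewrite /Phi.
  have /negbTE-> : (x, y) != (b, a) by apply/eqP => e; apply: none; exists t'; rewrite -?e.
  by rewrite subr0.
have far x y : modulus (y - x) = 1 -> rho <= modulus x -> Phi x y = 0.
  move=> _ xr; rewrite /Phi !xpair_eqE.
  have /negbTE-> : x != a by apply: contraTneq xr => ->; rewrite -ltNge.
  have /negbTE-> : x != b by apply: contraTneq xr => ->; rewrite -ltNge.
  by rewrite subrr.
have := proj2 cov Phi aP far.
rewrite (eq_big_seq _ bdP) => /eqP; rewrite gt_eqF //.
rewrite (perm_big _ (perm_to_rem tL)) big_cons.
apply: ltr_pwDl; last by apply: sumr_ge0 => ? _; apply: sumr_ge0 => ? _.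
rewrite (perm_big _ (perm_to_rem abt)) big_cons eqxx.
by apply: ltr_pwDl => //; apply: sumr_ge0.
Qed.

Lemma dedge_modulus t a b : (a, b) \in dedges t -> modulus (b - a) = 1.
Proof. by move/(frame_edge n_gt1) => [v [[h _ _ _] _ _]]; apply: modulus1. Qed.

Lemma edge_point t w : region t w -> ~ inside t w -> ~ vertices t w ->
  exists a b v, [/\ (a, b) \in dedges t, frame t a (b - a) v, 0 < al a (b - a) v w < 1 &
    be a (b - a) v w = 0].
Proof.
move=> /(regionP n_gt1) [/andP[a0 a1] /andP[b0 b1]] nin nv.
have h := tile_cross n_gt1 t.
have f0 := frame0 n_gt1 t; have f1 := frame_rebase n_gt1 f0.
have f2 := frame_rebase n_gt1 f1; have f3 := frame_rebase n_gt1 f2.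
have h1 := lt0r_neq0 (rhomb_cross n_gt1 (let: And3 r _ _ := f1 in r)).
have h2 := lt0r_neq0 (rhomb_cross n_gt1 (let: And3 r _ _ := f2 in r)).
set p := corner t in nin nv f0 f1 f2 f3 a0 a1 b0 b1 *; set u := side1 t in h h1 h2 nin nv f0 f1 f2 f3 a0 a1 b0 b1 *.
set v := side2 t in h h1 h2 nin nv f0 f1 f2 f3 a0 a1 b0 b1 *.
have nvx : ~ ((al p u v w = 0 \/ al p u v w = 1) /\ (be p u v w = 0 \/ be p u v w = 1)).
  case=> ha hb; apply: nv; apply/verticesP; rewrite (pg_coords p w h).
  have bool_of (x : R) : x = 0 \/ x = 1 -> exists s : bool, x = s%:R.
    by case=> ->; [exists false|exists true].
  by have [s ->] := bool_of _ ha; have [s' ->] := bool_of _ hb; exists s, s'.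
have strict (x y : R) : 0 <= x <= 1 -> ~ ((x = 0 \/ x = 1) /\ (y = 0 \/ y = 1)) ->
    y = 0 \/ y = 1 -> 0 < x < 1.
  move=> /andP[x0 x1] nxy hy; rewrite !lt_neqAle x0 x1 !andbT.
  by apply/andP; split; apply/eqP => e; apply: nxy; split=> //; [left|right].
have D (x : R) : 0 <= x <= 1 -> [\/ x = 0, x = 1 | 0 < x < 1].
  move=> /andP[x0 x1]; have [->|n0] := eqVneq x 0; first by constructor 1.
  have [->|n1] := eqVneq x 1; first by constructor 2.
  by constructor 3; rewrite !lt_neqAle x0 x1 n1 eq_sym n0.
case: (D (be p u v w) (introT andP (conj b0 b1))) => hb.
- exists p, (p + u), v; rewrite addrAC subrr add0r; split=> //; first by rewrite !inE eqxx.
  by apply: strict nvx _; rewrite ?a0 // hb; left.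
- exists (p + u + v), (p + v), (- v).
  have -> : p + v - (p + u + v) = - u by apply: planeP; rewrite !coordE; ring.
  split=> //; first by rewrite !inE eqxx !orbT.
    rewrite (al_rebase (p + u) v (- u)) be_rebase //.
    have := strict _ _ (introT andP (conj a0 a1)) nvx (or_intror hb); lra.
  by rewrite (be_rebase (p + u)) // al_rebase hb subrr.
case: (D (al p u v w) (introT andP (conj a0 a1))) => ha.
- exists (p + v), p, (- - u).
  have e : p + v = p + u + v + - u by apply: planeP; rewrite !coordE; ring.
  have -> : p - (p + v) = - v by apply: planeP; rewrite !coordE; ring.
  split=> //; first by rewrite !inE eqxx !orbT.
  - by rewrite e.
  - by rewrite e (al_rebase (p + u + v)) be_rebase // al_rebase; lra.
  by rewrite e (be_rebase (p + u + v)) // (al_rebase (p + u)) be_rebase // ha; lra.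
- exists (p + u), (p + u + v), (- u).
  have -> : p + u + v - (p + u) = v by rewrite addrAC subrr add0r.
   split=> //; first by rewrite !inE eqxx !orbT.
  - by rewrite al_rebase.
  by rewrite be_rebase // ha subrr.
by case: nin; split.
Qed.
End Fixed.
End Covers.
End ListCovers.

(** * Edge-to-edge meetings *)

Module EdgeMeetings.
Import CyclicPeeling RingFilling RayCrossing ParallelogramWinding TileFrames ListCovers.
Import Order.TTheory GRing.Theory Num.Theory.
Import numFieldNormedType.Exports.
Local Open Scope classical_set_scope.
Local Open Scope ring_scope.

Lemma midpoint_bool (R : realType) (s r k : bool) :
  (1 - 1 / 2) * s%:R + 1 / 2 * r%:R = k%:R :> R -> s = r.
Proof. by case: s r k => -[] [] //= h; exfalso; move: h; rewrite ?mulr1 ?mulr0; lra. Qed.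

Section Meeting.
Variables (R : realType) (n : nat).
Hypothesis n_gt1 : (1 < n)%N.
Local Notation plane := (plane R).
Local Notation tile := (tile R n).
Implicit Types (t : tile) (z w : plane) (L A : seq tile).

Lemma affine_nonzero p u v (d o : plane) : cross u v != 0 -> d <> 0 ->
  exists c, open_pg p u v c /\ cross d (c - o) <> 0.
Proof.
move=> h d0; apply: contrapT => none.
pose c (s t : R) : plane := p + scale s u + scale t v.
have z (s t : R) : 0 < s < 1 -> 0 < t < 1 -> cross d (c s t - o) = 0.
  move=> hs ht; apply: contrapT => hz; apply: none; exists (c s t); split=> //.
  by rewrite /open_pg al_at // be_at.
have h1 : cross d (c (1/2) (1/2) - o) = 0 by apply: z; lra.
have h2 : cross d (c (3/4) (1/2) - o) = 0 by apply: z; lra.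
have h3 : cross d (c (1/2) (3/4) - o) = 0 by apply: z; lra.
have du : cross d u = 0.
  have E : cross d (c (3/4) (1/2) - o) - cross d (c (1/2) (1/2) - o) = 1 / 4 * cross d u.
    by rewrite /cross /c !coordE; field.
  by lra.
have dv : cross d v = 0.
  have E : cross d (c (1/2) (3/4) - o) - cross d (c (1/2) (1/2) - o) = 1 / 4 * cross d v.
    by rewrite /cross /c !coordE; field.
  by lra.
have e1 : cross u v * re d = 0.
  have -> : cross u v * re d = cross d v * re u - cross d u * re v by rewrite /cross; ring.
  by rewrite du dv; ring.
have e2 : cross u v * im d = 0.
  have -> : cross u v * im d = cross d v * im u - cross d u * im v by rewrite /cross; ring.
  by rewrite du dv; ring.
apply: d0; apply: planeP; rewrite coordE.
  by apply/eqP; move/eqP: e1; rewrite mulf_eq0 (negbTE h).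
by apply/eqP; move/eqP: e2; rewrite mulf_eq0 (negbTE h).
Qed.

Lemma be_frame p u v z : cross u v != 0 -> be p u v z * cross u v = cross u (z - p).
Proof. by move=> h; rewrite /be divfK. Qed.

Section Fixed.
Variables (rho : R) (L : seq tile).
Hypothesis cov : covers rho L.

(** [w] is within an edge of [t]. Moving from [w] towards a point inside [t'] off the line of this
    edge leads into [t] or into the neighbour across the edge; the first is impossible, so [t'] is
    that neighbour. *)
Lemma edge_meet t t' w : t \in L -> t' \in L -> t <> t' -> modulus w + 2 < rho ->
  region t w -> region t' w -> ~ vertices t w ->
  exists a b, (a, b) \in dedges t /\ (b, a) \in dedges t'.
Proof.
move=> tL t'L ne wr rt rt' nv.
have m0 := modulus_ge0 w.
have wr' : modulus w < rho by lra.
have nin : ~ inside t w by move=> it; apply: ne; apply: (inside_region_unique n_gt1 cov) it rt'.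
have [a [b [v [abt [rh cl op] ha hb]]]] := edge_point n_gt1 rt nin nv.
have h := lt0r_neq0 (rhomb_cross n_gt1 rh).
have m1 := dedge_modulus n_gt1 abt.
have wE : w = a + scale (al a (b - a) v w) (b - a).
  by rewrite {1}(pg_coords a w h) hb; apply: planeP; rewrite !coordE; ring.
have /andP[a0 a1] := ha.
have dw : modulus (w - a) = al a (b - a) v w.
  by rewrite {1}wE addrAC subrr add0r modulus_scale ?m1 ?mulr1 // ltW.
have ar' : modulus a < modulus w + 1.
  by have := modulusD w (a - w); rewrite addrC subrK modulusB dw; move: a1; clear ne; lra.
have ar : modulus a < rho by move: ar' wr; clear ne; lra.
have br : modulus b < rho.
  by have := modulusD a (b - a); rewrite addrC subrK m1; move: ar' wr; clear ne; lra.
have [t2 t2L bat2] := neighbour cov tL abt ar br.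
have [v2 [rh2 cl2 op2]] := frame_edge n_gt1 bat2.
have h2 := lt0r_neq0 (rhomb_cross n_gt1 rh2).
have d0 : b - a <> 0 by move=> e; move: m1; rewrite e modulus0; lra.
have [c [ic nc]] := affine_nonzero (corner t') a (tile_cross n_gt1 t') d0.
have [cpos|cneg] := ltP 0 (cross (b - a) (c - a)).
  case: ne.
  apply: (meet_unique n_gt1 cov tL t'L wr' rt' ic).
  have [d dd0 hd] : exists2 d, 0 < d & forall s, 0 < s < d -> open_pg a (b - a) v (toward w c s).
    apply: open_toward => //; first by rewrite hb.
    right; rewrite hb; split=> //.
    by rewrite -(pmulr_lgt0 _ (rhomb_cross n_gt1 rh)) be_frame.
  by exists d => // s /hd /op.
have {}cneg : cross (b - a) (c - a) < 0 by rewrite lt_neqAle cneg andbT; apply/eqP.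
have wE2 : w = b + scale (1 - al a (b - a) v w) (a - b) + scale 0 v2.
  by rewrite {1}wE; apply: planeP; rewrite !coordE; ring.
have al2 : al b (a - b) v2 w = 1 - al a (b - a) v w by rewrite {1}wE2 al_at.
have be2 : be b (a - b) v2 w = 0 by rewrite {1}wE2 be_at.
suff <- : t2 = t' by exists a, b.
apply: (meet_unique n_gt1 cov t2L t'L wr' rt' ic).
have [d dd0 hd] : exists2 d, 0 < d & forall s, 0 < s < d -> open_pg b (a - b) v2 (toward w c s).
  apply: open_toward; rewrite ?al2 ?be2 //; first by move: ha; clear ne; lra.
  right; split=> //.
  rewrite -(pmulr_lgt0 _ (rhomb_cross n_gt1 rh2)) be_frame //.
  have -> : cross (a - b) (c - b) = - cross (b - a) (c - a) by rewrite /cross !coordE; ring.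
  by rewrite oppr_gt0.
by exists d => // s /hd /op2.
Qed.

Lemma shared_edge t t' a b : (a, b) \in dedges t -> (b, a) \in dedges t' ->
  region t `&` region t' = segment a b.
Proof.
move=> /(frame_edge n_gt1)[v [rh cl _]] /(frame_edge n_gt1)[v2 [rh2 cl2 _]].
have p1 := rhomb_cross n_gt1 rh; have p2 := rhomb_cross n_gt1 rh2.
have h := lt0r_neq0 p1; have h2 := lt0r_neq0 p2.
apply/seteqP; split=> z.
  case=> /cl [ha /andP[hb _]] /cl2 [_ /andP[hb2 _]].
  have e : be a (b - a) v z * cross (b - a) v = - (be b (a - b) v2 z * cross (a - b) v2).
    by rewrite !be_frame // /cross !coordE; ring.
  have b0 : be a (b - a) v z = 0.
    have q1 := mulr_ge0 hb (ltW p1); have q2 := mulr_ge0 hb2 (ltW p2).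
    have : be a (b - a) v z * cross (b - a) v = 0 by move: e q1 q2; lra.
    by move/eqP; rewrite mulf_eq0 (negbTE h) orbF => /eqP.
  exists (al a (b - a) v z) => //; rewrite {1}(pg_coords a z h) b0.
  by apply: planeP; rewrite !coordE; ring.
case=> s hs ->; split.
  apply/cl; have -> : a + scale s (b - a) = a + scale s (b - a) + scale 0 v.
    by apply: planeP; rewrite !coordE; ring.
  by rewrite /closed_pg al_at // be_at //; split; rewrite ?lexx ?ler01.
apply/cl2; have -> : a + scale s (b - a) = b + scale (1 - s) (a - b) + scale 0 v2.
  by apply: planeP; rewrite !coordE; ring.
by rewrite /closed_pg al_at // be_at //; split; rewrite ?lexx ?ler01 //; move: hs; lra.
Qed.

Lemma region_midpoint t z w : region t z -> region t w -> region t (toward z w (1 / 2)).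
Proof.
move=> /(regionP n_gt1) [h1 h2] /(regionP n_gt1) [h3 h4]; apply/(regionP n_gt1).
have h := tile_cross n_gt1 t; rewrite /closed_pg al_toward // be_toward //.
by move: h1 h2 h3 h4; clear; split; lra.
Qed.

Lemma vertices_midpoint t z w : vertices t z -> vertices t w ->
  vertices t (toward z w (1 / 2)) -> z = w.
Proof.
have h := tile_cross n_gt1 t.
move=> /verticesP[s [s' ->]] /verticesP[r [r' ->]] /verticesP[k [k' e]].
have e1 := congr1 (al (corner t) (side1 t) (side2 t)) e.
have e2 := congr1 (be (corner t) (side1 t) (side2 t)) e.
move: e1 e2; rewrite al_toward // be_toward // !al_at // !be_at //.
by move=> /midpoint_bool <- /midpoint_bool <-.
Qed.

(** A common point that is not a vertex of both tiles yields a shared edge. Otherwise the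
    intersection consists of vertices and contains midpoints, but the midpoint of two different
    vertices of a rhombus is no vertex. *)
Lemma meet_edge_to_edge t t' : t \in L -> t' \in L -> t <> t' ->
  (forall w, region t w -> modulus w + 2 < rho) ->
  [\/ region t `&` region t' = set0,
      exists v, [/\ vertices t v, vertices t' v & region t `&` region t' = [set v]] |
      exists e, [/\ edges t e, edges t' e & region t `&` region t' = e]].
Proof.
move=> tL t'L ne hr.
have shared a b : (a, b) \in dedges t -> (b, a) \in dedges t' ->
    exists e, [/\ edges t e, edges t' e & region t `&` region t' = e].
  move=> h1 h2; exists (segment a b); split; last exact: shared_edge.
    by apply/edgesP; exists (a, b).
  by apply/edgesP; exists (b, a) => //; rewrite segmentC.
have [[w [rt [rt' nv]]]|none] :=
  pselect (exists w, region t w /\ region t' w /\ ~ (vertices t w /\ vertices t' w)).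
  constructor 3; have [v1|v1] := pselect (vertices t w).
    have v2 : ~ vertices t' w by tauto.
    have [a [b [h1 h2]]] := edge_meet t'L tL (nesym ne) (hr _ rt) rt' rt v2.
    exact: shared h2 h1.
  have [a [b [h1 h2]]] := edge_meet tL t'L ne (hr _ rt) rt rt' v1.
  exact: shared h1 h2.
have allv w : region t w -> region t' w -> vertices t w /\ vertices t' w.
  by move=> h1 h2; apply: contrapT => h3; apply: none; exists w.
have [->|/set0P[w [h1 h2]]] := eqVneq (region t `&` region t') set0; first by constructor 1.
constructor 2; exists w; have [v1 v2] := allv w h1 h2; split=> //.
apply/seteqP; split=> z; last by move=> ->.
case=> g1 g2; have [v3 v4] := allv z g1 g2; apply: (vertices_midpoint v3 v1).
by have [] := allv _ (region_midpoint g1 h1) (region_midpoint g2 h2).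
Qed.
End Fixed.

(** All conditions on patches follow from this invariant, which passes to images because tiles at
    the border of [A] have neighbours in the extension. *)
Definition extendable A : Prop := forall rho, exists r, covers rho (A ++ r).

Lemma region_modulus t w : region t w -> modulus w <= modulus (corner t) + 2.
Proof.
move/(regionP n_gt1) => [/andP[a0 a1] /andP[b0 b1]]; have h := tile_cross n_gt1 t.
have [r1 r2 _ _] := tile_rhomb n_gt1 t.
have m1 := modulus_scale (side1 t) a0; have m2 := modulus_scale (side2 t) b0.
rewrite (modulus1 r1) in m1; rewrite (modulus1 r2) in m2.
set p := corner t in a0 a1 b0 b1 m1 m2 *; set a := al _ _ _ _ in a0 a1 m1.
set b := be _ _ _ _ in b0 b1 m2.
have -> : w = p + scale a (side1 t) + scale b (side2 t) by exact: pg_coords.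
have := modulusD (p + scale a (side1 t)) (scale b (side2 t)).
by have := modulusD p (scale a (side1 t)); rewrite m1 m2; lra.
Qed.

(** A tile lies within 2 of its corner and [meet_edge_to_edge] asks for a margin of 2; the constant
    5 makes the inequality strict. *)
Definition reach A : R := \sum_(t <- A) modulus (corner t) + 5.

Lemma reach_ge t A : t \in A -> modulus (corner t) + 5 <= reach A.
Proof.
move=> tA; rewrite lerD2r (perm_big _ (perm_to_rem tA)) big_cons lerDl.
by apply: sumr_ge0 => x _; exact: modulus_ge0.
Qed.

Lemma reach_region t w A : t \in A -> region t w -> modulus w + 2 < reach A.
Proof. by move=> /reach_ge h1 /region_modulus h2; move: h1 h2; lra. Qed.

Lemma extendable_cat A : extendable A -> forall rho,
  exists L, covers rho L /\ {subset A <= L}.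
Proof. by move=> eA rho; have [r c] := eA rho; exists (A ++ r); split=> // t; rewrite mem_cat => ->. Qed.

Lemma extendable_uniq A : extendable A -> uniq A.
Proof.
move=> eA; have [r c] := eA (reach A); apply: count_mem_uniq => t.
have [tA|/count_memPn->//] := boolP (t \in A).
have [z hz] := center_ex n_gt1 t.
have := covers_once n_gt1 c (t := t) (z := z); rewrite mem_cat tA => /(_ isT hz).
have := reach_region tA (inside_region n_gt1 hz) => h1 /(_ ltac:(move: h1; lra)).
have : (0 < count_mem t A)%N by rewrite -has_count has_pred1.
by rewrite count_cat; lia.
Qed.

Lemma extendable_edge_to_edge A : extendable A -> edge_to_edge [set` A].
Proof.
move=> eA t t' /= tA t'A ne; have [L [c sub]] := extendable_cat eA (reach A).
apply: (meet_edge_to_edge c) => //; try exact: sub.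
by move=> w; apply: reach_region.
Qed.

Lemma extendable_disjoint A : extendable A -> disjoint_interiors [set` A].
Proof.
move=> eA t t' /= tA t'A ne; have [L [c sub]] := extendable_cat eA (reach A).
apply: (interiors_disjoint n_gt1 c) => //; try exact: sub.
by move=> w /(reach_region tA) h; move: h; lra.
Qed.

Lemma extendable_patch A : extendable A -> is_patch [set` A].
Proof.
move=> eA; split; [exact: finite_seq|exact: extendable_edge_to_edge|exact: extendable_disjoint].
Qed.
End Meeting.
End EdgeMeetings.

(** * The edge path stays in a thin diamond *)

Module WordDiamond.
Import CyclicPeeling ProfileFunction BoundaryEndpoints EdgeWord RingFilling RayCrossing ParallelogramWinding TileFrames ListCovers.
Import Order.TTheory GRing.Theory Num.Theory.
Local Open Scope ring_scope.

Lemma sum_subset (R : realType) (T : eqType) (f : T -> R) (s1 s2 : seq T) :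
  (forall x, x \in s2 -> 0 <= f x) -> uniq s1 -> {subset s1 <= s2} ->
  \sum_(x <- s1) f x <= \sum_(x <- s2) f x.
Proof.
elim: s1 s2 => [|x s1 IH] s2 f0 /=.
  by move=> _ _; rewrite big_nil big_seq; apply: sumr_ge0 => y /f0.
move=> /andP[xs us] sub; have xs2 : x \in s2 by apply: sub; rewrite mem_head.
rewrite big_cons (perm_big _ (perm_to_rem xs2)) big_cons lerD2l; apply: IH => //.
  by move=> y /mem_rem /f0.
move=> y ys; have : y \in x :: rem x s2.
  by rewrite -(perm_mem (perm_to_rem xs2)) sub // inE ys orbT.
by rewrite inE => /orP[/eqP e|//]; rewrite -e ys in xs.
Qed.

Section WordSum.
Variables (R : realType) (n : nat).
Hypothesis n_gt1 : (1 < n)%N.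
Local Notation plane := (plane R).
Local Notation U := (U R n).
Local Notation theta := (theta R n).

Definition steps (l : seq int) : plane := \sum_(a <- l) U a.

Lemma steps_cat l l' : steps (l ++ l') = steps l + steps l'.
Proof. exact: big_cat. Qed.

Lemma steps_rev l : steps (rev l) = steps l.
Proof. by rewrite /steps; apply: perm_big; rewrite perm_rev. Qed.

Lemma re_steps l : re (steps l) = \sum_(a <- l) re (U a).
Proof. by rewrite /steps; elim: l => [|a l IH]; rewrite ?big_nil // !big_cons reD IH. Qed.

(** This is tan (theta / 2), so diamonds on two adjacent edges of a tile fit into an angle theta. *)
Definition slope : R := sin theta / (1 + cos theta).

Lemma slope_den : 0 < 1 + cos theta.
Proof. by have := cos_theta_ge0 R n_gt1; lra. Qed.

Lemma slope_gt0 : 0 < slope.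
Proof. by rewrite divr_gt0 ?slope_den ?sin_theta_gt0. Qed.

Lemma cos_letter_ge0 a : - n%:Z < 2 * a < n%:Z -> 0 <= re (U a).
Proof.
move=> ha; rewrite reU.
have e : cos (a%:~R * theta) = cos ((absz a)%:R * theta).
  have [a0|a0] := leP 0 a; first by rewrite -[in LHS](gez0_abs a0).
  by rewrite -cosN -mulNr -rmorphN /= -(ltz0_abs a0).
rewrite e; have [->|a0] := posnP (absz a); first by rewrite mul0r cos0.
have h2 : (2 * absz a <= n)%N by lia.
by have [/andP[]] := cos_mul_bounds R n_gt1 a0 h2.
Qed.

Local Notation h := (map fst (half_word n)).
Definition letters : seq int := map fst (word n).

Lemma letters_half : letters = h ++ rev h.
Proof. by rewrite /letters /word map_cat map_rev -map_comp. Qed.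

Lemma half_re_ge0 a : a \in h -> 0 <= re (U a).
Proof.
by case/mapP=> -[b k]; rewrite mem_half_word // => /andP[hb _] -> /=; apply: cos_letter_ge0.
Qed.

Definition weight (i : nat) : R := if i == 0%N then 1 else 2 * cos (i%:R * theta).

(** The Dirichlet kernel in closed form: 1 + 2 cos theta + ... + 2 cos ((b-1) theta) + cos (b theta)
    = sin (b theta) cot (theta / 2), with denominators cleared. *)
Lemma dirichlet b : (0 < b)%N ->
  (\sum_(i < b) weight i + cos (b%:R * theta)) * sin theta =
  sin (b%:R * theta) * (1 + cos theta).
Proof.
elim: b => // -[|b] IH _; first by rewrite big_ord1 /weight /= mul1r mulrC.
have -> : b.+2%:R * theta = b.+1%:R * theta + theta.
  by rewrite -[b.+2]addn1 natrD mulrDl mul1r.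
rewrite big_ord_recr cosD sinD.
have -> : weight (@ord_max b.+1) = 2 * cos (b.+1%:R * theta) by [].
have := IH isT; have := cos2Dsin2 theta.
set S := \sum_(i < _) _; set c := cos (b.+1%:R * theta); set s := sin (b.+1%:R * theta).
set C := cos theta; set D := sin theta => h1 h2.
have -> : (S + 2 * c + (c * C - s * D)) * D = (S + c) * D + (c * D + c * C * D - s * (D * D)) by ring.
by rewrite h2; have -> : D * D = 1 - C * C by [move: h1; rewrite !expr2; lra]; ring.
Qed.

Lemma mirror_steps p : - n%:Z < 2 * p.1%:Z < n%:Z ->
  im (steps (map fst (mirror_pair p))) = 0 /\ re (steps (map fst (mirror_pair p))) = weight p.1.
Proof.
case: p => -[|b] k /= _; rewrite /mirror_pair /weight /=.
  by rewrite /steps big_seq1 reU imU mul0r sin0 cos0.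
rewrite /steps big_cons big_seq1 reD imD !reU !imU ?NegzE !rmorphN !mulNr cosN sinN -?pmulrn.
by split; ring.
Qed.

Lemma weight_ge0 b : (2 * b < n)%N -> 0 <= weight b.
Proof.
move=> hb; have [] := @mirror_steps (b, 0%N); first by rewrite /=; lia.
move=> _ /= <-; rewrite re_steps big_seq; apply: sumr_ge0 => a.
rewrite /mirror_pair /=; case: eqP => _ /=; rewrite !inE => ha; apply: cos_letter_ge0; lia.
Qed.

Lemma flatten_steps ps : {subset ps <= half_letters n} ->
  im (steps (map fst (flatten (map mirror_pair ps)))) = 0 /\
  re (steps (map fst (flatten (map mirror_pair ps)))) = \sum_(p <- ps) weight p.1.
Proof.
elim: ps => [|p ps IH] sub; first by rewrite /steps !big_nil.
have [|i1 r1] := IH; first by move=> q hq; apply: sub; rewrite inE hq orbT.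
have := sub p (mem_head _ _); case: p sub => b k sub; rewrite mem_half_letters // => /andP[hb _].
have [|i2 r2] := @mirror_steps (b, k); first by rewrite /=; lia.
by rewrite /= map_cat steps_cat big_cons reD imD i1 i2 r1 r2 addr0.
Qed.

Lemma flatten_prefix ps l1 l2 : map fst (flatten (map mirror_pair ps)) = l1 ++ l2 ->
  (exists ps1 ps2, ps = ps1 ++ ps2 /\ l1 = map fst (flatten (map mirror_pair ps1))) \/
  (exists ps1 b k ps2, [/\ ps = ps1 ++ (b, k) :: ps2, (0 < b)%N &
     l1 = rcons (map fst (flatten (map mirror_pair ps1))) b%:Z]).
Proof.
elim: ps l1 => [|[b k] ps IH] l1; first by case: l1 => // _; left; exists [::], [::].
have sub l1' : map fst (flatten (map mirror_pair ps)) = l1' ++ l2 ->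
    l1 = map fst (mirror_pair (b, k)) ++ l1' ->
  (exists ps1 ps2, (b, k) :: ps = ps1 ++ ps2 /\ l1 = map fst (flatten (map mirror_pair ps1))) \/
  (exists ps1 b' k' ps2, [/\ (b, k) :: ps = ps1 ++ (b', k') :: ps2, (0 < b')%N &
     l1 = rcons (map fst (flatten (map mirror_pair ps1))) b'%:Z]).
  move=> /IH[[ps1 [ps2 [-> ->]]]|[ps1 [c [j [ps2 [-> c0 ->]]]]]] ->.
    by left; exists ((b, k) :: ps1), ps2; rewrite /= map_cat.
  by right; exists ((b, k) :: ps1), c, j, ps2; rewrite /= map_cat rcons_cat.
rewrite /= map_cat; case: l1 sub => [|a l1] sub; first by left; exists [::], ((b, k) :: ps).
move: sub; rewrite /mirror_pair /=; case: eqP => [b0|b0] sub /=.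
  by case=> ea /sub; apply; rewrite -ea.
case: l1 sub => [|a' l1] sub /=.
  by case=> ea _; right; exists [::], b, k, ps; split=> //; [lia|rewrite /= -ea].
by case=> ea ea' /sub; apply; rewrite -ea -ea'.
Qed.

(** Between pairs the path is on its axis. Inside a pair of [b] it is at height sin (b theta), and
    by [position_lt] every smaller letter has already occurred together with its mirror image;
    [dirichlet] converts this into the bound. *)
Lemma half_prefix l1 l2 : h = l1 ++ l2 ->
  [/\ `|im (steps l1)| <= slope * re (steps l1), 0 <= re (steps l1) & 0 <= re (steps l2)].
Proof.
move=> e.
have r1 : 0 <= re (steps l1).
  by rewrite re_steps big_seq; apply: sumr_ge0 => a ha; apply: half_re_ge0; rewrite e mem_cat ha.
have r2 : 0 <= re (steps l2).
  by rewrite re_steps big_seq; apply: sumr_ge0 => a ha; apply: half_re_ge0; rewrite e mem_cat ha orbT.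
split=> //; have s0 := slope_gt0.
case: (flatten_prefix e) => [[ps1 [ps2 [hp ->]]]|[ps1 [b [k [ps2 [hp b0 l1E]]]]]].
  have [|i0 rE] := @flatten_steps ps1; first by move=> p; rewrite hp mem_cat => ->.
  rewrite i0 normr0 rE mulr_ge0 ?(ltW s0) // big_seq; apply: sumr_ge0 => -[b k] hb.
  have : (b, k) \in half_letters n by rewrite hp mem_cat hb.
  by rewrite mem_half_letters // => /andP[h1 _]; exact: weight_ge0.
have sub1 : {subset ps1 <= half_letters n} by move=> p; rewrite hp mem_cat => ->.
have [i0 rE] := flatten_steps sub1.
have bl : (b, k) \in half_letters n by rewrite hp mem_cat mem_head orbT.
have bn : (2 * b < n)%N by move: bl; rewrite mem_half_letters // => /andP[].
have bE : re (U b%:Z) = cos (b%:R * theta) by rewrite reU -pmulrn.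
have bE' : im (U b%:Z) = sin (b%:R * theta) by rewrite imU -pmulrn.
rewrite l1E -cats1 steps_cat {2 4}/steps big_seq1 imD reD i0 rE add0r bE bE'.
have sb0 : 0 <= sin (b%:R * theta).
  have [_ h1] := cos_mul_bounds R n_gt1 b0 (ltnW bn).
  by apply: le_trans h1; apply: ltW; exact: sin_theta_gt0.
rewrite ger0_norm //.
have subs : \sum_(i < b) weight i <= \sum_(p <- ps1) weight p.1.
  rewrite -(big_mkord xpredT weight) /index_iota subn0.
  have -> : \sum_(i <- iota 0 b) weight i = \sum_(p <- [seq (i, 0%N) | i <- iota 0 b]) weight p.1.
    by rewrite big_map.
  apply: sum_subset.
  - move=> [c j] /sub1; rewrite mem_half_letters // => /andP[hc _]; exact: weight_ge0.
  - by rewrite map_inj_uniq ?iota_uniq // => i j [].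
  - move=> p; case/mapP => i hi ->; move: hi; rewrite mem_iota add0n => /andP[_ ib].
    have il : (i, 0%N) \in half_letters n.
      rewrite mem_half_letters //; have hi : (2 * i < n)%N by lia.
      have m0 : 1 < mult n i%:Z by apply: mult_gt0 => //; lia.
      have := half_countP n_gt1 hi; rewrite hi; move: (half_count n i) (mult n i%:Z) m0.
      by clear; move=> c m m0 e; lia.
    move: il; rewrite hp mem_cat inE => /orP[//|/orP[/eqP[ib']|il]]; first by rewrite ib' ltnn in ib.
    have := half_letters_sorted n; rewrite hp pairwise_cat /= => /and3P[_ _ /andP[/allP srt _]].
    by have := srt _ il; rewrite /= leNgt (position_lt n_gt1 _ ib bn).
have := dirichlet b0; rewrite /slope => D; have d0 := slope_den.
rewrite mulrAC ler_pdivlMr // -D mulrC ler_pM2l ?sin_theta_gt0 //.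
by rewrite lerD2r.
Qed.

Definition inflation_factor : R := re (steps letters).

Lemma letters_steps : im (steps letters) = 0 /\ inflation_factor = 2 * re (steps h).
Proof.
rewrite /inflation_factor letters_half steps_cat steps_rev reD imD.
have [i0 _] := flatten_steps (fun p (hp : p \in half_letters n) => hp).
by rewrite -/(half_word n) in i0; rewrite i0; split; ring.
Qed.

(** Beyond the middle, the palindrome lets the rest of the path be read as a prefix from the other
    end of the edge. *)
Lemma word_prefix l1 l2 : letters = l1 ++ l2 ->
  `|im (steps l1)| <= slope * re (steps l1) /\
  `|im (steps l1)| <= slope * (inflation_factor - re (steps l1)).
Proof.
have s0 := slope_gt0; have [i0 lE] := letters_steps.
have [ih _] := flatten_steps (fun p (hp : p \in half_letters n) => hp).
rewrite -/(half_word n) in ih; rewrite letters_half => e.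
have [le|lt] := leqP (size l1) (size h).
  have e1 : h = l1 ++ drop (size l1) h.
    have := congr1 (take (size l1)) e; rewrite [RHS]take_size_cat // takel_cat // => e'.
    by rewrite -[in LHS](cat_take_drop (size l1) h) e'.
  have [h1 h2 h3] := half_prefix e1; split=> //; apply: le_trans h1 _.
  by rewrite ler_pM2l // lE e1 steps_cat reD; lra.
have e1 : l1 = h ++ drop (size h) l1.
  have := congr1 (take (size h)) e; rewrite take_size_cat // takel_cat ?(ltnW lt) // => e'.
  by rewrite -[in LHS](cat_take_drop (size h) l1) -e'.
set q := drop _ _ in e1; have e2 : rev h = q ++ l2.
  by move: e; rewrite e1 -catA => /eqP; rewrite eqseq_cat // eqxx => /eqP.
have e3 : h = rev l2 ++ rev q by rewrite -rev_cat -e2 revK.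
have [h1 h2 h3] := half_prefix e3.
have E : steps l1 = steps h + steps h - steps (rev l2).
  have hs : steps h = steps (rev l2) + steps (rev q) by rewrite -steps_cat -e3.
  by rewrite e1 steps_cat -addrA; congr (_ + _); rewrite hs addrAC subrr add0r steps_rev.
have -> : im (steps l1) = - im (steps (rev l2)) by rewrite E !coordE ih; ring.
have -> : re (steps l1) = inflation_factor - re (steps (rev l2)) by rewrite E !coordE lE; ring.
rewrite normrN; split; last by rewrite subKr.
apply: le_trans h1 _; rewrite ler_pM2l // lE e3 steps_cat reD; move: h2 h3; lra.
Qed.

Lemma inflation_factor_ge4 : 4 <= inflation_factor.
Proof.
have m4 : 4 <= mult n 0.
  by rewrite /mult mprof_small //; [rewrite /parab expr0n /= mulr0 subr0; nia|lia].
rewrite /inflation_factor re_steps /letters big_map.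
pose s4 : seq (int * int) := [:: (0, 0); (0, 1); (0, 2); (0, 3)].
have s4E : \sum_(p <- s4) re (U p.1) = 4.
  have e1 k : re (U (0 : int, k : int).1) = 1 by rewrite reU mul0r cos0.
  by rewrite !big_cons big_nil !e1; ring.
rewrite -{1}s4E; apply: sum_subset => //.
  by move=> [a k]; rewrite mem_word // => /andP[ha _]; apply: cos_letter_ge0.
by move=> p; rewrite !inE => /or4P[] /eqP->; rewrite mem_word //; apply/andP; split; lia.
Qed.
End WordSum.
End WordDiamond.

(** * The substitution and its action on chains *)

Module TileSubstitution.
Import CyclicPeeling ProfileFunction BoundaryEndpoints EdgeWord RingFilling RhombusInflation RayCrossing ParallelogramWinding TileFrames ListCovers EdgeMeetings WordDiamond.
Import Order.TTheory GRing.Theory Num.Theory.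
Local Open Scope ring_scope.

Section PathSums.
Variables (V : zmodType) (A : comNzRingType) (E : eqType) (u : E -> V).

Lemma psum_telescope (Phi : V -> V -> A) (f : V -> A) p s :
  (forall s1 e s2, s = s1 ++ e :: s2 ->
     Phi (p + \sum_(x <- s1) u x) (p + \sum_(x <- s1) u x + u e) =
     f (p + \sum_(x <- s1) u x + u e) - f (p + \sum_(x <- s1) u x)) ->
  psum u Phi p s = f (p + \sum_(x <- s) u x) - f p.
Proof.
elim: s p => [|e s IH] p h /=; first by rewrite big_nil addr0 subrr.
have := h [::] e s erefl; rewrite big_nil addr0 => ->.
rewrite IH; first by rewrite big_cons (addrA p); ring.
by move=> s1 e' s2 sE; have := h (e :: s1) e' s2; rewrite big_cons addrA; apply; rewrite sE.
Qed.

Lemma psum_zero (Phi : V -> V -> A) p s :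
  (forall s1 e s2, s = s1 ++ e :: s2 ->
     Phi (p + \sum_(x <- s1) u x) (p + \sum_(x <- s1) u x + u e) = 0) ->
  psum u Phi p s = 0.
Proof. by move=> h; rewrite (@psum_telescope _ (fun=> 0)) ?subrr // => *; rewrite h // subrr. Qed.

Lemma psum_rev (Phi : V -> V -> A) p s : antisym Phi ->
  psum (fun e => - u e) Phi (p + \sum_(e <- s) u e) (rev s) = - psum u Phi p s.
Proof.
move=> aP; elim: s p => [|e s IH] p; first by rewrite /= oppr0.
have rE : \sum_(i <- rev s) - u i = - \sum_(i <- s) u i.
  by rewrite sumrN; congr (- _); apply: perm_big; rewrite perm_rev.
rewrite rev_cons -cats1 psum_cat /= big_cons (addrA p) IH rE.
by rewrite !addrK addr0 (aP p); ring.
Qed.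

Lemma eq_psum (v : E -> V) (Phi : V -> V -> A) p s : u =1 v ->
  psum u Phi p s = psum v Phi p s.
Proof. by move=> uv; elim: s p => //= e s IH p; rewrite IH uv. Qed.
End PathSums.

Section Paths.
Variables (R : realType) (n : nat).
Hypothesis n_gt1 : (1 < n)%N.
Local Notation plane := (plane R).
Local Notation U := (U R n).
Local Notation tile := (tile R n).
Local Notation slope := (slope R n).
Local Notation letters := (letters n).
Local Notation lambda := (inflation_factor R n).
Implicit Types (Phi : plane -> plane -> R) (a b w z : plane) (t : tile).

Lemma lambda_gt0 : 0 < lambda.
Proof. by have := inflation_factor_ge4 R n_gt1; lra. Qed.

(** The action on functions of edges dual to the substitution of tiles, see [bd_subst_seq]. *)
Definition path Phi a b : R := psum (fun d => (b - a) * U d) Phi (scale lambda a) letters.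

Lemma sum_steps (c : plane) l : \sum_(d <- l) c * U d = c * steps R n l.
Proof. by rewrite /steps mulr_sumr. Qed.

Lemma path_end a b : scale lambda a + \sum_(d <- letters) (b - a) * U d = scale lambda b.
Proof.
rewrite sum_steps; have [i0 _] := letters_steps R n_gt1.
by apply: planeP; rewrite !coordE i0 /inflation_factor; ring.
Qed.

(** As the word is a palindrome, the path from [b] to [a] is the reversed path from [a] to [b];
    neighbours thus agree on their common edge path. *)
Lemma path_antisym Phi : antisym Phi -> antisym (path Phi).
Proof.
move=> aP a b; rewrite /path -(psum_rev _ _ _ aP) path_end.
by rewrite /letters word_letters_rev //; apply: eq_psum => d; rewrite -mulNr opprB.
Qed.

Lemma psum_motion (g : motion R) (u : int -> plane) Phi p s :
  psum u (fun a b => Phi (motion_fun g a) (motion_fun g b)) p s =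
  psum (fun d => rot g * u d) Phi (motion_fun g p) s.
Proof.
elim: s p => //= d s IH p; rewrite IH.
by have -> : motion_fun g (p + u d) = motion_fun g p + rot g * u d by rewrite /motion_fun mulrDr addrAC.
Qed.

Lemma path_motion (g : motion R) Phi a b :
  path (fun x y => Phi (motion_fun (motion_scale lambda g) x) (motion_fun (motion_scale lambda g) y)) a b =
  path Phi (motion_fun g a) (motion_fun g b).
Proof.
rewrite /path psum_motion.
have -> : motion_fun (motion_scale lambda g) (scale lambda a) = scale lambda (motion_fun g a).
  rewrite /motion_fun [rot (motion_scale _ _)]/= [trans (motion_scale _ _)]/=.
  by apply: planeP; rewrite !coordE; ring.
apply: eq_psum => d /=; rewrite mulrA; congr (_ * _).
by rewrite /motion_fun; apply: planeP; rewrite !coordE; ring.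
Qed.

Definition in_diamond a b w : Prop :=
  let X := dot (b - a) (w - a) in let Y := cross (b - a) (w - a) in
  `|Y| <= slope * X /\ `|Y| <= slope * (1 - X).

Lemma crossing_scale z a b : crossing (scale lambda z) (scale lambda a) (scale lambda b) = crossing z a b.
Proof.
have l0 := lambda_gt0.
have bE p : below (scale lambda z) (scale lambda p) = below z p.
  by rewrite /below !reZ ler_pM2l.
rewrite /crossing !bE.
have -> : cross (scale lambda b - scale lambda a) (scale lambda z - scale lambda a) =
    lambda ^+ 2 * cross (b - a) (z - a) by rewrite /cross !coordE; ring.
by rewrite pmulr_rgt0 ?pmulr_rlt0 ?exprn_gt0.
Qed.

(** One of the four lines bounding the diamond separates [w] from it, and the inflated path lies
    beyond the scaled line by [word_prefix]. By [crossing_half] only the ends of the path then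
    matter. *)
Lemma path_crossing a b w : dot (b - a) (b - a) = 1 -> ~ in_diamond a b w ->
  path (crossing (scale lambda w)) a b = crossing w a b.
Proof.
move=> w1 nd; have l0 := lambda_gt0; set z := scale lambda w.
suff : exists d o, cross d (z - o) < 0 /\
    forall l1 l2, letters = l1 ++ l2 -> 0 <= cross d (scale lambda a + (b - a) * steps R n l1 - o).
  case=> d [p0 [hz hp]].
  have pts l1 l2 : letters = l1 ++ l2 ->
      0 <= cross d (scale lambda a + \sum_(x <- l1) (b - a) * U x - p0).
    by rewrite sum_steps; exact: hp.
  pose f p := if 0 < re d then below z p else 0.
  have half p q : 0 <= cross d (p - p0) -> 0 <= cross d (q - p0) -> crossing z p q = f q - f p.
    by move=> h1 h2; rewrite (crossing_half h1 h2 hz) /f; case: ifP => _; rewrite ?subrr.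
  rewrite /path (@psum_telescope _ _ _ _ _ f); last first.
    move=> s1 e s2 sE; apply: half; first exact: pts sE.
    have := pts (rcons s1 e) s2; rewrite -cats1 big_cat big_seq1 addrA; apply.
    by rewrite sE -catA.
  rewrite path_end -half ?crossing_scale //.
    by have := pts [::] letters erefl; rewrite big_nil addr0.
  by have := pts letters [::] (esym (cats0 _)); rewrite path_end.
have [i0 _] := letters_steps R n_gt1.
have E0 d0 (l1 : seq int) : cross ((b - a) * d0) (scale lambda a + (b - a) * steps R n l1 - scale lambda a) =
    cross d0 (steps R n l1).
  by rewrite addrAC subrr add0r crossM w1 mul1r.
have E1 d0 (l1 : seq int) : cross ((b - a) * d0) (scale lambda a + (b - a) * steps R n l1 - scale lambda b) =
    cross d0 (steps R n l1 - scale lambda 1).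
  have -> : scale lambda a + (b - a) * steps R n l1 - scale lambda b =
      (b - a) * (steps R n l1 - scale lambda 1) by apply: planeP; rewrite !coordE; ring.
  by rewrite crossM w1 mul1r.
set X := dot (b - a) (w - a); set Y := cross (b - a) (w - a).
have dE : re (b - a) * re (b - a) + im (b - a) * im (b - a) = 1 by [].
have F0 d0 : cross ((b - a) * d0) (z - scale lambda a) = lambda * (re d0 * Y - im d0 * X).
  by rewrite /z /X /Y /cross /dot !coordE; ring.
have F1 d0 : cross ((b - a) * d0) (z - scale lambda b) = lambda * (re d0 * Y - im d0 * (X - 1)).
  have -> : X - 1 = dot (b - a) (w - b).
    by rewrite -w1 /X /dot !coordE; ring.
  by rewrite /z /Y /cross /dot !coordE; ring.
have cs := @word_prefix R n n_gt1.
(* The four cases are the sides of the diamond, two through each end of the edge. *)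
have [h1|h1] := ltP (slope * X) Y.
  exists ((b - a) * Complex (-1) (- slope)), (scale lambda a); split.
    by rewrite F0 pmulr_rlt0 // /re /im /=; lra.
  move=> l1 l2 /cs[+ _]; rewrite E0 /cross /re /im /=; rewrite ler_norml => /andP[]; lra.
have [h2|h2] := ltP Y (- (slope * X)).
  exists ((b - a) * Complex 1 (- slope)), (scale lambda a); split.
    by rewrite F0 pmulr_rlt0 // /re /im /=; lra.
  move=> l1 l2 /cs[+ _]; rewrite E0 /cross /re /im /=; rewrite ler_norml => /andP[]; lra.
have [h3|h3] := ltP (slope * (1 - X)) Y.
  exists ((b - a) * Complex (-1) slope), (scale lambda b); split.
    by rewrite F1 pmulr_rlt0 // /re /im /=; lra.
  move=> l1 l2 /cs[_ +]; rewrite E1 /cross reD imD reN imN reZ imZ re1 im1 ler_norml => /andP[].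
  by rewrite {2 4}/re {2 4}/im /=; lra.
have [h4|h4] := ltP Y (- (slope * (1 - X))).
  exists ((b - a) * Complex 1 slope), (scale lambda b); split.
    by rewrite F1 pmulr_rlt0 // /re /im /=; lra.
  move=> l1 l2 /cs[_ +]; rewrite E1 /cross reD imD reN imN reZ imZ re1 im1 ler_norml => /andP[].
  by rewrite {2 4}/re {2 4}/im /=; lra.
case: nd; rewrite /in_diamond -/X -/Y !ler_norml; split; apply/andP; split; lra.
Qed.

(** The inflated path stays within 2 lambda of its start, where [Phi] vanishes on its steps. *)
Lemma path_zero Phi a b (r : R) : dot (b - a) (b - a) = 1 ->
  (forall p q, modulus (q - p) = 1 -> lambda * (r - 2) <= modulus p -> Phi p q = 0) ->
  r <= modulus a -> path Phi a b = 0.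
Proof.
move=> w1 hPhi ra; have l0 := lambda_gt0; apply: psum_zero => s1 e s2 sE.
have m1 := modulus1 w1.
apply: hPhi.
  rewrite addrAC subrr add0r modulusM m1 mul1r; apply: modulus1.
  by rewrite /dot -/(dot _ _) /dot reU imU -!expr2 cos2Dsin2.
rewrite sum_steps; set S := steps R n s1.
have [c1 c2] := @word_prefix R n n_gt1 s1 (e :: s2) sE.
have s0 := slope_gt0 R n_gt1.
have sl1 : slope <= 1.
  rewrite ler_pdivrMr ?slope_den // mul1r.
  by have := cos_theta_ge0 R n_gt1; have := sin_le1 (theta R n); lra.
have re0 : 0 <= re S.
  by rewrite -(pmulr_rge0 _ s0); apply: le_trans c1; exact: normr_ge0.
have re1 : re S <= lambda.
  by rewrite -subr_ge0 -(pmulr_rge0 _ s0); apply: le_trans c2; exact: normr_ge0.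
have imb : `|im S| <= lambda.
  apply: le_trans c1 _; have : slope * re S <= 1 * re S by rewrite ler_wpM2r.
  by rewrite mul1r; lra.
have mS : modulus S <= 2 * lambda.
  rewrite -[leRHS]ger0_norm; last by lra.
  rewrite -sqrtr_sqr; apply: ler_wsqrtr.
  have : `|im S| ^+ 2 <= lambda ^+ 2 by rewrite ler_sqr ?nnegrE // ltW.
  have : re S ^+ 2 <= lambda ^+ 2 by rewrite ler_sqr ?nnegrE // ltW.
  by rewrite real_normK ?num_real // /dot -!expr2 exprMn; have := sqr_ge0 lambda; lra.
have E1 : scale lambda a = scale lambda a + (b - a) * S - (b - a) * S by rewrite addrK.
have := modulusD (scale lambda a + (b - a) * S) (- ((b - a) * S)).
rewrite -E1 modulusN modulusM m1 mul1r (modulus_scale _ (ltW l0)) => h.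
have : lambda * r <= lambda * modulus a by rewrite ler_pM2l.
by move: h mS; lra.
Qed.

Lemma U_norm d : `|U d : plane| == 1.
Proof.
rewrite normE (@modulus1 _ (U d)) ?rmorph1 //.
by rewrite /dot reU imU -!expr2 cos2Dsin2.
Qed.

Lemma half_gt0 : (0 < n./2)%N. Proof. by lia. Qed.

Definition proto_of (k : nat) : proto n := insubd (Ordinal half_gt0) k.

Lemma proto_ofE k : (2 * k.+1 <= n)%N -> proto_of k = k :> nat.
Proof. by move=> h; rewrite val_insubd ifT //; lia. Qed.

(* The rhombus with corner q and sides U c, U c' is a copy of the prototile of
   angle |c' - c| or of its supplement. *)
Definition rhomb_tile (r : plane * int * int) : tile :=
  let: (q, c, c') := r in
  let y := absz (residue n (c' - c)) in
  if (2 * y <= n)%N then Tile (proto_of y.-1) (Motion q (U_norm c))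
  else Tile (proto_of (n - y).-1) (Motion (q + U c) (U_norm c')).

(** For an obtuse angle the prototile of the supplementary angle is placed at the next corner, which
    is the same quadrilateral by [quad_rebase]. *)
Lemma bd_rhomb_tile Phi r : 0 < residue n (r.2 - r.1.2) < n%:Z ->
  bd Phi (rhomb_tile r) = quad U Phi r.
Proof.
case: r => -[q c] c' /=; set y := residue _ _ => hy.
have cE : U c' = U c * U y by rewrite UM (antiperiodic_residue n_gt1 (UD R n_gt1)).
have yE : (absz y)%:Z = y by rewrite gez0_abs //; lia.
rewrite bdE /quad -/(quad id Phi (q, U c, U c')) /rhomb_tile -/y; case: ifP => hy2.
  rewrite /corner /side1 /side2 /= proto_sideE proto_ofE ?prednK //; try lia.
  by rewrite yE -cE.
rewrite /corner /side1 /side2 /= proto_sideE proto_ofE ?prednK //; try lia.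
have -> : U c' * U (n - absz y)%N%:Z = - U c.
  rewrite UM -(UD R n_gt1) -[in RHS](antiperiodic_residue n_gt1 (UD R n_gt1) (c + n%:Z) c').
  rewrite -[in LHS](antiperiodic_residue n_gt1 (UD R n_gt1) (c' + (n - absz y)%N%:Z) c').
  have [k [hk _]] := residue_spec n_gt1 (c' - c).
  rewrite !(antiperiodic_residue n_gt1 (UD R n_gt1)).
  rewrite -[RHS](antiperiodic_mod (UD R n_gt1) _ k); congr U.
  by rewrite -/y in hk; rewrite -subzn; lia.
exact: quad_rebase.
Qed.

Lemma motion_eq (g h : motion R) : rot g = rot h -> trans g = trans h -> g = h.
Proof.
case: g h => [r t p] [r' t' p'] /= e1 e2; subst r' t'; congr Motion; exact: bool_irrelevance.
Qed.

Lemma bd_move (g : motion R) Phi t :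
  bd Phi (move_tile g t) = bd (fun a b => Phi (motion_fun g a) (motion_fun g b)) t.
Proof.
rewrite !bdE /quad /corner /side1 /side2 /move_tile /=.
have fE p v : motion_fun g (p + v) = motion_fun g p + rot g * v.
  by rewrite /motion_fun mulrDr addrAC.
by rewrite !fE /motion_fun !mulrA.
Qed.

Definition inflation_spec (T : proto n) (tl : seq (plane * int * int)) : Prop :=
  [/\ all (fun r => 0 < residue n (r.2 - r.1.2) < n%:Z) tl, (0, 0, T.+1%:Z) \in tl,
      (exists p : plane, forall c : nat, (c < 2 * n)%N -> (p, c%:Z + 1, c%:Z + 2) \in tl) &
      (forall Phi, antisym Phi ->
        psum (U \o dir n T.+1) Phi 0 (boundary n) = \sum_(r <- tl) quad U Phi r)].

Lemma inflation_ex (T : proto n) : exists tl, inflation_spec T tl.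
Proof.
have hT : (0 < T.+1 < n)%N by have := ltn_ord T; lia.
by have [tl [h1 h2 h3] h4] := inflation n_gt1 hT R (UD R n_gt1); exists tl.
Qed.

Definition om (T : proto n) : seq tile := map rhomb_tile (projT1 (cid (inflation_ex T))).

Lemma tile_path Phi (T : proto n) :
  psum (U \o dir n T.+1) Phi 0 (boundary n) = bd (path Phi) (proto_tile R T).
Proof.
have sideE q (p : plane) : psum (U \o dir n T.+1) Phi p [seq (q, x.1, x.2) | x <- word n] =
    psum (fun d => U (side_dir n T.+1 q) * U d) Phi p letters.
  rewrite psum_map [RHS]psum_map /letters -!map_comp; congr (psum _ _ _ _).
  by apply: eq_map => -[d k] /=; rewrite UM.
have sumE q : \sum_(e <- [seq (q, x.1, x.2) | x <- word n]) (U \o dir n T.+1) e =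
    \sum_(d <- letters) U (side_dir n T.+1 q) * U d.
  by rewrite !big_map; apply: eq_bigr => -[d k] _ /=; rewrite UM.
pose g q : seq endpoint := [seq (q, x.1, x.2) | x <- word n].
have -> : boundary n = g 0%N ++ g 1%N ++ g 2 ++ g 3 ++ [::] by [].
rewrite !psum_cat !sumE !sideE [psum _ _ _ [::]]/= addr0.
rewrite /bd /dedges /corner /side1 /side2 !big_cons big_nil /= mul1r proto_sideE.
have u0 : U (side_dir n T.+1 0) = 0 + 1 - 0 by rewrite /side_dir /= U0 add0r subr0.
have u1 : U (side_dir n T.+1 1) = 0 + 1 + U T.+1%:Z - (0 + 1).
  by rewrite /side_dir /= addrAC subrr add0r.
have u2 : U (side_dir n T.+1 2) = 0 + U T.+1%:Z - (0 + 1 + U T.+1%:Z).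
  have -> : U (side_dir n T.+1 2) = - 1 by rewrite /side_dir /= -[n%:Z]add0r UD // U0.
  by rewrite !add0r opprD addrCA subrr addr0.
have u3 : U (side_dir n T.+1 3) = 0 - (0 + U T.+1%:Z).
  by rewrite /side_dir /= addrC UD // !add0r.
have z0 : scale lambda 0 = (0 : plane) by rewrite /scale mulr0.
have e0 := path_end 0 (0 + 1); rewrite z0 in e0.
by rewrite [in LHS]u0 [in LHS]u1 [in LHS]u2 [in LHS]u3 e0 !path_end /path z0 !addr0.
Qed.

Lemma bd_om Phi (T : proto n) : antisym Phi ->
  \sum_(s <- om T) bd Phi s = bd (path Phi) (proto_tile R T).
Proof.
move=> aP; rewrite /om; case: cid => tl /= [gd _ _ h]; rewrite big_map -tile_path h //.
by apply: eq_big_seq => r rt; rewrite bd_rhomb_tile //; move/allP: gd; apply.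
Qed.

Definition subst_seq (t : tile) : seq tile :=
  map (move_tile (motion_scale lambda (tmotion t))) (om (tproto t)).

Lemma bd_subst_seq Phi t : antisym Phi -> \sum_(s <- subst_seq t) bd Phi s = bd (path Phi) t.
Proof.
move=> aP; rewrite /subst_seq big_map; under eq_bigr do rewrite bd_move.
rewrite bd_om; last by move=> a b; exact: aP.
have <- : move_tile (tmotion t) (proto_tile R (tproto t)) = t.
  by case: t => T g; congr Tile; apply: motion_eq; rewrite /= ?mulr1 ?mulr0 ?add0r.
rewrite bd_move /bd; apply: eq_bigr => e _; rewrite path_motion.
by have -> : tmotion (move_tile (tmotion t) (proto_tile R (tproto t))) = tmotion t by
  apply: motion_eq; rewrite /= ?mulr1 ?mulr0 ?add0r.
Qed.

Lemma proto_tile_om (T : proto n) : proto_tile R T \in om T.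
Proof.
rewrite /om; case: cid => tl /= [_ h _ _]; apply/mapP; exists (0, 0, T.+1%:Z) => //.
have hT := tproto_bound n_gt1 T.
have r0 : residue n (T.+1%:Z - 0) = T.+1%:Z.
  have hr : 0 <= T.+1%:Z < 2 * n%:Z by lia.
  by have := residue_small 0 hr; rewrite mulr0 addr0 ?subr0.
rewrite /rhomb_tile r0 absz_nat hT; congr Tile; first by apply: val_inj; rewrite /= proto_ofE.
by apply: motion_eq; rewrite //= U0.
Qed.

Definition star_tile (p : plane) (c : int) : tile := Tile (proto_of 0) (Motion p (U_norm c)).

Lemma star_om (T : proto n) : exists p, forall c : nat, (c < 2 * n)%N ->
  star_tile p (c%:Z + 1) \in om T.
Proof.
rewrite /om; case: cid => tl /= [_ _ [p h] _]; exists p => c /h hc.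
apply/mapP; exists (p, c%:Z + 1, c%:Z + 2) => //.
have r0 : residue n (c%:Z + 2 - (c%:Z + 1)) = 1.
  have hr : 0 <= (1 : int) < 2 * n%:Z by lia.
  rewrite (_ : c%:Z + 2 - (c%:Z + 1) = 1); last by ring.
  by have := residue_small 0 hr; rewrite mulr0 addr0.
by rewrite /rhomb_tile r0 /= ifT //; lia.
Qed.
End Paths.
End TileSubstitution.

(** * Images of covering lists have no gaps *)

Module SubstitutionGaps.
Import CyclicPeeling RingFilling RayCrossing ParallelogramWinding TileFrames ListCovers EdgeMeetings WordDiamond TileSubstitution.
Import Order.TTheory GRing.Theory Num.Theory.
Local Open Scope classical_set_scope.
Local Open Scope ring_scope.

Section Stability.
Variables (R : realType) (n : nat).
Hypothesis n_gt1 : (1 < n)%N.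
Local Notation plane := (plane R).
Local Notation tile := (tile R n).
Local Notation lambda := (inflation_factor R n).
Local Notation slope := (slope R n).
Local Notation om := (om R n_gt1).
Local Notation subst_seq := (@subst_seq R n n_gt1).
Implicit Types (Phi : plane -> plane -> R) (a b w z : plane) (t : tile) (L A : seq tile).

Lemma covers_perm rho L L' : perm_eq L L' -> covers rho L -> covers rho L'.
Proof.
move=> pL [c1 c2]; split=> [z zr|Phi aP h]; first by rewrite -(perm_big _ pL) c1.
by rewrite -(perm_big _ pL) c2.
Qed.

Lemma covers_mono rho rho' L : rho' <= rho -> covers rho L -> covers rho' L.
Proof.
move=> le [c1 c2]; split=> [z zr|Phi aP h]; first exact: c1 (lt_le_trans zr le).
by apply: c2 => // a b ab ra; apply: h => //; exact: le_trans le ra.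
Qed.

Definition subst_list A := flatten (map subst_seq A).

Lemma sum_subst_list Phi L : antisym Phi ->
  \sum_(s <- subst_list L) bd Phi s = \sum_(t <- L) bd (path n Phi) t.
Proof.
move=> aP; rewrite /subst_list big_flatten /= big_map.
by apply: eq_bigr => t _; exact: bd_subst_seq.
Qed.

Lemma unit_dot a b : modulus (b - a) = 1 -> dot (b - a) (b - a) = 1.
Proof.
by move=> m1; rewrite -[LHS](sqr_sqrtr (dot_ge0 (b - a))) -/(modulus _) m1 expr1n.
Qed.

Lemma slope_le1 : slope <= 1.
Proof.
rewrite ler_pdivrMr ?slope_den // mul1r.
by have := cos_theta_ge0 R n_gt1; have := sin_le1 (theta R n); lra.
Qed.

Lemma diamond_bounds a b w : in_diamond n a b w ->
  0 <= dot (b - a) (w - a) <= 1 /\ `|cross (b - a) (w - a)| <= slope / 2.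
Proof.
rewrite /in_diamond /=; set X := dot _ _; set Y := cross _ _ => -[h1 h2].
have s0 := slope_gt0 R n_gt1; have y0 := normr_ge0 Y.
have x0 : 0 <= X by rewrite -(pmulr_rge0 _ s0) (le_trans y0 h1).
have x1 : 0 <= 1 - X by rewrite -(pmulr_rge0 _ s0) (le_trans y0 h2).
by split; lra.
Qed.

Lemma decompose (u w : plane) : dot u u = 1 ->
  w = scale (dot u w) u + scale (cross u w) (u * Complex 0 1).
Proof.
rewrite /dot => h; apply: planeP; rewrite /cross !coordE [re (Complex _ _)]/= [im (Complex _ _)]/=.
  by transitivity ((re u * re u + im u * im u) * re w); [rewrite h mul1r|ring].
by transitivity ((re u * re u + im u * im u) * im w); [rewrite h mul1r|ring].
Qed.

Lemma diamond_near a b w : dot (b - a) (b - a) = 1 -> in_diamond n a b w ->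
  modulus (w - a) <= 2.
Proof.
move=> h1 /diamond_bounds[/andP[x0 x1] y1]; have s1 := slope_le1.
rewrite (decompose (w - a) h1); apply: le_trans (modulusD _ _) _.
have mi (s : R) (u : plane) : dot u u = 1 -> modulus (scale s u) = `|s|.
  move=> hu; rewrite /modulus (_ : dot _ _ = s ^+ 2 * dot u u); last by rewrite /dot !coordE; ring.
  by rewrite hu mulr1 sqrtr_sqr.
rewrite !mi //; first by rewrite (ger0_norm x0); lra.
by rewrite dotM h1 mul1r /dot /re /im /=; ring.
Qed.

(** Winding over z = lambda w differs from winding over [w] by the chain sum of [Psi], which
    vanishes on edges whose diamond misses [w], hence outside the disc, so the second clause of
    [covers] applies. That clause passes on by [path_zero]. The loss of 2 allows for the extent of a
    diamond and of an edge path. *)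
Lemma covers_subst rho L : covers rho L -> covers (lambda * (rho - 2)) (subst_list L).
Proof.
move=> [c1 c2]; have l0 := lambda_gt0 R n_gt1; split=> [z zr|Phi aP h].
  rewrite (sum_subst_list _ (crossing_antisym z)).
  pose w := scale lambda^-1 z.
  have zE : z = scale lambda w.
    by apply: planeP; rewrite /w !coordE mulrA divff ?gt_eqF // mul1r.
  have wr : modulus w < rho - 2.
    by move: zr; rewrite zE modulus_scale ?ltW // ltr_pM2l.
  pose Psi a b := path n (crossing z) a b - crossing w a b.
  have Psi_antisym : antisym Psi.
    move=> a b; rewrite /Psi (path_antisym n_gt1 (crossing_antisym z) a) (crossing_antisym w a).
    by ring.
  have Psi0 : \sum_(t <- L) bd Psi t = 0.
    apply: c2 => // a b /unit_dot ab ra; apply/eqP; rewrite subr_eq0; apply/eqP.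
    rewrite zE; apply: path_crossing => // /(diamond_near ab) h.
    by have := modulusD (w) (a - w); rewrite addrC subrK modulusB; lra.
  have wr2 : modulus w < rho by lra.
  have split t : bd (path n (crossing z)) t = bd Psi t + chi w t.
    by rewrite /chi /bd -big_split /=; apply: eq_bigr => e _; rewrite /Psi subrK.
  by under eq_bigr do rewrite split; rewrite big_split /= Psi0 add0r c1.
rewrite (sum_subst_list _ aP); apply: c2; first exact: path_antisym.
by move=> a b /unit_dot ab ra; apply: path_zero ra.
Qed.

Lemma extendable_subst A : extendable A -> extendable (subst_list A).
Proof.
move=> eA rho; have [r c] := eA (`|rho| + 2); exists (subst_list r).
have -> : subst_list A ++ subst_list r = subst_list (A ++ r).
  by rewrite /subst_list map_cat flatten_cat.
apply: covers_mono (covers_subst c); rewrite addrK.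
have l4 := inflation_factor_ge4 R n_gt1; have a0 := normr_ge0 rho; have := ler_norm rho; nra.
Qed.

Lemma extendable_sub A A' : uniq A' -> {subset A' <= A} -> extendable A -> extendable A'.
Proof.
move=> uA' sub eA rho; have [r c] := eA rho; exists (seq.filter (predC (mem A')) A ++ r).
apply: covers_perm c; rewrite catA perm_cat2r perm_sym.
have p1 : perm_eq A' (seq.filter (mem A') A).
  apply: uniq_perm => //; first exact: filter_uniq (extendable_uniq n_gt1 eA).
  by move=> t; rewrite mem_filter /=; case: (boolP (t \in A')) => [/sub->|].
by rewrite -(permPr (permEl (perm_filterC (mem A') A))) perm_cat2r.
Qed.

Definition shift (v : plane) : motion R := Motion v (motion1_norm R).

Lemma shiftE v z : motion_fun (shift v) z = z + v.
Proof. by rewrite /motion_fun mul1r. Qed.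

Lemma crossing_shift z v a b : crossing z (a + v) (b + v) = crossing (z - v) a b.
Proof.
have bE p : below z (p + v) = below (z - v) p by rewrite /below !coordE lerBrDr.
rewrite /crossing !bE; have -> // : cross (b + v - (a + v)) (z - (a + v)) = cross (b - a) (z - v - a).
by rewrite /cross !coordE; ring.
Qed.

Lemma extendable_shift v A : extendable A -> extendable (map (move_tile (shift v)) A).
Proof.
move=> eA rho; have [r [c1 c2]] := eA (rho + modulus v); exists (map (move_tile (shift v)) r).
rewrite -map_cat; split=> [z zr|Phi aP h]; rewrite big_map; under eq_bigr do rewrite ?/chi bd_move.
  rewrite -[RHS](c1 (z - v)); last by have := modulusD z (- v); rewrite modulusN; lra.
  apply: eq_bigr => t _; rewrite /chi /bd; apply: eq_bigr => e _.
  by rewrite !shiftE crossing_shift.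
apply: c2 => [a b|a b ab ra]; first by rewrite aP.
rewrite !shiftE; apply: h; first by rewrite opprD addrACA subrr addr0.
by have := modulusD (a + v) (- v); rewrite addrK modulusN; lra.
Qed.

Lemma sum_nonzero (T : eqType) (f : T -> R) (s : seq T) : \sum_(x <- s) f x <> 0 ->
  exists2 x, x \in s & f x <> 0.
Proof.
move=> h; apply: contrapT => none; apply: h; rewrite big_seq big1 // => x xs.
by apply: contrapT => fx; apply: none; exists x.
Qed.

Section Diamonds.
Variables (t : tile) (a b w : plane).
Hypothesis abt : (a, b) \in dedges t.
Hypothesis dw : in_diamond n a b w.

Let num : exists v, [/\ frame t a (b - a) v,
  al a (b - a) v w = (dot (b - a) (w - a) * cross (b - a) v - cross (b - a) (w - a) * dot (b - a) v)
    / cross (b - a) v & be a (b - a) v w = cross (b - a) (w - a) / cross (b - a) v].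
Proof.
have [v f] := frame_edge n_gt1 abt; exists v; split=> //; congr (_ / _).
case: f => -[d1 _ _ _] _ _.
by transitivity (dot (b - a) (b - a) * cross (w - a) v); [rewrite d1 mul1r|rewrite /cross /dot; ring].
Qed.

(** The sides of the diamond make an angle theta/2 with the edge, and the angles of the tile are at
    least theta. *)
Lemma diamond_inside : 0 < cross (b - a) (w - a) -> inside t w.
Proof.
case: num => v [[rh _ op] alE beE] Y0; apply/op; rewrite /open_pg alE beE.
have s0 := rhomb_cross n_gt1 rh; case: rh => _ _ hs hc.
move: dw Y0; rewrite /in_diamond /slope /=; move: (dot (b - a) (w - a)) (cross (b - a) (w - a)).
move=> X Y [h1 h2] Y0; have S0 := sin_theta_gt0 R n_gt1; have C0 := cos_theta_ge0 R n_gt1.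
move: h1 h2; rewrite (gtr0_norm Y0) !(mulrAC _ _^-1) !ler_pdivlMr ?slope_den //.
move: s0 hs hc S0 C0; rewrite ler_norml.
move: (cross (b - a) v) (dot (b - a) v) (sin _) (cos _) => s c S C s0 hs /andP[hc1 hc2] S0 C0 h1 h2.
have X0 : 0 < X by rewrite -(pmulr_rgt0 _ S0); apply: lt_le_trans h1; rewrite mulr_gt0 //; lra.
have X1 : 0 < 1 - X by rewrite -(pmulr_rgt0 _ S0); apply: lt_le_trans h2; rewrite mulr_gt0 //; lra.
have e1 : Y * C < X * s.
  have : Y * C < S * X by have : Y * (1 + C) = Y + Y * C by [ring]; lra.
  by have : S * X <= s * X by [rewrite ler_pM2r]; rewrite (mulrC X); lra.
have e2 : Y * C < (1 - X) * s.
  have : Y * C < S * (1 - X) by have : Y * (1 + C) = Y + Y * C by [ring]; lra.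
  by have : S * (1 - X) <= s * (1 - X) by [rewrite ler_pM2r]; rewrite (mulrC (1 - X)); lra.
have e3 : Y * c <= Y * C by rewrite ler_pM2l.
have e4 : - (Y * C) <= Y * c by rewrite -mulrN ler_pM2l //; lra.
have e5 : 0 <= Y * C by rewrite mulr_ge0 // ltW.
rewrite !divr_gt0 ?ltr_pdivrMr //; last by lra.
have e6 : Y * (1 + C) = Y + Y * C by ring.
have e7 : (1 - X) * s = s - X * s by ring.
have e8 : S * (1 - X) = S - S * X by ring.
split; lra.
Qed.

Lemma diamond_region : 0 <= cross (b - a) (w - a) -> region t w.
Proof.
rewrite le_eqVlt => /orP[/eqP Y0|/diamond_inside/inside_region]; last by apply.
case: num => v [[rh cl _] alE beE]; apply/cl; rewrite /closed_pg alE beE -Y0 !mul0r subr0.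
have s0 := rhomb_cross n_gt1 rh; rewrite mulfK ?gt_eqF //.
by have [h _] := diamond_bounds dw; rewrite h lexx ler01.
Qed.
End Diamonds.

Section Gaps.
Variables (rho : R) (L : seq tile) (Q : set tile).
Hypothesis cov : covers rho L.
Hypothesis QL : forall t, Q t -> t \in L.
Let omega T := [set` om T].

Lemma parent z w : z = scale lambda w -> modulus w < rho - 2 ->
  exists t s, [/\ t \in L, s \in subst_seq t, region s z &
    region t w \/ exists a b, (a, b) \in dedges t /\ in_diamond n a b w].
Proof.
move=> zE wr; have l0 := lambda_gt0 R n_gt1; have [c1 c2] := covers_subst cov.
have zr : modulus z < lambda * (rho - 2) by rewrite zE modulus_scale ?ltW // ltr_pM2l.
have := c1 z zr; rewrite (sum_subst_list _ (crossing_antisym z)) => e1.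
have [t tL ht] : exists2 t, t \in L & bd (path n (crossing z)) t <> 0.
  by apply: sum_nonzero; rewrite e1; apply/eqP; exact: oner_neq0.
have := ht; rewrite -(bd_subst_seq n_gt1 t (crossing_antisym z)).
move=> /sum_nonzero[s st hs]; exists t, s; split=> //.
  by apply: contrapT => ns; apply: hs; exact: chi_out.
have [|nd] := pselect (exists a b, (a, b) \in dedges t /\ in_diamond n a b w); first by right.
left; apply: contrapT => nt; apply: ht; rewrite -(chi_out n_gt1 nt) /chi /bd.
apply: eq_big_seq => -[a b] abt; rewrite zE; apply: path_crossing => //.
  exact: unit_dot (dedge_modulus n_gt1 abt).
by move=> dab; apply: nd; exists a, b.
Qed.

Lemma support_subst t s z : Q t -> s \in subst_seq t -> region s z ->
  support (subst lambda omega Q) z.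
Proof.
move=> Qt /mapP[s' s'o ->] rs; exists (move_tile (motion_scale lambda (tmotion t)) s') => //.
by exists t => //; exists s'.
Qed.

Lemma edge_end_region t a b : (a, b) \in dedges t -> region t a.
Proof.
move=> abt; have [v [rh cl _]] := frame_edge n_gt1 abt; apply/cl.
have s0 := lt0r_neq0 (rhomb_cross n_gt1 rh).
have e : a = a + scale 0 (b - a) + scale 0 v by apply: planeP; rewrite !coordE; ring.
have e1 : al a (b - a) v a = 0 by rewrite {3}e al_at.
have e2 : be a (b - a) v a = 0 by rewrite {3}e be_at.
by rewrite /closed_pg e1 e2 lexx ler01.
Qed.

(** If the parent [t0] does not contain [w], then [w] is in a diamond across an edge of [t0], and
    the neighbour across this edge is [t]. The ends of the edge belong to [t], hence to the interior
    of the support, which puts [t0] into [Q]. *)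
Lemma no_gap t w : Q t -> region t w -> region t `<=` interior (support Q) ->
  modulus w + 5 < rho -> support (subst lambda omega Q) (scale lambda w).
Proof.
move=> Qt rt tQ wr; have m0 := modulus_ge0 w.
have [t0 [s [t0L st0 rs [rt0|[a [b [abt dab]]]]]]] := @parent _ w erefl ltac:(lra).
  apply: support_subst st0 rs; apply: (support_tile n_gt1 cov QL t0L _ rt0); first by lra.
  exact: tQ.
have m1 := dedge_modulus n_gt1 abt; have near := diamond_near (unit_dot m1) dab.
have ar : modulus a < rho - 2.
  by have := modulusD w (a - w); rewrite addrC subrK modulusB; lra.
have br : modulus b < rho by have := modulusD a (b - a); rewrite addrC subrK m1; lra.
have [Y0|Y0] := leP 0 (cross (b - a) (w - a)).
  have rt0 := diamond_region abt dab Y0.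
  apply: support_subst st0 rs; apply: (support_tile n_gt1 cov QL t0L _ rt0); first by lra.
  exact: tQ.
have ar' : modulus a < rho by lra.
have [t1 t1L bat1] := neighbour cov t0L abt ar' br.
have dba : in_diamond n b a w.
  have d1 := unit_dot m1.
  have eX : dot (a - b) (w - b) = 1 - dot (b - a) (w - a) by rewrite -d1 /dot !coordE; ring.
  have eY : cross (a - b) (w - b) = - cross (b - a) (w - a) by rewrite /cross !coordE; ring.
  by case: dab => h1 h2; rewrite /in_diamond eX eY normrN; split=> //; rewrite subKr.
have it1 : inside t1 w.
  apply: (diamond_inside bat1 dba).
  have -> : cross (a - b) (w - b) = - cross (b - a) (w - a) by rewrite /cross !coordE; ring.
  by rewrite oppr_gt0.
have e1 : t1 = t by apply: (inside_region_unique n_gt1 cov t1L (QL Qt) _ it1 rt); lra.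
apply: support_subst st0 rs.
apply: (support_tile n_gt1 cov QL t0L ar' (edge_end_region abt)).
apply: tQ; rewrite -e1.
have [v [rh cl _]] := frame_edge n_gt1 bat1; apply/cl.
have s0 := lt0r_neq0 (rhomb_cross n_gt1 rh).
have e : a = b + scale 1 (a - b) + scale 0 v by apply: planeP; rewrite !coordE; ring.
have e2 : al b (a - b) v a = 1 by rewrite {2}e al_at.
have e3 : be b (a - b) v a = 0 by rewrite {2}e be_at.
by rewrite /closed_pg e2 e3 !lexx ler01.
Qed.

(** If [w] is only in a diamond of its parent, the foot of the perpendicular to the edge is a point
    of the parent at distance at most slope / 2. *)
Lemma coverage (r : R) w : (forall z, modulus z < r -> support Q z) -> r < rho - 2 ->
  modulus w < r - slope / 2 -> support (subst lambda omega Q) (scale lambda w).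
Proof.
move=> ball rr wr; have s0 := slope_gt0 R n_gt1.
have intr x : modulus x < r -> interior (support Q) x.
  move=> xr; apply/plane_nbhsP; exists (r - modulus x); first by lra.
  by move=> y hy; apply: ball; have := modulusD x (y - x); rewrite addrC subrK; lra.
have [t0 [s [t0L st0 rs [rt0|[a [b [abt dab]]]]]]] := @parent _ w erefl ltac:(lra).
  apply: support_subst st0 rs; apply: (support_tile n_gt1 cov QL t0L _ rt0); first by lra.
  by apply: intr; lra.
have [v [rh cl _]] := frame_edge n_gt1 abt; have h := lt0r_neq0 (rhomb_cross n_gt1 rh).
have d1 := unit_dot (dedge_modulus n_gt1 abt).
have [hX hY] := diamond_bounds dab.
pose f := a + scale (dot (b - a) (w - a)) (b - a).
have fw : modulus (f - w) <= slope / 2.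
  have -> : f - w = scale (- cross (b - a) (w - a)) ((b - a) * Complex 0 1).
    have e := decompose (w - a) d1; rewrite /f.
    have -> : a + scale (dot (b - a) (w - a)) (b - a) - w =
        scale (dot (b - a) (w - a)) (b - a) - (w - a) by rewrite opprB [a + _]addrC addrA.
    by rewrite {2}e; apply: planeP; rewrite !coordE; ring.
  rewrite /modulus (_ : dot _ _ = cross (b - a) (w - a) ^+ 2 * dot (b - a) (b - a)).
    by rewrite d1 mulr1 sqrtr_sqr.
  by rewrite /dot !coordE [re (Complex _ _)]/= [im (Complex _ _)]/=; ring.
have fr : modulus f < r by have := modulusD w (f - w); rewrite addrC subrK; lra.
have rf : region t0 f.
  apply/cl; have e : f = a + scale (dot (b - a) (w - a)) (b - a) + scale 0 v.
    by rewrite /f; apply: planeP; rewrite !coordE; ring.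
  by rewrite /closed_pg e al_at // be_at // hX lexx ler01.
apply: support_subst st0 rs; apply: (support_tile n_gt1 cov QL t0L _ rf); first by lra.
exact: intr.
Qed.
End Gaps.
End Stability.
End SubstitutionGaps.

(** * Periodic tilings by one prototile *)

Module ParallelogramGrid.
Import CyclicPeeling RingFilling RayCrossing ParallelogramWinding TileFrames ListCovers EdgeMeetings WordDiamond TileSubstitution SubstitutionGaps.
Import Order.TTheory GRing.Theory Num.Theory.
Local Open Scope classical_set_scope.
Local Open Scope ring_scope.

Section Telescope.
Variable V : zmodType.

Lemma sum_telescope (f : nat -> V) m : \sum_(j <- iota 0 m) (f j - f j.+1) = f 0%N - f m.
Proof.
elim: m => [|m IH]; first by rewrite big_nil subrr.
by rewrite -[m.+1]addn1 iotaD big_cat big_seq1 IH add0n addn1 /= addrA subrK.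
Qed.

Lemma grid_telescope (h v : nat -> nat -> V) m :
  \sum_(i <- iota 0 m) \sum_(j <- iota 0 m) (h i j + v i.+1 j - h i j.+1 - v i j) =
  \sum_(i <- iota 0 m) (h i 0%N - h i m) - \sum_(j <- iota 0 m) (v 0%N j - v m j).
Proof.
rewrite -sumrN; under [X in _ = _ + X]eq_bigr do rewrite opprB.
have vE j : v m j - v 0%N j = \sum_(i <- iota 0 m) (v i.+1 j - v i j).
  by rewrite -[LHS]opprB -(sum_telescope (fun i => v i j)) -sumrN; apply: eq_bigr => i _; rewrite opprB.
under [X in _ = _ + X]eq_bigr do rewrite vE.
rewrite [X in _ = _ + X]exchange_big /= -big_split /=; apply: eq_bigr => i _.
rewrite -(sum_telescope (h i)) -big_split /=; apply: eq_bigr => j _.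
by rewrite addrACA -!addrA [v i.+1 j + _]addrCA.
Qed.
End Telescope.

Section Grid.
Variables (R : realType) (n : nat).
Hypothesis n_gt1 : (1 < n)%N.
Local Notation plane := (plane R).
Local Notation tile := (tile R n).
Implicit Types (Phi : plane -> plane -> R) (a b w z u p : plane).

Lemma crossing_multiple z p u m :
  \sum_(i <- iota 0 m) crossing z (p + scale i%:R u) (p + scale i.+1%:R u) =
  crossing z p (p + scale m%:R u).
Proof.
have s0 : p + scale 0%:R u = p by rewrite /scale mul0r addr0.
elim: m => [|m IH].
  rewrite big_nil s0 /crossing (_ : cross (p - p) (z - p) = 0) ?ltxx //.
  by rewrite subrr /cross !coordE !mul0r subrr.
rewrite -[m.+1]addn1 iotaD big_cat big_seq1 IH add0n addn1 /=.
have m0 : m.+1%:R != 0 :> R by rewrite pnatr_eq0.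
rewrite [RHS](crossing_additive z p _ (t := m%:R / m.+1%:R)).
  by have -> : p + scale (m%:R / m.+1%:R) (p + scale m.+1%:R u - p) = p + scale m%:R u;
    [apply: planeP; rewrite !coordE; field|].
by rewrite divr_ge0 ?ler0n //= ler_pdivrMr ?ltr0Sn // mul1r ler_nat.
Qed.

Lemma cross_le a b : `|cross a b| <= modulus a * modulus b.
Proof.
rewrite /modulus -sqrtrM ?dot_ge0 // -sqrtr_sqr; apply: ler_wsqrtr.
have -> : dot a a * dot b b = cross a b ^+ 2 + dot a b ^+ 2 by rewrite /dot /cross; ring.
by rewrite lerDl sqr_ge0.
Qed.

(** A block of 2m by 2m translates covers a large disc: inner edges cancel by [grid_telescope], and
    the winding number of one big parallelogram remains. *)
Lemma extendable_proto (T : proto n) : extendable [:: proto_tile R T].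
Proof.
move=> rho; have rh := tile_rhomb n_gt1 (proto_tile R T).
set s := side2 (proto_tile R T) in rh.
have s1E : side1 (proto_tile R T) = 1 by [].
rewrite s1E in rh; have d0 := rhomb_cross n_gt1 rh; case: rh => d1 d2 _ _.
(* The border lines of the block are at distance m times the height of the tile from the origin; the
   successor makes [m] positive, so that the block contains the given tile. *)
pose m := (Num.bound (`|rho| / cross 1 s)).+1.
have mb : rho < m%:R * cross 1 s.
  rewrite -ltr_pdivrMr //; apply: (@le_lt_trans _ _ (`|rho| / cross 1 s)).
    by rewrite ler_pM2r ?invr_gt0 // ler_norm.
  apply: lt_le_trans (archi_boundP _) _; first by rewrite divr_ge0 // ltW.
  by rewrite ler_nat.
pose p0 : plane := - scale m%:R 1 - scale m%:R s.
pose pt i j : plane := p0 + scale i%:R 1 + scale j%:R s.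
pose M := (2 * m)%N.
pose L : seq tile := [seq move_tile (shift (pt i j)) (proto_tile R T) | i <- iota 0 M, j <- iota 0 M].
have E1 i j : pt i j + 1 = pt i.+1 j.
  by rewrite /pt; apply: planeP; rewrite !coordE -[in RHS]natr1; ring.
have E2 i j : pt i j + s = pt i j.+1.
  by rewrite /pt; apply: planeP; rewrite !coordE -[in RHS]natr1; ring.
have ptE i j : [/\ cross 1 (pt i j) = (j%:R - m%:R) * cross 1 s &
    cross (pt i j) s = (i%:R - m%:R) * cross 1 s].
  by rewrite /pt /p0 /cross !coordE; split; ring.
have sumE Phi : antisym Phi -> \sum_(t <- L) bd Phi t =
    \sum_(i <- iota 0 M) (Phi (pt i 0%N) (pt i.+1 0%N) - Phi (pt i M) (pt i.+1 M)) -
    \sum_(j <- iota 0 M) (Phi (pt 0%N j) (pt 0%N j.+1) - Phi (pt M j) (pt M j.+1)).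
  move=> aP; rewrite /L big_allpairs_dep -(grid_telescope (fun i j => Phi (pt i j) (pt i.+1 j))
    (fun i j => Phi (pt i j) (pt i j.+1))).
  apply: eq_bigr => i _; apply: eq_bigr => j _.
  rewrite bdE /quad /corner /side1 /side2 /= !mul1r add0r -/s (_ : proto_side R T = s); last first.
    by rewrite /s /side2 /= mul1r.
  rewrite !E1 !E2 (aP (pt i j.+1) (pt i.+1 j.+1)) (aP (pt i j) (pt i j.+1)); ring.
have mM : M%:R - m%:R = m%:R :> R by rewrite /M natrM; ring.
have cov : covers rho L.
  split=> [z zr|Phi aP h]; [rewrite (sumE _ (crossing_antisym z))|rewrite (sumE _ aP)]; last 1 first.
  - have far a : m%:R * cross 1 s <= `|cross 1 a| \/ m%:R * cross 1 s <= `|cross a s| -> rho <= modulus a.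
      have m1 : modulus (1 : plane) = 1 by exact: modulus1.
      have m2 : modulus s = 1 by exact: modulus1.
      by have := cross_le 1 a; have := cross_le a s; rewrite m1 m2 mul1r mulr1 => h1 h2 []; lra.
    have mge : 0 <= m%:R * cross 1 s by rewrite mulr_ge0 ?ler0n ?ltW.
    have u1 i j : modulus (pt i.+1 j - pt i j) = 1.
      by rewrite -E1 addrAC subrr add0r; exact: modulus1.
    have u2 i j : modulus (pt i j.+1 - pt i j) = 1.
      by rewrite -E2 addrAC subrr add0r; exact: modulus1.
    have fari k j : `|k%:R - m%:R| = m%:R :> R -> rho <= modulus (pt k j) /\ rho <= modulus (pt j k).
      move=> hk; have [e1 _] := ptE j k; have [_ e2] := ptE k j.
      by split; apply: far; [right; rewrite e2|left; rewrite e1];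
         rewrite normrM hk (ger0_norm (ltW d0)).
    have f0 j := fari 0%N j (_ : `|0%:R - m%:R| = m%:R :> R).
    have f1 j := fari M j (_ : `|M%:R - m%:R| = m%:R :> R).
    have e0 : `|0%:R - m%:R| = m%:R :> R by rewrite sub0r normrN ger0_norm.
    have e1 : `|M%:R - m%:R| = m%:R :> R by rewrite mM ger0_norm.
    rewrite !big1 ?subrr // => i _.
      have [g0 _] := f0 e0 i; have [g1 _] := f1 e1 i.
      by rewrite (h _ _ (u2 _ _) g0) (h _ _ (u2 _ _) g1) subrr.
    have [_ g0] := f0 e0 i; have [_ g1] := f1 e1 i.
    by rewrite (h _ _ (u1 _ _) g0) (h _ _ (u1 _ _) g1) subrr.
  have side1E j : \sum_(i <- iota 0 M) crossing z (pt i j) (pt i.+1 j) = crossing z (pt 0%N j) (pt M j).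
    have e i : pt i j = p0 + scale j%:R s + scale i%:R 1 by rewrite /pt addrAC.
    under eq_bigr do rewrite !e; rewrite crossing_multiple !e.
    by congr crossing; rewrite /scale mul0r addr0.
  have side2E i : \sum_(j <- iota 0 M) crossing z (pt i j) (pt i j.+1) = crossing z (pt i 0%N) (pt i M).
    rewrite crossing_multiple; congr crossing; by rewrite /pt /scale mul0r addr0.
  rewrite !sumrB !side1E !side2E.
  have c0 : pt M 0%N = pt 0%N 0%N + scale M%:R 1.
    by rewrite /pt; apply: planeP; rewrite !coordE; ring.
  have c1 : pt 0%N M = pt 0%N 0%N + scale M%:R s.
    by rewrite /pt; apply: planeP; rewrite !coordE; ring.
  have c2 : pt M M = pt 0%N 0%N + scale M%:R 1 + scale M%:R s.
    by rewrite /pt; apply: planeP; rewrite !coordE; ring.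
  transitivity (winding z (pt 0%N 0%N) (scale M%:R 1) (scale M%:R s)).
    rewrite /winding /quad -c0 -c1 (_ : pt M 0%N + scale M%:R s = pt M M); last first.
      by rewrite c0 c2.
    rewrite (crossing_antisym z (pt 0%N M) (pt M M)) (crossing_antisym z (pt 0%N 0%N) (pt 0%N M)).
    by ring.
  have mz := modulus_ge0 z.
  have m0 : 0 < m%:R :> R.
    by rewrite -(pmulr_lgt0 _ d0); lra.
  have M0 : 0 < M%:R :> R by rewrite /M natrM mulr_gt0.
  have cM : cross (scale M%:R 1) (scale M%:R s) = M%:R * M%:R * cross 1 s.
    by rewrite /cross !coordE; ring.
  apply: winding_in; first by rewrite cM !mulr_gt0.
  have l1 := cross_le z s; have l2 := cross_le 1 z.
  have m1 : modulus (1 : plane) = 1 by exact: modulus1.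
  have m2 : modulus s = 1 by exact: modulus1.
  rewrite m1 mul1r ler_norml in l2; rewrite m2 mulr1 ler_norml in l1.
  have [p1 p2] := ptE 0%N 0%N.
  have aE : al (pt 0%N 0%N) (scale M%:R 1) (scale M%:R s) z =
      (cross z s + m%:R * cross 1 s) / (M%:R * cross 1 s).
    rewrite /al cM; have -> : cross (z - pt 0%N 0%N) (scale M%:R s) = M%:R * (cross z s - cross (pt 0%N 0%N) s).
      by rewrite /cross !coordE; ring.
    by rewrite p2; field; rewrite !gt_eqF.
  have bE : be (pt 0%N 0%N) (scale M%:R 1) (scale M%:R s) z =
      (cross 1 z + m%:R * cross 1 s) / (M%:R * cross 1 s).
    rewrite /be cM; have -> : cross (scale M%:R 1) (z - pt 0%N 0%N) = M%:R * (cross 1 z - cross 1 (pt 0%N 0%N)).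
      by rewrite /cross !coordE; ring.
    by rewrite p1; field; rewrite !gt_eqF.
  have dM : 0 < M%:R * cross 1 s by exact: mulr_gt0.
  have ME : M%:R * cross 1 s = 2 * (m%:R * cross 1 s) by rewrite /M natrM; ring.
  move: l1 l2 => /andP[l1 l1'] /andP[l2 l2'].
  rewrite /open_pg aE bE !ltr_pdivrMr // !mul1r !divr_gt0 // ?ME; [split|..]; lra.
have mem : proto_tile R T \in L.
  have mM2 : m \in iota 0 M by rewrite mem_iota /M; lia.
  apply/allpairsP; exists (m, m); split=> //.
  congr Tile; apply: motion_eq; rewrite /= ?mulr1 ?mulr0 ?add0r //.
  by rewrite /pt /p0; apply: planeP; rewrite !coordE; ring.
by exists (rem (proto_tile R T) L); apply: covers_perm cov; exact: perm_to_rem.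
Qed.
End Grid.
End ParallelogramGrid.

(** * Area of an image *)

Module AreaBalance.
Import CyclicPeeling EdgeWord RingFilling RayCrossing ParallelogramWinding TileFrames ListCovers EdgeMeetings WordDiamond TileSubstitution SubstitutionGaps.
Import Order.TTheory GRing.Theory Num.Theory.
Local Open Scope classical_set_scope.
Local Open Scope ring_scope.

Section ParallelogramArea.
Variable R : realType.
Local Notation plane := (plane R).
Implicit Types (p u v : plane).
Local Notation leb := (@lebesgue_measure R).

Lemma lebesgue_interval (l r : R) : leb [set y | l <= y <= r] = (Num.max (r - l) 0)%:E.
Proof.
have -> : [set y | l <= y <= r] = [set` `[l, r]] :> set R.
  by apply/seteqP; split=> y /=; rewrite in_itv.
rewrite lebesgue_measure_itv /= lte_fin; case: ltP => h.
  by rewrite max_l // subr_ge0 ltW.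
by rewrite max_r // subr_le0.
Qed.

Lemma strip_section (c k w : R) : exists l r, forall b,
  (0 <= b <= 1) && (0 <= c - b * k <= w) = (l <= b <= r).
Proof.
have [k0|k0|->] := ltgtP k 0.
- exists (Num.max 0 (c / k)), (Num.min 1 ((c - w) / k)) => b.
  rewrite ge_max le_min ler_ndivrMr // ler_ndivlMr //.
  by apply/andP/andP => -[] /andP[h1 h2] /andP[h3 h4]; split; apply/andP; split; lra.
- exists (Num.max 0 ((c - w) / k)), (Num.min 1 (c / k)) => b.
  rewrite ge_max le_min ler_pdivrMr // ler_pdivlMr //.
  by apply/andP/andP => -[] /andP[h1 h2] /andP[h3 h4]; split; apply/andP; split; lra.
have [h|h] := boolP (0 <= c <= w).
  by exists 0, 1 => b; rewrite mulr0 subr0 h andbT.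
by exists 1, 0 => b; rewrite mulr0 subr0 (negbTE h) andbF; apply/esym/negbTE/negP => /andP[]; lra.
Qed.

(** Each vertical section is an affine image, with factor cross u v / re u, of the section of the
    sheared strip [S]; integrated in the other order, the strip has area re u. *)
Lemma area_pg_pos p u v : 0 < re u -> 0 < cross u v ->
  area [set z | closed_pg p u v z] = (cross u v)%:E.
Proof.
move=> u0 uv; set K := cross u v / re u; have K0 : 0 < K by rewrite divr_gt0.
pose S : set (R * R) := [set q | (0 <= q.2 <= 1) && (0 <= q.1 - re p - q.2 * re v <= re u)].
have mS : measurable S.
  have m1 : measurable_fun [set: R * R] (fun q => q.2 : R) by exact: measurable_snd.
  have m2 : measurable_fun [set: R * R] (fun q => q.1 - re p - q.2 * re v : R).
    apply: measurable_realfun.measurable_funB; last by apply: measurable_realfun.measurable_funM => //; exact: measurable_cst.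
    by apply: measurable_realfun.measurable_funB.
  have -> : S = ((fun q => q.2 : R) @^-1` [set` `[0, 1]]) `&`
      ((fun q => q.1 - re p - q.2 * re v : R) @^-1` [set` `[0, re u]]).
    by apply/seteqP; split=> q /=; rewrite /S /= !in_itv /= => /andP.
  apply: measurableI; rewrite -[X in measurable X]setTI; [apply: m1|apply: m2];
    by [exact: measurableT|exact: measurable_itv].
have secE x : leb (xsection [set q : R * R | closed_pg p u v (Complex q.1 q.2)] x) =
    (K%:E * leb (xsection S x))%E.
  have [l [r lr]] := strip_section (x - re p) (re v) (re u).
  pose c0 := im p + (x - re p) * im u / re u.
  have -> : xsection S x = [set b | l <= b <= r].
    by apply/seteqP; split=> b; rewrite xsectionE /S /= lr.
  have key y : closed_pg p u v (Complex x y) <-> (c0 + K * l <= y <= c0 + K * r).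
    have [b ->] : exists b, y = c0 + K * b.
      by exists ((y - c0) / K); rewrite mulrCA divff ?gt_eqF // mulr1 addrC subrK.
    have beE : be p u v (Complex x (c0 + K * b)) = b.
      rewrite /be /c0 /K /cross !coordE [re (Complex _ _)]/= [im (Complex _ _)]/=.
      by move: uv u0; rewrite /cross => uv' u0'; field; rewrite !gt_eqF.
    have alE : al p u v (Complex x (c0 + K * b)) = (x - re p - b * re v) / re u.
      rewrite /al /c0 /K /cross !coordE [re (Complex _ _)]/= [im (Complex _ _)]/=.
      by move: uv u0; rewrite /cross => uv' u0'; field; rewrite !gt_eqF.
    rewrite /closed_pg beE alE ler_pdivrMr // mul1r ler_pdivlMr // mul0r.
    rewrite !lerD2l !ler_pM2l // -lr.
    by split=> [[h1 h2]|/andP[]//]; rewrite h1 h2.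
  have -> : xsection [set q : R * R | closed_pg p u v (Complex q.1 q.2)] x =
      [set y | c0 + K * l <= y <= c0 + K * r].
    by apply/seteqP; split=> y; rewrite xsectionE /= key.
  rewrite !lebesgue_interval -EFinM; congr EFin.
  have -> : c0 + K * r - (c0 + K * l) = K * (r - l) by ring.
  by rewrite maxr_pMr ?mulr0 // ltW.
rewrite /area /product_measure1.
under eq_integral => x _ do rewrite [(_ \o _) x]/= secE.
rewrite ge0_integralZl_EFin //; [|exact: measurable_fun_xsection|exact: ltW].
have -> : (\int[leb]_x leb (xsection S x))%E = (leb \x^ leb)%E S.
  rewrite -[LHS]/((leb \x leb)%E S).
  by apply: product_measure_unique => //= A B mA mB; rewrite product_measure2E.
rewrite /product_measure2.
have ysecE y : (leb (ysection S y) = (re u)%:E * (\1_([set` `[0, 1]] : set R) y)%:E)%E.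
  rewrite indicE mem_setE in_itv /=; case: (boolP (0 <= y <= 1)) => hy.
    have -> : ysection S y = [set x | re p + y * re v <= x <= re p + y * re v + re u].
      apply/seteqP; split=> x; rewrite ysectionE /S /= hy /= => /andP[h1 h2]; apply/andP; split; lra.
    by rewrite lebesgue_interval mule1 addrAC subrr add0r max_l // ltW.
  have -> : ysection S y = set0.
    by apply/seteqP; split=> x //; rewrite ysectionE /S /= (negbTE hy).
  by rewrite measure0 mule0.
under eq_integral => y _ do rewrite [(_ \o _) y]/= ysecE.
rewrite ge0_integralZl_EFin //; first last.
- exact: ltW.
- by apply/measurable_realfun.measurable_EFinP; apply: measurable_realfun.measurable_indic; exact: measurable_itv.
rewrite integral_indic //= setIT lebesgue_measure_itv /= lte_fin ltr01 oppr0 adde0 mule1.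
by rewrite -EFinM divfK // gt_eqF.
Qed.

(** One of u, v, -u, -v has positive real part, and going round the corners makes it the first
    side. *)
Lemma area_pg p u v : 0 < cross u v -> area [set z | closed_pg p u v z] = (cross u v)%:E.
Proof.
have step (q a b : plane) : 0 < cross a b ->
    [set z | closed_pg q a b z] = [set z | closed_pg (q + a) b (- a) z].
  by move=> h; apply/seteqP; split=> z /=; rewrite closed_rebase ?gt_eqF.
move=> uv; have h1 := cross_rebase u v; have h2 := cross_rebase v (- u).
have h3 := cross_rebase (- u) (- v).
have [u0|u0|u0] := ltgtP 0 (re u); first exact: area_pg_pos.
  rewrite step // step ?h1 // area_pg_pos ?h2 ?h1 // reN; lra.
have [v0|v0|v0] := ltgtP 0 (re v).
- by rewrite step // area_pg_pos ?h1.
- by rewrite step // step ?h1 // step ?h2 ?h1 // area_pg_pos ?h3 ?h2 ?h1 // reN; lra.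
by exfalso; move: uv; rewrite /cross -u0 -v0 mul0r mulr0 subrr ltxx.
Qed.
End ParallelogramArea.

Section TileArea.
Variables (R : realType) (n : nat).
Hypothesis n_gt1 : (1 < n)%N.
Local Notation plane := (plane R).
Local Notation tile := (tile R n).
Local Notation lambda := (inflation_factor R n).
Local Notation om := (om R n_gt1).
Implicit Types (t : tile) (a b : plane).

Lemma area_region t : area (region t) = (cross (side1 t) (side2 t))%:E.
Proof.
rewrite -(area_pg (corner t)) ?(rhomb_cross n_gt1) //; last exact: tile_rhomb.
by congr area; apply/seteqP; split=> z /=; rewrite regionP.
Qed.

Lemma bd_cross t : bd (@cross R) t = 2 * cross (side1 t) (side2 t).
Proof. by rewrite bdE /quad /cross !coordE; ring. Qed.

Lemma cross_antisym : antisym (@cross R).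
Proof. by move=> a b; rewrite /cross; ring. Qed.

Lemma psum_cross_affine (c w : plane) l : psum (fun d => w * U R n d) (@cross R) c l =
  cross c (w * steps R n l) + dot w w * psum (U R n) (@cross R) 0 l.
Proof.
have gen q : psum (fun d => w * U R n d) (@cross R) (c + w * q) l =
    cross c (w * steps R n l) + dot w w * psum (U R n) (@cross R) q l.
  elim: l q => [|d l IH] q.
    by rewrite /steps big_nil mulr0 /= /cross !coordE; ring.
  have e : c + w * q + w * U R n d = c + w * (q + U R n d) by rewrite mulrDr addrA.
  have -> : steps R n (d :: l) = U R n d + steps R n l by rewrite /steps big_cons.
  by rewrite /= e IH /cross /dot !coordE; ring.
by have := gen 0; rewrite mulr0 addr0.
Qed.

(* The two halves of an edge path sweep out opposite areas, because the word
   is a palindrome. *)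
Lemma path_cross a b : path n (@cross R) a b = lambda ^+ 2 * cross a b.
Proof.
have [i0 _] := letters_steps R n_gt1.
have k0 : psum (U R n) (@cross R) 0 (letters n) = 0.
  have h := psum_rev (U R n) 0 (letters n) cross_antisym.
  rewrite add0r /letters (word_letters_rev n) -/(letters n) in h.
  have e : psum (fun d => - U R n d) (@cross R) (\sum_(d <- letters n) U R n d) (letters n) =
      cross (steps R n (letters n)) ((-1) * steps R n (letters n)) +
      dot (-1) (-1) * psum (U R n) (@cross R) 0 (letters n).
    by rewrite -psum_cross_affine; apply: eq_psum => d; rewrite mulN1r.
  rewrite e in h; move: h; rewrite {1}/cross /dot !coordE.
  by move: (psum _ _ _ _) => k h; lra.
rewrite /path psum_cross_affine k0 mulr0 addr0 /cross !coordE i0 -/lambda /inflation_factor; ring.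
Qed.

(** Twice the area of a tile is the boundary sum of [cross], so [bd_om] reduces the total area to
    sums along edge paths, which [path_cross] evaluates. *)
Lemma area_om (T : proto n) : uniq (om T) ->
  (\sum_(t \in [set` om T]) area (region t))%E = area (scale lambda @` (proto_region T : set plane)).
Proof.
move=> uo; have l0 := lambda_gt0 R n_gt1.
rewrite -fsbig_seq //.
have -> : (\sum_(t <- om T) area (region t))%E = (\sum_(t <- om T) cross (side1 t) (side2 t))%:E.
  by rewrite -sumEFin; apply: eq_bigr => t _; rewrite area_region.
have d0 := rhomb_cross n_gt1 (tile_rhomb n_gt1 (proto_tile R T)).
pose u := scale lambda (side1 (proto_tile R T)); pose v := scale lambda (side2 (proto_tile R T)).
have uvE : cross u v = lambda ^+ 2 * cross (side1 (proto_tile R T)) (side2 (proto_tile R T)).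
  by rewrite /u /v /cross !coordE; ring.
have uv : 0 < cross u v by rewrite uvE mulr_gt0 // exprn_gt0.
have -> : scale lambda @` proto_region T = [set z | closed_pg 0 u v z].
  apply/seteqP; split=> z.
    case=> _ [a [b [ha hb ->]]] <-.
    have -> : scale lambda (scale a 1 + scale b (proto_side R T)) = 0 + scale a u + scale b v.
      by rewrite /u /v /side1 /side2 /=; apply: planeP; rewrite !coordE; ring.
    by rewrite /= /closed_pg al_at ?be_at // gt_eqF.
  case; have := pg_coords 0 z (lt0r_neq0 uv); move: (al 0 u v z) (be 0 u v z) => a b -> ha hb.
  exists (scale a 1 + scale b (proto_side R T)); first by do 2!eexists; split; [exact: ha|exact: hb|].
  by rewrite /u /v /side1 /side2 /=; apply: planeP; rewrite !coordE; ring.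
rewrite area_pg // uvE; congr EFin.
apply: (mulfI (_ : 2 != 0 :> R)); first by rewrite pnatr_eq0.
rewrite mulr_sumr; under eq_bigr do rewrite -bd_cross.
rewrite (bd_om n_gt1 T cross_antisym) mulrCA -bd_cross /bd mulr_sumr.
by apply: eq_bigr => e _; rewrite path_cross.
Qed.
End TileArea.
End AreaBalance.

(** * The tiling grown from the star *)

Module StarTiling.
Import CyclicPeeling BoundaryEndpoints RingFilling RhombusInflation RayCrossing ParallelogramWinding TileFrames ListCovers EdgeMeetings WordDiamond TileSubstitution SubstitutionGaps ParallelogramGrid AreaBalance.
Import Order.TTheory GRing.Theory Num.Theory.
Local Open Scope classical_set_scope.
Local Open Scope ring_scope.

Lemma uniq_flatten_disjoint (S T : eqType) (f : S -> seq T) A t t' x :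
  uniq (flatten (map f A)) -> t \in A -> t' \in A -> t <> t' -> x \in f t -> x \in f t' -> False.
Proof.
move=> u tA t'A ne xt xt'.
have t'r : t' \in rem t A.
  have : t' \in t :: rem t A by rewrite -(perm_mem (perm_to_rem tA)).
  by rewrite inE => /orP[/eqP e|//]; case: ne.
move: u; rewrite (perm_uniq (perm_flatten (perm_map f (perm_to_rem tA)))) /= cat_uniq.
move=> /and3P[_ /hasPn h _].
have xr : x \in flatten (map f (rem t A)) by apply/flattenP; exists (f t') => //; apply: map_f.
by have := h x xr; rewrite /= xt.
Qed.

Section Tiling.
Variables (R : realType) (n : nat).
Hypothesis n_gt1 : (1 < n)%N.
Local Notation plane := (plane R).
Local Notation tile := (tile R n).
Local Notation lambda := (inflation_factor R n).
Local Notation om := (om R n_gt1).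
Local Notation subst_list := (@subst_list R n n_gt1).
Local Notation U := (U R n).
Implicit Types (t : tile) (z w : plane) (A L : seq tile) (g h : motion R).

Definition omega (T : proto n) : set tile := [set` om T].
Local Notation subst_set := (subst lambda omega).

Lemma subst_listE A : subst_set [set` A] = [set` subst_list A].
Proof.
apply/seteqP; split=> s /=.
  case=> t /= tA [s' s'o <-]; apply/flattenP; exists (subst_seq n_gt1 t); first exact: map_f.
  exact: map_f.
by case/flattenP => _ /mapP[t tA ->] /mapP[s' s'o ->]; exists t => //; exists s'.
Qed.

Lemma subst_iterE k T :
  subst_iter lambda omega k T = [set` iter k subst_list [:: proto_tile R T]].
Proof.
elim: k => [|k IH]; first by apply/seteqP; split=> t /=; rewrite inE => /eqP.
by rewrite /subst_iter iterS -/(subst_iter lambda omega k T) IH subst_listE.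
Qed.

Lemma extendable_iter k A : extendable A -> extendable (iter k subst_list A).
Proof. by move=> eA; elim: k => //= k; exact: extendable_subst. Qed.

Lemma move_tile_id g t : rot g = 1 -> trans g = 0 -> move_tile g t = t.
Proof.
case: t => T h r1 t0; congr Tile; apply: motion_eq; rewrite /= r1 ?t0 ?mul1r ?addr0 //.
Qed.

Lemma subst_seq_proto T : subst_list [:: proto_tile R T] = om T.
Proof.
rewrite /subst_list /= cats0 /subst_seq -[RHS]map_id; apply: eq_map => t.
by apply: move_tile_id => //=; rewrite /scale mulr0.
Qed.

Lemma extendable_om T : extendable (om T).
Proof. by rewrite -subst_seq_proto; apply: extendable_subst; exact: extendable_proto. Qed.

(** Extendable lists have no repetitions, so the concatenated images of different tiles share no
    tile; overlap between different tiles is excluded by extendability as well. *)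
Lemma omega_consistent : consistent lambda omega.
Proof.
move=> T k Q; have eA := extendable_iter k (extendable_proto n_gt1 T).
have -> : Q = [set` iter k subst_list [:: proto_tile R T]] by exact: subst_iterE.
move: (iter _ _ _) eA => A eA; have eB := extendable_subst n_gt1 eA.
split; first exact: extendable_patch.
  move=> t t' /= tA t'A ne s s' [s1 h1 e1] [s2 h2 e2].
  have st : s \in subst_seq n_gt1 t by rewrite -e1; exact: map_f.
  have st' : s' \in subst_seq n_gt1 t' by rewrite -e2; exact: map_f.
  apply: (extendable_disjoint n_gt1 eB) => /=.
  - by apply/flattenP; exists (subst_seq n_gt1 t) => //; exact: map_f.
  - by apply/flattenP; exists (subst_seq n_gt1 t') => //; exact: map_f.
  move=> e; rewrite -e in st'.
  exact: (uniq_flatten_disjoint (extendable_uniq n_gt1 eB) tA t'A ne st st').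
move=> t /= tA tQ _ [w rw <-].
have [L [c sub]] := extendable_cat eA (reach A + 5).
have sub' x : [set` A] x -> x \in L by exact: sub.
by apply: (no_gap n_gt1 c sub' tA rw tQ); have := reach_region n_gt1 tA rw; lra.
Qed.

Lemma omega_substitution : is_substitution lambda omega.
Proof.
split; first by have := inflation_factor_ge4 R n_gt1; lra.
- by move=> T; apply: (extendable_patch n_gt1 (extendable_om T)).
- by move=> T; apply: (area_om (extendable_uniq n_gt1 (extendable_om T))).
exact: omega_consistent.
Qed.

Local Notation star_tile := (@star_tile R n n_gt1).

Definition star : seq tile := undup [seq star_tile 0 (c%:Z + 1) | c <- iota 0 (2 * n)].

Lemma star_tile_eq p c c' : U c = U c' -> star_tile p c = star_tile p c'.
Proof. by move=> e; congr Tile; apply: motion_eq. Qed.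

Lemma star_mem c : star_tile 0 c \in star.
Proof.
have [k [hk hr]] := residue_spec n_gt1 (c - 1).
have -> : star_tile 0 c = star_tile 0 ((absz (residue n (c - 1)))%:Z + 1).
  apply: star_tile_eq; rewrite -[LHS](antiperiodic_mod (UD R n_gt1) _ (- k)) gez0_abs; last lia.
  by congr TileFrames.U; lia.
by rewrite mem_undup; apply/mapP; eexists; last reflexivity; rewrite mem_iota; lia.
Qed.

Lemma starP t : t \in star -> exists c, t = star_tile 0 c.
Proof. by rewrite mem_undup => /mapP[c _ ->]; eexists. Qed.

Definition star_place (T : proto n) : plane := projT1 (cid (star_om R n_gt1 T)).

Lemma star_place_om T t : t \in star -> move_tile (shift (star_place T)) t \in om T.
Proof.
rewrite mem_undup => /mapP[c]; rewrite mem_iota add0n => /andP[_ hc] ->.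
rewrite /star_place; case: cid => p /= /(_ c hc) hm.
have -> : move_tile (shift p) (star_tile 0 (c%:Z + 1)) = star_tile p (c%:Z + 1); last exact: hm.
by congr Tile; apply: motion_eq; rewrite /= ?mul1r ?add0r.
Qed.

Lemma move_tileM g h t : move_tile (motionM g h) t = move_tile g (move_tile h t).
Proof.
congr Tile; apply: motion_eq; rewrite /= ?mulrA //.
by rewrite mulrDr mulrA addrA.
Qed.

(** A translate of the star is part of the image of a prototile. *)
Lemma extendable_star : extendable star.
Proof.
pose T0 := proto_of n_gt1 0.
have eS := extendable_shift (- star_place T0) (extendable_om T0).
apply: (extendable_sub n_gt1 _ _ eS).
  exact: undup_uniq.
move=> t /(star_place_om T0) ht; apply/mapP; eexists; first exact: ht.
by rewrite -move_tileM move_tile_id //= ?mulr1 ?mul1r ?subrr.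
Qed.

Lemma subst_list_sub A A' : {subset A <= A'} -> {subset subst_list A <= subst_list A'}.
Proof.
move=> sub s /flattenP[_ /mapP[t tA ->] st]; apply/flattenP; exists (subst_seq n_gt1 t) => //.
exact/map_f/sub.
Qed.

Lemma motion_scaleM g h : motion_scale lambda (motionM g h) =
  motionM (motion_scale lambda g) (motion_scale lambda h).
Proof.
apply: motion_eq => //=; apply: planeP; rewrite !coordE; ring.
Qed.

Lemma subst_list_move g A : subst_list (map (move_tile g) A) =
  map (move_tile (motion_scale lambda g)) (subst_list A).
Proof.
rewrite /subst_list map_flatten -!map_comp; congr flatten; apply: eq_map => t /=.
rewrite /subst_seq -map_comp; apply: eq_map => s /=.
by rewrite motion_scaleM move_tileM.
Qed.

Definition W k : seq tile := iter k subst_list star.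

(** All star tiles have their corner at the origin, which inflation fixes; by [proto_tile_om] the
    image of each contains the tile itself. *)
Lemma star_grows : {subset star <= subst_list star}.
Proof.
move=> t ht; have [c tE] := starP ht.
apply/flattenP; exists (subst_seq n_gt1 t); first exact: map_f.
apply/mapP; exists (proto_tile R (tproto t)); first exact: proto_tile_om.
rewrite tE; congr Tile; apply: motion_eq; rewrite /= ?mulr1 ?mulr0 ?add0r // /scale mulr0.
by [].
Qed.

Lemma WS k : {subset W k <= W k.+1}.
Proof. by elim: k => [|k IH]; [exact: star_grows|exact: subst_list_sub]. Qed.

Lemma W_mono k k' : (k <= k')%N -> {subset W k <= W k'}.
Proof.
by move=> /subnK <-; elim: (k' - k)%N => // i IH t /IH; rewrite addSn; exact: WS.
Qed.

Lemma extendable_W k : extendable (W k).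
Proof. exact: extendable_iter extendable_star. Qed.

Definition Q : set tile := [set t | exists k, t \in W k].

Lemma Q_list A : (forall t, t \in A -> Q t) -> exists k, {subset A <= W k}.
Proof.
elim: A => [|t A IH] h; first by exists 0%N.
have [k hk] := h t (mem_head _ _).
have [|k' hk'] := IH; first by move=> x xA; apply: h; rewrite inE xA orbT.
exists (maxn k k') => x; rewrite inE => /orP[/eqP->|/hk'].
  by apply: W_mono hk; exact: leq_maxl.
by apply: W_mono; exact: leq_maxr.
Qed.

Lemma Q_pair t t' : Q t -> Q t' -> exists k, t \in W k /\ t' \in W k.
Proof.
move=> h h'; have [|k hk] := @Q_list [:: t; t'].
  by move=> x; rewrite !inE => /orP[] /eqP->.
by exists k; split; apply: hk; rewrite !inE eqxx ?orbT.
Qed.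

Lemma subst_Q k t : Q t -> forall s, s \in iter k subst_list [:: t] -> Q s.
Proof.
move=> [j tj] s hs; exists (k + j)%N; rewrite /W iterD.
have sub : {subset [:: t] <= W j} by move=> x; rewrite inE => /eqP->.
elim: k s hs => [|k IH] s /=; first exact: sub.
exact: subst_list_sub.
Qed.

(** A half turn reverses the sign of cross (U c) z, so the sign changes between consecutive
    directions c and c+1, and [z] lies in that sector. The radius is the height of the narrow
    rhombus. *)
Lemma star_ball z : modulus z < sin (theta R n) -> support [set` W 0] z.
Proof.
move=> zs; pose f (c : int) := cross (U c) z; have S0 := sin_theta_gt0 R n_gt1.
have fn c : f (c + n%:Z) = - f c by rewrite /f UD // /cross !coordE; ring.
have dU c : dot (U c) (U c) = 1 by rewrite /dot reU imU -!expr2 cos2Dsin2.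
have fle c : `|f c| <= modulus z.
  by have := cross_le (U c) z; rewrite (modulus1 (dU c)) mul1r.
have change d : 0 <= f d -> exists c, 0 <= f c /\ f (c + 1) <= 0.
  move=> fd; apply: contrapT => none.
  have pos i : 0 <= f (d + i%:Z) /\ (i == 0%N \/ 0 < f (d + i%:Z)).
    elim: i => [|i [IH _]]; first by rewrite addr0; split=> //; left.
    have [le|lt] := leP (f (d + i.+1%:Z)) 0; last by split; [exact: ltW|right].
    by case: none; exists (d + i%:Z); split=> //; rewrite -addrA -[i%:Z + 1]PoszD addn1.
  have [_ []] := pos n; first by move/eqP=> n0; move: n_gt1; rewrite n0.
  by rewrite fn oppr_gt0 ltNge fd.
have [c [c0 c1]] : exists c, 0 <= f c /\ f (c + 1) <= 0.
  have [h|h] := leP 0 (f 0); first exact: change h.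
  by apply: (change (0 + n%:Z)); rewrite fn oppr_ge0 ltW.
exists (star_tile 0 c); first exact: star_mem.
apply/(regionP n_gt1).
have s1 : side1 (star_tile 0 c) = U c by [].
have s2 : side2 (star_tile 0 c) = U (c + 1).
  by rewrite /side2 /= proto_sideE proto_ofE ?UM //; lia.
have cr : cross (U c) (U (c + 1)) = sin (theta R n).
  rewrite -UM -[U c]mulr1 -mulrA mul1r crossM dU mul1r.
  by rewrite /cross re1 im1 imU mul1r mul0r subr0 mul1r.
have crz : cross z (U (c + 1)) = - f (c + 1) by rewrite /f /cross; ring.
rewrite /closed_pg /al /be s1 s2 cr -[corner _]/(0 : plane) subr0 crz -/(f c).
have b1 := fle c; have b2 := fle (c + 1).
rewrite ler_norml in b1; rewrite ler_norml in b2.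
move: b1 b2 => /andP[b1 b1'] /andP[b2 b2'].
by rewrite !ler_pdivrMr // !ler_pdivlMr // mul0r mul1r; split; lra.
Qed.

(** The loss slope / 2 is at most half of the radius, and inflation multiplies by at least 4, so the
    radius doubles. *)
Lemma W_ball k z : modulus z < 2 ^+ k * sin (theta R n) -> support [set` W k] z.
Proof.
elim: k z => [|k IH] z zs; first by apply: star_ball; move: zs; rewrite expr0 mul1r.
have l4 := inflation_factor_ge4 R n_gt1; have l0 : 0 < lambda by lra.
have S0 := sin_theta_gt0 R n_gt1; have C0 := cos_theta_ge0 R n_gt1.
pose w := scale lambda^-1 z.
have zE : z = scale lambda w.
  by apply: planeP; rewrite /w !coordE mulrA divff ?gt_eqF // mul1r.
have sl : slope R n <= sin (theta R n).
  by rewrite ler_pdivrMr ?slope_den //; nra.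
have p1 : 1 <= 2 ^+ k :> R by rewrite exprn_ege1 // ler1n.
set r := 2 ^+ k * sin (theta R n) in IH.
have rS : sin (theta R n) <= r by rewrite /r -[leLHS]mul1r ler_pM2r.
have wr : modulus w < r / 2.
  move: zs; rewrite zE (modulus_scale _ (ltW l0)) exprS -mulrA -/r => h.
  have m0 := modulus_ge0 w.
  have : 4 * modulus w <= lambda * modulus w by rewrite ler_wpM2r.
  by lra.
have [L [c sub]] := extendable_cat (extendable_W k) (r + 3).
rewrite -[W k.+1]/(subst_list (W k)) -subst_listE zE.
have sub' x : [set` W k] x -> x \in L by exact: sub.
apply: (coverage n_gt1 c sub' IH); first by lra.
by apply: lt_le_trans wr _; lra.
Qed.

Lemma Q_support : support Q = [set: plane].
Proof.
apply/seteqP; split=> // z _; have S0 := sin_theta_gt0 R n_gt1.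
have m0 := modulus_ge0 z; pose N := Num.bound (modulus z / sin (theta R n)).
have [t tW rt] : support [set` W N] z.
  apply: W_ball; rewrite -ltr_pdivrMr //.
  apply: lt_trans (archi_boundP _) _; first by rewrite divr_ge0 // ltW.
  by rewrite -natrX ltr_nat; exact: ltn_expl.
by exists t => //; exists N.
Qed.

Lemma Q_tiling : is_tiling Q.
Proof.
split; last exact: Q_support.
  move=> t t' ht ht'; have [k [tW t'W]] := Q_pair ht ht'.
  exact: (extendable_edge_to_edge n_gt1 (extendable_W k)).
move=> t t' ht ht'; have [k [tW t'W]] := Q_pair ht ht'.
exact: (extendable_disjoint n_gt1 (extendable_W k)).
Qed.

Lemma region_move g t : region (move_tile g t) = motion_fun g @` region t.
Proof.
apply/seteqP; split=> z.
  by case=> x hx <-; rewrite motionME; exists (motion_fun (tmotion t) x) => //; exists x.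
by case=> _ [x hx <-] <-; exists x => //; rewrite motionME.
Qed.

(** Carries [W k] into the image of order k+1 of [t]: the star sits at [star_place] in the first
    image, and each further substitution rescales the motion. *)
Definition embedding k t : motion R :=
  iter k (motion_scale lambda) (motionM (motion_scale lambda (tmotion t)) (shift (star_place (tproto t)))).

Lemma embedding_mem k t s : s \in W k ->
  move_tile (embedding k t) s \in iter k.+1 subst_list [:: t].
Proof.
rewrite iterSr /embedding; set B := subst_list [:: t]; set g := motionM _ _.
have base : {subset map (move_tile g) star <= B}.
  move=> _ /mapP[x xs ->]; rewrite /B /subst_list /= cats0 /g move_tileM.
  by apply: map_f; exact: star_place_om.
have {base} : {subset map (move_tile (iter k (motion_scale lambda) g)) (W k) <= iter k subst_list B}.
  elim: k => [//|k IH]; rewrite iterS /W iterS -subst_list_move; exact: subst_list_sub.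
by move=> sub sW; apply: sub; exact: map_f.
Qed.

Lemma embedding_rot k t : dot (rot (embedding k t)) (rot (embedding k t)) = 1.
Proof. exact: rot_dot. Qed.

Lemma embedding_trans k t : trans (embedding k t) =
  scale (lambda ^+ k) (scale lambda (corner t) + rot (tmotion t) * star_place (tproto t)).
Proof.
elim: k => [|k IH] /=.
  by apply: planeP; rewrite /corner !coordE [trans (shift _)]/= ?expr0; ring.
by rewrite IH; apply: planeP; rewrite !coordE exprS; ring.
Qed.

Lemma Q_legal P : is_patch P -> P `<=` Q -> legal lambda omega P.
Proof.
case=> /finite_seqP[A ->] _ _ sub; have [|k hk] := @Q_list A; first by move=> t; exact: sub.
exists (proto_of n_gt1 0), k.+1, (embedding k (proto_tile R (proto_of n_gt1 0))).
rewrite subst_iterE => _ [_ [t /= tA <-] <-].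
by eexists; last reflexivity; apply: embedding_mem; exact: hk.
Qed.

Lemma region_corner t w : region t w -> modulus (w - corner t) <= 2.
Proof.
move=> rw; have : region (move_tile (shift (- corner t)) t) (w - corner t).
  by rewrite region_move; exists w => //; rewrite shiftE.
move/(region_modulus n_gt1).
have -> : corner (move_tile (shift (- corner t)) t) = 0.
  by rewrite /corner /= mul1r subrr.
by rewrite modulus0 add0r.
Qed.

(** A point is lambda^(k+1) w with [w] in some tile of [Q], whose image of order k+1 contains a copy
    of [W k] and thus of the patch, at bounded distance. *)
Lemma Q_recurrent : uniformly_recurrent Q.
Proof.
move=> P [/finite_seqP[A ->] _ _] [h hP].
have tileOf t : t \in A -> exists2 s, Q s & region s = region (move_tile h t).
  move=> tA; have [|s Qs rs] := hP (region (move_tile h t)).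
    by exists (move_tile h t) => //; exists t.
  by exists s.
(* The patch occurs in [Q] only as a collection of shapes; [B] consists of actual tiles of [Q] with
   the same regions. *)
have [B [hB QB]] : exists B : seq tile, (forall t, t \in A ->
    exists2 s, s \in B & region s = region (move_tile h t)) /\ forall s, s \in B -> Q s.
  elim: A tileOf {hP} => [|t A IH] tileOf; first by exists [::].
  have [|B [h1 h2]] := IH; first by move=> x xA; apply: tileOf; rewrite inE xA orbT.
  have [s Qs rs] := tileOf t (mem_head _ _); exists (s :: B); split=> x.
    rewrite inE => /orP[/eqP->|/h1[y yB ry]]; first by exists s; rewrite ?mem_head.
    by exists y; rewrite // inE yB orbT.
  by rewrite inE => /orP[/eqP->|/h2].
have [k hk] := Q_list QB; have l0 := lambda_gt0 R n_gt1.
(* The sum serves as an upper bound for the place of a star in any first image. The other terms of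
   [D] bound the patch itself and, by 2 before scaling, the distance from [w] to the corner of its
   tile. *)
pose far := \sum_(T : proto n) modulus (star_place T).
pose D := reach (map (move_tile h) A) + (lambda ^+ k.+1 * 2 + lambda ^+ k * far).
have far0 : 0 <= far by apply: sumr_ge0 => T _; exact: modulus_ge0.
have reach0 : 0 < reach (map (move_tile h) A).
  by rewrite ltr_wpDl // sumr_ge0 // => t _; exact: modulus_ge0.
have lk0 : 0 < lambda ^+ k by exact: exprn_gt0.
have lk1 : 0 < lambda ^+ k.+1 by exact: exprn_gt0.
have D0 : 0 < D by rewrite ltr_pwDl // addr_ge0 // mulr_ge0 // ltW.
exists D => // z; pose w := scale (lambda ^+ k.+1)^-1 z.
have zE : z = scale (lambda ^+ k.+1) w.
  by apply: planeP; rewrite /w !coordE mulrA divff ?gt_eqF // mul1r.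
have [t Qt rt] : support Q w by rewrite Q_support.
have inQ s : s \in B -> Q (move_tile (embedding k t) s).
  by move=> /hk sW; apply: (subst_Q (k := k.+1) Qt); exact: embedding_mem.
exists (motionM (embedding k t) h).
  move=> _ [_ [x /= xA <-] <-]; have [s sB rs] := hB x xA.
  exists (move_tile (embedding k t) s); first exact: inQ.
  by rewrite move_tileM !region_move rs region_move.
move=> p [_ [x /= xA <-]]; rewrite move_tileM region_move => -[q rq <-].
rewrite normE lecR.
have q1 : modulus q <= reach (map (move_tile h) A).
  by have := reach_region n_gt1 (map_f (move_tile h) xA) rq; lra.
have mrot v : modulus (rot (embedding k t) * v) = modulus v.
  by rewrite modulusM (modulus1 (embedding_rot k t)) mul1r.
have rt1 : modulus (rot (tmotion t)) = 1 by apply: modulus1; exact: rot_dot.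
have -> : motion_fun (embedding k t) q - z = rot (embedding k t) * q +
    (scale (lambda ^+ k.+1) (corner t - w) +
     scale (lambda ^+ k) (rot (tmotion t) * star_place (tproto t))).
  by rewrite /motion_fun embedding_trans zE; apply: planeP; rewrite !coordE exprS; ring.
apply: le_trans (modulusD _ _) _; rewrite mrot; apply: lerD => //.
apply: le_trans (modulusD _ _) _; apply: lerD.
  by rewrite (modulus_scale _ (ltW lk1)) ler_pM2l // modulusB region_corner.
rewrite (modulus_scale _ (ltW lk0)) modulusM rt1 mul1r ler_pM2l // /far (bigD1 (tproto t)) //= lerDl.
by apply: sumr_ge0 => T _; exact: modulus_ge0.
Qed.

Definition turn_by (d : int) : motion R := Motion 0 (U_norm R n d).

Lemma W_turn d k t : t \in W k -> move_tile (turn_by d) t \in W k.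
Proof.
have sc : motion_scale lambda (turn_by d) = turn_by d.
  by apply: motion_eq => //=; rewrite /scale mulr0.
suff sub : {subset map (move_tile (turn_by d)) (W k) <= W k} by move=> tW; apply: sub; exact: map_f.
elim: k => [|k IH].
  move=> _ /mapP[x /starP[c ->] ->].
  have -> : move_tile (turn_by d) (star_tile 0 c) = star_tile 0 (d + c); last exact: star_mem.
  by congr Tile; apply: motion_eq; rewrite /= ?UM // mulr0 addr0.
by rewrite /W iterS -[X in move_tile X]sc -subst_list_move; exact: subst_list_sub.
Qed.

(** A rotation about the origin by theta permutes the star and commutes with inflation, so it
    preserves every [W k]. *)
Lemma Q_symmetric : rotational_symmetry (2 * n) Q.
Proof.
exists 0.
have angle : 2 * pi / (2 * n)%:R = theta R n :> R.
  rewrite natrM /theta; field; rewrite gt_eqF ?n_gt0R //.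
have rotE z : rotation 0 (2 * pi / (2 * n)%:R) z = motion_fun (turn_by 1) z.
  by rewrite /rotation angle /motion_fun /= /TileFrames.U mul1r subr0 add0r addr0.
have rotS t : rotation 0 (2 * pi / (2 * n)%:R) @` region t = region (move_tile (turn_by 1) t).
  by rewrite region_move; apply/seteqP; split=> z [x hx <-]; exists x.
apply/seteqP; split=> A.
  case=> _ [t [k tW] <-] <-; rewrite rotS; exists (move_tile (turn_by 1) t) => //.
  by exists k; exact: W_turn.
case=> t [k tW] <-; exists (region (move_tile (turn_by (- 1)) t)).
  by exists (move_tile (turn_by (- 1)) t) => //; exists k; exact: W_turn.
rewrite rotS -move_tileM move_tile_id //= ?mulr0 ?addr0 //.
by rewrite UM subrr U0.
Qed.
End Tiling.
End StarTiling.

Import WordDiamond StarTiling.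

Theorem theorem1 (R : realType) (n : nat) (hn : (2 <= n)%N) :
  exists Q : set (tile R n),
    [/\ is_substitution_tiling Q,
        uniformly_recurrent Q &
        rotational_symmetry (2 * n)%N Q].
Proof.
exists (@Q R n hn); split; [|exact: Q_recurrent|exact: Q_symmetric].
split; first exact: Q_tiling.
exists (inflation_factor R n), (@omega R n hn); split; first exact: omega_substitution.
exact: Q_legal.
Qed.
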